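(* Let $n \geq 2$, let $\Omega \subset \mathbb{R}^n$ be a bounded convex domain, and let $u$ be the solution of $$-\Delta u = 1 \quad \text{in } \Omega, \qquad u = 0 \quad \text{on } \partial\Omega.$$ Then $$\max_{x \in \partial \Omega} \frac{\partial u}{\partial \nu}(x) \leq \frac{\sqrt{2}}{\pi}\,|\Omega|^{1/n},$$ where $\nu$ is the interior unit normal on $\partial \Omega$.
   Context: A bounded convex domain is a nonempty bounded open convex subset of $\mathbb{R}^n$. The function $u$ (the torsion function of $\Omega$) is the unique function in $C^2(\Omega)\cap C(\overline{\Omega})$ solving the stated Dirichlet problem. $|\Omega|$ denotes the $n$-dimensional Lebesgue measure of $\Omega$. The interior normal derivative at $x\in\partial\Omega$ is $\frac{\partial u}{\partial \nu}(x) = \lim_{t\to 0^+} \frac{u(x+t\nu(x)) - u(x)}{t}$, where $\nu(x)$ is the unit normal at $x$ pointing into $\Omega$; the inequality asserts the bound at every boundary point $x$ at which the interior unit normal and this derivative are defined. *)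

(* Defs.v *)
From mathcomp Require Export all_boot all_order all_algebra.
From mathcomp Require Export all_classical all_reals all_analysis.

Set Implicit Arguments.
Unset Strict Implicit.
Unset Printing Implicit Defensive.

Import Order.TTheory GRing.Theory Num.Theory.
Import numFieldNormedType.Exports.

Local Open Scope classical_set_scope.
Local Open Scope ring_scope.

(* The topology of ['rV[R]_n] comes from the max norm, which is equivalent to
   the Euclidean norm; where the Euclidean norm itself matters (unit vectors),
   [enorm] is used. *)
Definition dotv (R : realType) (n : nat) (v w : 'rV[R]_n) : R :=
  \sum_(i < n) v 0 i * w 0 i.

Definition enorm (R : realType) (n : nat) (v : 'rV[R]_n) : R :=
  Num.sqrt (dotv v v).

Definition boundary (T : topologicalType) (A : set T) : set T :=
  closure A `\` interior A.

Definition bounded_convex_domain (R : realType) (n : nat)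
    (Omega : set 'rV[R]_n) : Prop :=
  [/\ Omega !=set0, bounded_set Omega, open Omega
    & convex_set (Omega : set (convex_lmodType 'rV[R]_n))].

(* Lebesgue measure on R^n as the n-fold product of the Lebesgue measure on R
   (the unit mass at the empty tuple when n = 0), on [n.-tuple R] with its
   product sigma-algebra, transported to row vectors by [lebesgue_rV]. *)
Fixpoint lebesgue_tuple (R : realType) (n : nat) :
    set (n.-tuple (measurableTypeR R)) -> \bar R :=
  match n with
  | 0 => \d_[tuple]
  | m.+1 => pushforward (lebesgue_measure \x @lebesgue_tuple R m)%E
              (fun p : measurableTypeR R * m.-tuple (measurableTypeR R) =>
                 [tuple of p.1 :: p.2])
  end.

Definition lebesgue_rV (R : realType) (n : nat) (A : set 'rV[R]_n) : \bar R :=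
  lebesgue_tuple [set t | A (\row_(i < n) tnth t i)].

Definition partial (R : realType) (n : nat) (i : 'I_n) (u : 'rV[R]_n -> R) :
    'rV[R]_n -> R := 'D_(delta_mx 0 i) u.

(* [Omega] is meant to be open, so that the derivatives at its points do not
   depend on the values of [u] outside of [Omega]. *)
Definition C2_on (R : realType) (n : nat) (Omega : set 'rV[R]_n)
    (u : 'rV[R]_n -> R) : Prop :=
  forall x, Omega x ->
  [/\ {for x, continuous u},
      forall i, derivable u x (delta_mx 0 i) /\
                {for x, continuous (partial i u)}
    & forall i j, derivable (partial i u) x (delta_mx 0 j) /\
                  {for x, continuous (partial j (partial i u))}].

Definition laplacian (R : realType) (n : nat) (u : 'rV[R]_n -> R)
    (x : 'rV[R]_n) : R := \sum_(i < n) partial i (partial i u) x.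

(* [u] in C^2(Omega) and C(closure Omega) with -Laplacian u = 1 in Omega and
   u = 0 on the boundary; the values of [u] outside of [closure Omega] are
   irrelevant. *)
Definition torsion_function (R : realType) (n : nat) (Omega : set 'rV[R]_n)
    (u : 'rV[R]_n -> R) : Prop :=
  [/\ C2_on Omega u,
      {within closure Omega, continuous u},
      forall x, Omega x -> - laplacian u x = 1
    & forall x, boundary Omega x -> u x = 0].

Definition inward_unit_support (R : realType) (n : nat) (Omega : set 'rV[R]_n)
    (x nu : 'rV[R]_n) : Prop :=
  enorm nu = 1 /\ forall y, Omega y -> 0 <= dotv (y - x) nu.

(* At a boundary point [x] of a convex domain, inner normals are the directions
   of supporting half-spaces; the normal [nu] is defined at [x] when this
   direction is unique. In that case x + t nu lies in the domain for all small
   t > 0. *)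
Definition interior_unit_normal (R : realType) (n : nat)
    (Omega : set 'rV[R]_n) (x nu : 'rV[R]_n) : Prop :=
  inward_unit_support Omega x nu /\
  forall nu', inward_unit_support Omega x nu' -> nu' = nu.

Definition is_normal_derivative (R : realType) (n : nat) (u : 'rV[R]_n -> R)
    (x nu : 'rV[R]_n) (d : R) : Prop :=
  (u (x + t *: nu) - u x) / t @[t --> 0^'+] --> d.

(* Main.v *)
(* Let M be the maximum of u, attained at x0, and L = sqrt (2 M). In a supporting
   half-space of Omega with distance h to its boundary, the one-dimensional profile
   L h - h^2 / 2 dominates u where h <= L; in particular the normal derivative is
   at most L, and it remains to prove that |Omega| >= (pi L / sqrt 2)^n.

   Since u, truncated smoothly near the boundary and extended by 0, has Laplacian
   at least -1, its average over the ball of radius L sqrt n centred at x0 is at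
   least M - n M / (n + 2) = 2 M / (n + 2). For n >= 4 the trivial bound u <= M on
   Omega then gives |Omega| >= 2 omega_n (L sqrt n)^n / (n + 2), which is enough.
   For n = 2, 3 the bound u <= M is replaced, on each ray from x0, by the barrier at
   the point where the ray leaves Omega: the integral of u along the ray with weight
   s^(n - 1) is then compared with a small multiple of that of the indicator of
   Omega. *)

(* The radius [L sqrt n] maximises [r^n (M - r^2 / (2 (n + 2)))], which is, up to the factor
   [omega n], the lower bound that the mean value inequality gives for the integral over a ball of
   radius r. In dimensions 2 and 3 the bound [u <= M] only yields [pi L^2] and about [8.71 L^3],
   short of the required [pi^2 L^2 / 2] and about [10.96 L^3]: too much is lost near the boundary,
   where the barrier forces u to be small. Applied at x0 itself, the barrier also shows that every
   ray from x0 leaves Omega at distance at least L, so in units of L each ray contains a full unit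
   segment.

   Neither the divergence theorem nor a measure on the sphere is used. The mean value inequality
   comes from integration by parts on chords parallel to the axes, with a weight vanishing on the
   sphere; the comparison along rays comes from Tonelli with an auxiliary radial weight. In both,
   the multiple integrals have nonnegative integrands, so that measurability is all that the
   exchanges require. The bound [pi <= 19/6] is exactly what the planar case consumes. *)
Require Import Defs.
From HB Require Import structures.
From mathcomp Require Import measurable_realfun ring lra.
Set Implicit Arguments.
Unset Strict Implicit.
Unset Printing Implicit Defensive.
Import Order.TTheory GRing.Theory Num.Theory.
Import numFieldNormedType.Exports.
Local Open Scope classical_set_scope.
Local Open Scope ring_scope.

(** * Lebesgue measure on tuples *)

Section tuple_measure.
Context {R : realType}.
Notation mR := (measurableTypeR R).
Notation leb := (@lebesgue_measure R).

Definition tuple_cons n (p : mR * n.-tuple mR) : n.+1.-tuple mR :=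
  [tuple of p.1 :: p.2].

Lemma measurable_tuple_cons n : measurable_fun [set: mR * n.-tuple mR] (@tuple_cons n).
Proof. exact: measurable_cons measurable_fst measurable_snd. Qed.

Section step.
Variables (n : nat) (m : {sigma_finite_measure set (n.-tuple mR) -> \bar R}).

Definition lebesgue_cons : set (n.+1.-tuple mR) -> \bar R :=
  pushforward (leb \x m)%E (@tuple_cons n).

Let pf := measure_function_pushforward__canonical__measure_function_Measure
  (leb \x m)%E (@measurable_tuple_cons n).

HB.instance Definition _ := isMeasure.Build _ _ _ lebesgue_cons
  (measure0 pf) (measure_ge0 pf) (@measure_semi_sigma_additive _ _ _ pf).

(** Products of two exhausting sequences, pulled back along [g]; a common index exists because both
    sequences increase. *)
Lemma lebesgue_cons_sigma_finite : sigma_finite setT lebesgue_cons.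
Proof.
have /sigma_finiteP[F [FT ndF Ff]] := sigma_finiteT leb.
have /sigma_finiteP[G [GT ndG Gf]] := sigma_finiteT m.
pose g (t : n.+1.-tuple mR) : mR * n.-tuple mR := (thead t, [tuple of behead t]).
have mg : measurable_fun setT g.
  apply/measurable_fun_pair => /=; [exact: measurable_tnth|exact: measurable_behead].
have gK : cancel (@tuple_cons n) g.
  by move=> [x t]; rewrite /g /tuple_cons /= theadE; congr pair; exact/val_inj.
exists (fun k => g @^-1` (F k `*` G k)).
  rewrite -preimage_bigcup; apply/seteqP; split => //= t _ /=.
  have [k _ Fk] : (\bigcup_i F i) (thead t) by rewrite -FT.
  have [l _ Gl] : (\bigcup_i G i) [tuple of behead t] by rewrite -GT.
  exists (maxn k l) => //=; split.
  - by move: (thead t) Fk; exact/subsetPset/ndF/leq_maxl.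
  - by move: [tuple of behead t] Gl; exact/subsetPset/ndG/leq_maxr.
move=> k; have [mF Fk] := Ff k; have [mG Gk] := Gf k; split.
  by rewrite -[X in measurable X]setTI; apply: mg => //; exact: measurableX.
rewrite /lebesgue_cons /pushforward (_ : _ @^-1` _ = F k `*` G k); last first.
  by rewrite -comp_preimage (_ : g \o @tuple_cons n = id)//; exact/funext/gK.
by rewrite product_measure1E// lte_mul_pinfty// ge0_fin_numE.
Qed.

HB.instance Definition _ := Measure_isSigmaFinite.Build _ _ _ lebesgue_cons
  lebesgue_cons_sigma_finite.

Lemma ge0_integral_lebesgue_cons (f : n.+1.-tuple mR -> \bar R) :
  measurable_fun setT f -> (forall t, 0 <= f t)%E ->
  (\int[lebesgue_cons]_t f t = \int[leb]_x \int[m]_t f [tuple of x :: t])%E.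
Proof.
move=> mf f0.
transitivity (\int[(leb \x m)%E]_p (f \o @tuple_cons n) p)%E.
  rewrite -[RHS](@ge0_integral_pushforward _ _ _ _ _ _ (@measurable_tuple_cons n) (leb \x m)%E setT)//.
rewrite fubini_tonelli1//.
by apply: measurableT_comp => //; exact: measurable_tuple_cons.
by move=> x; exact: f0.
Qed.
End step.

(** The recursion of [lebesgue_tuple], with the measure structure and sigma-finiteness attached at
    each stage, as Tonelli requires. *)
Fixpoint lebesgue_n n : {sigma_finite_measure set (n.-tuple mR) -> \bar R} :=
  match n with
  | 0 => \d_[tuple]
  | m.+1 => lebesgue_cons (lebesgue_n m)
  end.

Lemma lebesgue_nE n : lebesgue_n n = @lebesgue_tuple R n :> (set _ -> _).
Proof. by elim: n => //= n <-. Qed.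

Lemma ge0_integral_lebesgue_nS n (f : n.+1.-tuple mR -> \bar R) :
  measurable_fun setT f -> (forall t, 0 <= f t)%E ->
  (\int[lebesgue_n n.+1]_t f t = \int[leb]_x \int[lebesgue_n n]_t f [tuple of x :: t])%E.
Proof. exact: ge0_integral_lebesgue_cons. Qed.

(** Together with the previous lemma this gives both orders of integration. The exchanges of
    integrals below encode a real parameter as the head of an [n.+1]-tuple. *)
Lemma ge0_integral_lebesgue_nS2 n (f : n.+1.-tuple mR -> \bar R) :
  measurable_fun setT f -> (forall t, 0 <= f t)%E ->
  (\int[lebesgue_n n.+1]_t f t = \int[lebesgue_n n]_t \int[leb]_x f [tuple of x :: t])%E.
Proof.
move=> mf f0; rewrite ge0_integral_lebesgue_nS// -(@fubini_tonelli _ _ _ _ _ _ _ (f \o @tuple_cons n))//.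
- by apply: measurableT_comp => //; exact: measurable_tuple_cons.
- by move=> x; exact: f0.
Qed.

(** Both sides are measures in [A] that agree on half-open intervals, so uniqueness of the Lebesgue
    measure applies. *)
Lemma leb_affine (a b : R) (A : set mR) : 0 < b -> measurable A ->
  (leb A = b%:E * leb ((fun x => a + b * x)%R @^-1` A))%E.
Proof.
move=> b0 mA.
have mg : measurable_fun [set: mR] (fun x : mR => (a + b * x)%R : mR).
  by apply: measurable_funD => //; exact: measurable_funM.
pose pf := measure_function_pushforward__canonical__measure_function_Measure leb mg.
rewrite (@lebesgue_measure_unique _ (mscale (NngNum (ltW b0)) pf))//.
move=> _ [[x y] /= xy <-]; rewrite /mscale/= /pushforward.
rewrite (_ : _ @^-1` _ = `]((x - a) / b)%R, ((y - a) / b)%R]%classic); last first.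
  apply/seteqP; split => z /=; rewrite !in_itv/= ltr_pdivrMr// ler_pdivlMr//;
    by rewrite ltrBlDl lerBrDl [z * b]mulrC.
rewrite !lebesgue_measure_itv/= !lte_fin ltr_pM2r ?invr_gt0// ltrD2r.
case: ifPn => xy'; last by rewrite mule0.
by rewrite -EFinB -EFinM; congr EFin; field; exact: lt0r_neq0.
Qed.

Lemma ge0_integral_leb_affine (a b : R) (f : mR -> \bar R) : 0 < b ->
  measurable_fun setT f -> (forall x, 0 <= f x)%E ->
  (\int[leb]_x f x = b%:E * \int[leb]_x f (a + b * x)%R)%E.
Proof.
move=> b0 mf f0.
have mg : measurable_fun [set: mR] (fun x : mR => (a + b * x)%R : mR).
  by apply: measurable_funD => //; exact: measurable_funM.
pose pf := measure_function_pushforward__canonical__measure_function_Measure leb mg.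
transitivity (\int[mscale (NngNum (ltW b0)) pf]_x f x)%E.
  apply: eq_measure_integral => /= A mA _.
  by rewrite (leb_affine a b0 mA).
rewrite ge0_integral_mscale//=; congr (_ * _)%E.
rewrite (@ge0_integral_pushforward _ _ _ _ _ _ mg leb setT)//.
Qed.

Definition affine_tuple n (a : n.-tuple mR) (b : R) (t : n.-tuple mR) : n.-tuple mR :=
  [tuple (tnth a i + b * tnth t i)%R | i < n].

Lemma measurable_affine_tuple n (a : n.-tuple mR) b :
  measurable_fun [set: n.-tuple mR] (affine_tuple a b).
Proof.
apply/measurable_fun_tnthP => i.
rewrite (_ : _ \o _ = fun t => (tnth a i + b * tnth t i)%R); last first.
  by apply/funext => t /=; rewrite tnth_mktuple.
apply: measurable_funD => //; apply: measurable_funM => //.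
exact: measurable_tnth.
Qed.

(** The affine rule on the line treats the head, the induction hypothesis the tail. It serves to
    recentre at x0, to scale balls and to substitute along rays. *)
Lemma ge0_integral_lebesgue_n_affine n (a : n.-tuple mR) (b : R)
    (f : n.-tuple mR -> \bar R) : 0 < b ->
  measurable_fun setT f -> (forall x, 0 <= f x)%E ->
  (\int[lebesgue_n n]_x f x = (b ^+ n)%:E * \int[lebesgue_n n]_x f (affine_tuple a b x))%E.
Proof.
move=> b0; elim: n a f => [|n IH] a f mf f0.
  rewrite expr0 mul1e; apply: eq_integral => x _; congr f.
  by rewrite [x]tuple0 [RHS]tuple0.
rewrite !ge0_integral_lebesgue_nS//; last first.
  by apply: measurableT_comp => //; exact: measurable_affine_tuple.
have mcons (x : mR) : measurable_fun [set: n.-tuple mR]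
    (fun t => [tuple of x :: t] : n.+1.-tuple mR).
  exact: measurable_cons.
have mF : measurable_fun [set: mR]
    (fun x => \int[lebesgue_n n]_t f [tuple of x :: t])%E.
  apply: (@measurable_fun_fubini_tonelli_F _ _ _ _ _ _ (f \o @tuple_cons n)).
  - by apply: measurableT_comp => //; exact: measurable_tuple_cons.
  - by move=> x; exact: f0.
rewrite (ge0_integral_leb_affine (thead a) b0)//; last first.
  by move=> x; exact: integral_ge0.
rewrite exprS EFinM -muleA; congr (_ * _)%E.
rewrite -ge0_integralZl//; last 3 first.
- have mF' : measurable_fun [set: mR]
      (fun x => \int[lebesgue_n n]_t f (affine_tuple a b [tuple of x :: t]))%E.
    apply: (@measurable_fun_fubini_tonelli_F _ _ _ _ _ _ (f \o affine_tuple a b \o @tuple_cons n)).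
    + apply: measurableT_comp; last exact: measurable_tuple_cons.
      by apply: measurableT_comp => //; exact: measurable_affine_tuple.
    + by move=> x; exact: f0.
  exact: mF'.
- by move=> x _; exact: integral_ge0.
- by rewrite lee_fin exprn_ge0// ltW.
apply: eq_integral => x _.
rewrite (IH [tuple of behead a]); last 2 first.
- exact: measurableT_comp.
- by move=> t; exact: f0.
congr (_ * _)%E; apply: eq_integral => t _; congr f.
apply: eq_from_tnth => i; rewrite tnth_mktuple.
case: (unliftP ord0 i) => [j|] ->.
  rewrite !tnthS tnth_mktuple; congr (_ + _).
  by rewrite [in RHS](tuple_eta a) tnthS.
by rewrite !tnth0.
Qed.

Definition set_coord n (t : n.-tuple mR) (i : 'I_n) (x : mR) : n.-tuple mR :=
  [tuple if j == i then x else tnth t j | j < n].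

(** If [i] is the head, that coordinate is integrated innermost; otherwise the head is integrated
    outermost and the induction hypothesis acts on the tail. This lifts integration by parts in one
    variable to n variables. *)
Lemma le_integral_lines n (i : 'I_n) (f g : n.-tuple mR -> \bar R) :
  measurable_fun setT f -> measurable_fun setT g ->
  (forall t, 0 <= f t)%E -> (forall t, 0 <= g t)%E ->
  (forall t, \int[leb]_x f (set_coord t i x) <= \int[leb]_x g (set_coord t i x))%E ->
  (\int[lebesgue_n n]_t f t <= \int[lebesgue_n n]_t g t)%E.
Proof.
elim: n i f g => [[]//|n IH] i f g mf mg f0 g0 fg.
have mcons (x : mR) : measurable_fun [set: n.-tuple mR]
    (fun t => [tuple of x :: t] : n.+1.-tuple mR).
  exact: measurable_cons.
have mcf h : measurable_fun setT h ->
    measurable_fun [set: mR * n.-tuple mR] (h \o @tuple_cons n : _ -> \bar R).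
  by move=> mh; apply: measurableT_comp => //; exact: measurable_tuple_cons.
case: (unliftP ord0 i) fg => [j|] -> fg.
  rewrite !ge0_integral_lebesgue_nS//; apply: ge0_le_integral => //.
  - by move=> x _; exact: integral_ge0.
  - apply: (@measurable_fun_fubini_tonelli_F _ _ _ _ _ _ (f \o @tuple_cons n)); first exact: mcf.
    by move=> x; exact: f0.
  - apply: (@measurable_fun_fubini_tonelli_F _ _ _ _ _ _ (g \o @tuple_cons n)); first exact: mcf.
    by move=> x; exact: g0.
  move=> x _; apply: (IH j).
  - exact: measurableT_comp.
  - exact: measurableT_comp.
  - by move=> t; exact: f0.
  - by move=> t; exact: g0.
  move=> t; have := fg [tuple of x :: t].
  have E y : set_coord [tuple of x :: t] (lift ord0 j) y = [tuple of x :: set_coord t j y].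
    apply: eq_from_tnth => k; rewrite tnth_mktuple.
    case: (unliftP ord0 k) => [l|] ->.
      by rewrite !tnthS tnth_mktuple (inj_eq lift_inj).
    by rewrite !tnth0.
  by under eq_integral do rewrite E; under [X in (_ <= X)%E]eq_integral do rewrite E.
rewrite !ge0_integral_lebesgue_nS2//; apply: ge0_le_integral => //.
- by move=> x _; exact: integral_ge0.
- apply: (@measurable_fun_fubini_tonelli_G _ _ _ _ _ _ (f \o @tuple_cons n)); first exact: mcf.
  by move=> x; exact: f0.
- apply: (@measurable_fun_fubini_tonelli_G _ _ _ _ _ _ (g \o @tuple_cons n)); first exact: mcf.
  by move=> x; exact: g0.
move=> t _; have := fg [tuple of 0%R :: t].
have E y : set_coord [tuple of 0%R :: t] ord0 y = [tuple of y :: t].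
  apply: eq_from_tnth => k; rewrite tnth_mktuple.
  case: (unliftP ord0 k) => [l|] ->.
    by rewrite !tnthS.
  by rewrite !tnth0.
by under eq_integral do rewrite E; under [X in (_ <= X)%E]eq_integral do rewrite E.
Qed.

End tuple_measure.

(** * Measurability of open sets and continuous functions on row vectors *)

Section row_measurable.
Context {R : realType}.
Notation mR := (measurableTypeR R).

Definition row_of n (t : n.-tuple mR) : 'rV[R]_n := \row_i tnth t i.

(** An open set is the countable union of the rational boxes that it contains, and each box is a
    finite intersection of coordinate conditions. *)
Lemma measurable_open_row_of n (A : set 'rV[R]_n) : open A ->
  measurable ((@row_of n) @^-1` A).
Proof.
move=> oA.
pose box (p : n.-tuple rat * nat) := [set t : n.-tuple mR |
  forall i, `|tnth t i - ratr (tnth p.1 i)| < p.2.+1%:R^-1].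
have mbox p : measurable (box p).
  rewrite (_ : box p = \bigcap_(i in [set: 'I_n])
    (fun t : n.-tuple mR => tnth t i) @^-1`
      [set x : mR | `|x - ratr (tnth p.1 i)| < p.2.+1%:R^-1]); last first.
    by apply/seteqP; split => t /= H i => [_|]; exact: H.
  apply: fin_bigcap_measurable => // i _.
  rewrite -[X in measurable X]setTI; apply: measurable_tnth => //.
  rewrite (_ : [set _ | _] = ball (ratr (tnth p.1 i) : R) (p.2.+1%:R^-1)).
    exact: measurable_ball.
  by apply/seteqP; split => x /=; rewrite /ball/= distrC.
pose D := [set p | box p `<=` (@row_of n) @^-1` A].
rewrite (_ : _ @^-1` _ = \bigcup_p (if p \in D then box p else set0)).
  apply: countable_bigcupT_measurable => [|p]; first exact: countableP.
  by case: ifPn.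
apply/seteqP; split => [t /= At|t [p _]]; last first.
  by case: ifPn => // /set_mem pD; exact: pD.
have /nbhs_ballP[e /= e0 He] := open_nbhs_nbhs (conj oA At).
(* Two points of a box of half-width 1/(k+1) differ by less than 2/(k+1) in each coordinate, so a
   box of this size containing t stays in the ball. *)
have [k ke] : exists k, 2%:R * k.+1%:R^-1 < e :> R.
  exists (Num.truncn (2 / e)).
  by rewrite ltr_pdivrMr// mulrC -ltr_pdivrMr// truncnS_gt.
have k0 : 0 < k.+1%:R^-1 :> R by rewrite invr_gt0.
have aux (x y d : R) : x - d < y -> y < x + d -> `|x - y| < d.
  by move=> ? ?; rewrite ltr_distl; apply/andP; split; lra.
have qP i : exists q : rat, `|tnth t i - ratr q| < k.+1%:R^-1.
  have [q] : exists q, ratr q \in `](tnth t i - k.+1%:R^-1), (tnth t i + k.+1%:R^-1)[.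
    by apply: rat_in_itvoo; rewrite ltrBlDr -addrA ltrDl addr_gt0.
  rewrite in_itv/= => /andP[q1 q2]; exists q.
  exact: aux q1 q2.
pose q : n.-tuple rat := [tuple projT1 (cid (qP i)) | i < n].
exists (q, k) => //; rewrite ifT//; last first.
  rewrite inE => s /= Hs; apply: He; split => // i j; rewrite !mxE /ball/=.
  have Hq : `|tnth t j - ratr (tnth q j)| < k.+1%:R^-1.
    by rewrite tnth_mktuple; case: cid.
  apply: lt_trans ke.
  rewrite (_ : _ - _ = (tnth t j - ratr (tnth q j)) - (tnth s j - ratr (tnth q j))).
    by rewrite (le_lt_trans (ler_normB _ _))// mulr_natl mulr2n ltrD//; exact: Hs.
  by rewrite opprB addrA subrK.
by move=> i /=; rewrite tnth_mktuple; case: cid.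
Qed.

Lemma measurable_continuous_row_of n (f : 'rV[R]_n -> R) : continuous f ->
  measurable_fun [set: n.-tuple mR] (f \o @row_of n).
Proof.
move=> cf mD; apply: (measurability _ (RGenOInfty.measurableE R)) => //.
move=> /= _ [_ [x ->] <-]; rewrite setTI comp_preimage.
apply: measurable_open_row_of; apply: open_comp => [y _|]; first exact: cf.
exact: interval_open.
Qed.
End row_measurable.

(** * Volume of the unit ball *)

Section derive_fun.
Context {R : realType} {V : normedModType R}.
Implicit Types (f g : V -> R) (x v : V).

(** Pointwise forms of the differentiation rules: derivatives of explicit formulas are assembled
    from them as terms, and the resulting value is then normalised by [field] or [ring]. *)
Lemma is_deriveD_fun f g x v df dg : is_derive x v f df -> is_derive x v g dg ->
  is_derive x v (fun y => f y + g y) (df + dg).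
Proof. exact: is_deriveD. Qed.

Lemma is_deriveB_fun f g x v df dg : is_derive x v f df -> is_derive x v g dg ->
  is_derive x v (fun y => f y - g y) (df - dg).
Proof. exact: is_deriveB. Qed.

Lemma is_deriveM_fun f g x v df dg : is_derive x v f df -> is_derive x v g dg ->
  is_derive x v (fun y => f y * g y) (df * g x + f x * dg).
Proof.
move=> hf hg; apply: (is_derive_eq (is_deriveM hf hg)).
by rewrite /GRing.scale/= addrC mulrC.
Qed.

Lemma is_deriveX_fun f x v df n : is_derive x v f df ->
  is_derive x v (fun y => f y ^+ n) (n%:R * f x ^+ n.-1 * df).
Proof. by move=> hf; have := is_deriveX n hf; rewrite exprfctE. Qed.
End derive_fun.

Lemma is_derive_continuous {R : realType} (f df : R -> R) :
  (forall x, is_derive x (1 : R) f (df x)) -> continuous f.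
Proof.
move=> h x; apply: differentiable_continuous; apply/derivable1_diffP.
exact: ex_derive.
Qed.

Section wallis.
Context {R : realType}.
Notation leb := (@lebesgue_measure R).

(** The derivative is required only inside the interval because the antiderivative in [wallisSS]
    involves [circ], which is not differentiable at -1 and 1. *)
Lemma continuous_FTC (F f : R -> R) (a b : R) : a <= b -> continuous f ->
  continuous F -> (forall x, a < x < b -> is_derive x 1 F (f x)) ->
  (\int[leb]_(x in `[a, b]) (f x)%:E = (F b - F a)%:E)%E.
Proof.
rewrite le_eqVlt => /predU1P[<- _ _ _|ab cf cF dF].
  by rewrite set_itv1 integral_set1 subrr.
rewrite EFinB; apply: continuous_FTC2 => //.
- by apply: continuous_in_subspaceT => x _; exact: cf.
- split.
  + by move=> x; rewrite in_itv/= => /dF h; exact: ex_derive.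
  + by apply: cvg_at_right_filter; exact: cF.
  + by apply: cvg_at_left_filter; exact: cF.
- by move=> x; rewrite in_itv/= => /dF h; rewrite derive1E; exact: derive_val.
Qed.

Lemma integrable_itv_continuous (f : R -> R) (a b : R) : continuous f ->
  leb.-integrable `[a, b] (EFin \o f).
Proof.
move=> cf; apply: continuous_compact_integrable; first exact: segment_compact.
by apply: continuous_in_subspaceT => x _; exact: cf.
Qed.

(** Radius of the slice of the unit ball at height x. The square root of a negative number being 0,
    it vanishes for |x| >= 1 and is continuous on the whole line. *)
Definition circ (x : R) := Num.sqrt (1 - x ^+ 2).

Lemma continuous_circ : continuous circ.
Proof.
move=> x; apply: (@continuous_comp _ _ _ (fun x : R => 1 - x ^+ 2) Num.sqrt).
  by apply: cvgB; [exact: cvg_cst|exact: exprn_continuous].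
exact: sqrt_continuous.
Qed.

Lemma continuous_circX n : continuous (fun x => circ x ^+ n).
Proof.
move=> x; apply: (@continuous_comp _ _ _ circ (fun y => y ^+ n)).
  exact: continuous_circ.
exact: exprn_continuous.
Qed.

Lemma circ2 (x : R) : -1 <= x <= 1 -> circ x ^+ 2 = 1 - x ^+ 2.
Proof. by move=> x1; rewrite sqr_sqrtr//; nra. Qed.

Lemma is_derive_circ (x : R) : -1 < x < 1 -> is_derive x 1 circ (- x / circ x).
Proof.
move=> x1; have p0 : 0 < 1 - x ^+ 2 by nra.
have c0 : 0 < circ x by rewrite sqrtr_gt0.
have h := is_derive1_sqrt p0.
have h2 : is_derive x 1 (fun x : R => 1 - x ^+ 2) (- (2 * x)).
  by apply: is_derive_eq; rewrite /GRing.scale/=; ring.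
have := @is_derive1_comp _ Num.sqrt (fun x : R => 1 - x ^+ 2) x _ _ h h2.
rewrite -/(circ x) => h3; apply: (is_derive_eq h3); field.
exact: lt0r_neq0.
Qed.

(** Ratio of the volumes of the unit balls of dimensions n + 1 and n; a Wallis integral after the
    substitution x = sin t. *)
Definition wallis n := (\int[leb]_(x in `[(-1 : R), 1]) circ x ^+ n)%R.

Lemma wallisE n : (\int[leb]_(x in `[(-1)%R, 1%R]) (circ x ^+ n)%:E = (wallis n)%:E)%E.
Proof.
rewrite /wallis /Rintegral fineK//.
by apply: integrable_fin_num => //; apply: integrable_itv_continuous; exact: continuous_circX.
Qed.

Lemma wallis0 : wallis 0 = 2.
Proof.
rewrite /wallis; under eq_Rintegral do rewrite expr0.
rewrite Rintegral_cst//= lebesgue_measure_itv/= lte_fin mul1r.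
by rewrite ifT -?EFinB//=; lra.
Qed.

(** The function x circ(x)^(n+2) vanishes at both endpoints and, since x^2 = 1 - circ(x)^2, its
    derivative is (n+3) circ(x)^(n+2) - (n+2) circ(x)^n. *)
Lemma wallisSS n : (n.+3)%:R * wallis n.+2 = n.+2%:R * wallis n.
Proof.
apply/eqP; rewrite -subr_eq0; apply/eqP.
pose f (x : R) := n.+3%:R * circ x ^+ n.+2 - n.+2%:R * circ x ^+ n.
have cf k (c : R) : continuous (fun x => c * circ x ^+ k).
  by move=> x; apply: cvgM; [exact: cvg_cst|exact: continuous_circX].
have := @continuous_FTC (fun x => x * circ x ^+ n.+2) f (-1) 1.
have -> : (\int[leb]_(x in `[(-1)%R, 1%R]) (f x)%:E =
  (n.+3%:R * wallis n.+2 - n.+2%:R * wallis n)%:E)%E.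
  rewrite EFinB !EFinM -!wallisE -!integralZl//; last 2 first.
  - by apply: integrable_itv_continuous; exact: continuous_circX.
  - by apply: integrable_itv_continuous; exact: continuous_circX.
  rewrite -integralB//.
  - by apply: (@integrable_itv_continuous (fun x => n.+3%:R * circ x ^+ n.+2)); exact: cf.
  - by apply: (@integrable_itv_continuous (fun x => n.+2%:R * circ x ^+ n)); exact: cf.
have c1 : circ 1 = 0 by rewrite /circ expr1n subrr sqrtr0.
have c1' : circ (-1) = 0 by rewrite /circ sqrrN expr1n subrr sqrtr0.
rewrite c1 c1' expr0n/= !mulr0 subrr => E; apply: EFin_inj; apply: E; first lra.
- by move=> x; apply: cvgB; exact: cf.
- by move=> x; apply: cvgM; [exact: cvg_id|exact: continuous_circX].
- move=> x x1; have h := is_derive_circ x1.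
  have c0 : circ x != 0 by rewrite sqrtr_eq0 -ltNge; nra.
  apply: (is_derive_eq (is_deriveM_fun (is_derive_id x 1) (is_deriveX_fun n.+2 h))).
  have xx : x * x = 1 - circ x * circ x by rewrite -!expr2 circ2 ?subKr//; lra.
  rewrite /f mul1r /= !exprS; set k := circ x ^+ n.
  have -> : x * (n.+2%:R * (circ x * k) * (- x / circ x)) = - (n.+2%:R * k * (x * x)).
    by field.
  by rewrite xx; ring.
Qed.

(** Substitution x = sin t turns the integrand into cos^2 t, with primitive (t + sin t cos t) /
    2. *)
Lemma wallis1 : wallis 1 = pi / 2.
Proof.
have p0 : 0 < pi / 2 :> R by rewrite divr_gt0 ?pi_gt0.
have c0 (t : R) : - (pi / 2) <= t <= pi / 2 -> 0 <= cos t by exact: cos_ge0_pihalf.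
have dsin : derive1 (sin : R -> R) = cos.
  by apply/funext => t; rewrite derive1E; exact: derive_val.
apply: EFin_inj; rewrite -wallisE.
have -> : (\int[leb]_(x in `[(-1)%R, 1%R]) (circ x ^+ 1)%:E =
    \int[leb]_(x in `[(sin (- (pi / 2))), (sin (pi / 2))]) (circ x)%:E)%E.
  by rewrite sinN sin_pihalf; under eq_integral do rewrite expr1.
rewrite (@integration_by_substitution_increasing _ sin circ); first last.
- by apply: continuous_in_subspaceT => x _; exact: continuous_circ.
- split; [by move=> x _; exact: ex_derive| |].
    by apply: cvg_at_right_filter; exact: continuous_sin.
  by apply: cvg_at_left_filter; exact: continuous_sin.
- by rewrite dsin; apply: cvgP; apply: cvg_at_left_filter; exact: continuous_cos.
- by rewrite dsin; apply: cvgP; apply: cvg_at_right_filter; exact: continuous_cos.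
- by rewrite dsin => x _; exact: continuous_cos.
- by move=> x y /= xi yi xy; rewrite ltr_sin.
- lra.
rewrite dsin.
have -> : (\int[leb]_(x in `[(- (pi / 2))%R, (pi / 2)%R]) (((circ \o sin) * cos) x)%:E =
    \int[leb]_(x in `[(- (pi / 2))%R, (pi / 2)%R]) (cos x * cos x)%:E)%E.
  apply: eq_integral => x; rewrite inE/= in_itv/= => xi; congr EFin.
  change (circ (sin x) * cos x = cos x * cos x); congr (_ * _).
  by rewrite /circ -cos2sin2 sqrtr_sqr ger0_norm// c0.
pose F (x : R) := (x + sin x * cos x) / 2.
transitivity ((F (pi / 2) - F (- (pi / 2)))%:E)%E; last first.
  by rewrite /F cosN sinN cos_pihalf; congr EFin; field.
apply: continuous_FTC.
- lra.
- by move=> x; apply: cvgM; exact: continuous_cos.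
- move=> x; apply: cvgM; last exact: cvg_cst.
  by apply: cvgD; [exact: cvg_id|apply: cvgM; [exact: continuous_sin|exact: continuous_cos]].
- move=> x _.
  have h := is_deriveD_fun (is_derive_id x (1:R)) (is_deriveM_fun (is_derive_sin x) (is_derive_cos x)).
  apply: (is_derive_eq (is_deriveM_fun h (is_derive_cst (2^-1:R) x 1))).
  have := cos2Dsin2 x; rewrite /cst => E; nra.
Qed.

(** By the two-step recursion the left side does not depend on n; its value is read off at n = 0. *)
Lemma wallisM n : n.+2%:R * (wallis n.+1 * wallis n) = 2 * pi.
Proof.
elim: n => [|n IH]; first by rewrite wallis0 wallis1; field.
by rewrite -IH mulrA wallisSS; ring.
Qed.
End wallis.

Section ball_volume.
Context {R : realType}.
Notation mR := (measurableTypeR R).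
Notation leb := (@lebesgue_measure R).

Definition sqnorm n (t : n.-tuple mR) : R := \sum_(i < n) tnth t i ^+ 2.

Lemma sqnorm_ge0 n (t : n.-tuple mR) : 0 <= sqnorm t.
Proof. by apply: sumr_ge0 => i _; exact: sqr_ge0. Qed.

Lemma sqnorm_cons n (x : mR) (t : n.-tuple mR) :
  sqnorm [tuple of x :: t] = x ^+ 2 + sqnorm t.
Proof.
rewrite /sqnorm big_ord_recl tnth0; congr (_ + _).
by apply: eq_bigr => i _; rewrite tnthS.
Qed.

Lemma sqnorm_affine_tuple0 n (b : R) (t : n.-tuple mR) :
  sqnorm (affine_tuple [tuple of nseq n 0] b t) = b ^+ 2 * sqnorm t.
Proof.
rewrite /sqnorm mulr_sumr; apply: eq_bigr => i _.
by rewrite tnth_mktuple tnth_nseq add0r exprMn.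
Qed.

Lemma measurable_sqnorm n : measurable_fun [set: n.-tuple mR] (@sqnorm n).
Proof.
rewrite /sqnorm; apply: measurable_sum => i; apply: measurable_funX.
exact: measurable_tnth.
Qed.

(** [c] is the square of the radius, which keeps square roots out of the membership condition. *)
Definition tuple_ball n (c : R) := [set t : n.-tuple mR | sqnorm t < c].
Arguments tuple_ball : clear implicits.

Lemma measurable_tuple_ball n c : measurable (tuple_ball n c).
Proof.
rewrite (_ : tuple_ball n c = (@sqnorm n) @^-1` `]-oo, c[); last first.
  by apply/seteqP; split=> t; rewrite /tuple_ball/= in_itv.
by rewrite -[X in measurable X]setTI; exact: measurable_sqnorm.
Qed.

Lemma lebesgue_n_integral_indic n (A : set (n.-tuple mR)) : measurable A ->
  (lebesgue_n n A = \int[lebesgue_n n]_t (\1_A t)%:E)%E.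
Proof. by move=> mA; rewrite integral_indic// setIT. Qed.

Lemma measurable_tuple_indic n (A : set (n.-tuple mR)) : measurable A ->
  measurable_fun setT (fun t => (\1_A t)%:E : \bar R).
Proof. by move=> mA; apply/measurable_EFinP; exact: measurable_indic. Qed.

Lemma lebesgue_n_tuple_ball_scale n (b : R) : 0 < b ->
  (lebesgue_n n (tuple_ball n (b ^+ 2)) = (b ^+ n)%:E * lebesgue_n n (tuple_ball n 1))%E.
Proof.
move=> b0; have mb := @measurable_tuple_ball n.
rewrite -(setIT (tuple_ball n (b ^+ 2))) -(setIT (tuple_ball n 1)) -!integral_indic//.
rewrite (ge0_integral_lebesgue_n_affine [tuple of nseq n 0] b0)//; last first.
  by apply/measurable_EFinP; exact: measurable_indic.
congr (_ * _)%E; apply: eq_integral => t _; congr EFin; congr (nat_of_bool _)%:R.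
apply/idP/idP; rewrite !inE /tuple_ball/= sqnorm_affine_tuple0 gtr_pMr//; exact: exprn_gt0.
Qed.

(** Volume of the unit ball obtained by slicing, in place of the formula with the Gamma function. *)
Fixpoint omega n : R := if n is m.+1 then omega m * wallis m else 1.

Lemma lebesgue_n_tuple_ball n : lebesgue_n n (tuple_ball n 1) = (omega n)%:E.
Proof.
elim: n => [|n IH].
  rewrite /= diracE mem_set//= /tuple_ball/= /sqnorm big_ord0; exact: ltr01.
have mb := @measurable_tuple_ball.
have -> : lebesgue_n n.+1 (tuple_ball n.+1 1) =
    (\int[lebesgue_n n.+1]_t (\1_(tuple_ball n.+1 1) t)%:E)%E.
  exact: lebesgue_n_integral_indic.
rewrite ge0_integral_lebesgue_nS//; last first.
    have := measurable_tuple_indic (mb n.+1 1); apply.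
have -> : (\int[leb]_x \int[lebesgue_n n]_t (\1_(tuple_ball n.+1 1) [tuple of x :: t])%:E =
    \int[leb]_(x in `](-1)%R, 1%R[) ((omega n)%:E * (circ x ^+ n)%:E))%E.
  rewrite [RHS]integral_mkcond; apply: eq_integral => x _.
  have E : (\int[lebesgue_n n]_t (\1_(tuple_ball n.+1 1) [tuple of x :: t])%:E =
      lebesgue_n n (tuple_ball n (1 - x ^+ 2)))%E.
    rewrite lebesgue_n_integral_indic//; apply: eq_integral => t _.
    congr EFin; congr (nat_of_bool _)%:R.
    by apply/idP/idP; rewrite !inE /tuple_ball/= sqnorm_cons ltrBrDl.
  rewrite E patchE; case: ifPn => [|/negP]; rewrite inE/= in_itv/= => x1.
    have x1' : 0 < 1 - x ^+ 2 by move: x1; nra.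
    have c0 : 0 < circ x by rewrite sqrtr_gt0.
    by rewrite -circ2; [rewrite lebesgue_n_tuple_ball_scale// IH muleC|lra].
  rewrite (_ : tuple_ball _ _ = set0) ?measure0//; apply/seteqP; split=> // t.
  rewrite /tuple_ball/= => h; have := sqnorm_ge0 t => h2.
  have : x ^+ 2 < 1 by lra.
  by exfalso; apply: x1; apply/andP; split; nra.
have mc : measurable_fun (`](-1)%R, 1%R[%classic : set mR) (fun x : mR => (circ x ^+ n)%:E).
  apply/measurable_EFinP; apply: measurable_funTS; apply: continuous_measurable_fun.
  exact: continuous_circX.
rewrite integralZl//; last first.
  apply: (integrableS _ _ _ (integrable_itv_continuous (-1) 1 (@continuous_circX R n))) => //.
  exact: subset_itv_oo_cc.
by rewrite -(@integral_itv_bndoo _ _ _ _ true false)// wallisE.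
Qed.

Lemma wallis_gt0 n : 0 < wallis n :> R.
Proof.
have [//] : 0 < wallis n :> R /\ 0 < wallis n.+1 :> R.
elim: n => [|n [h1 h2]]; first by rewrite wallis0 wallis1 divr_gt0 ?pi_gt0.
split=> //; rewrite -(pmulr_rgt0 _ (_ : 0 < n.+3%:R)) ?ltr0n// wallisSS.
by rewrite mulr_gt0.
Qed.

Lemma omega_gt0 n : 0 < omega n.
Proof. by elim: n => //= n IH; rewrite mulr_gt0// wallis_gt0. Qed.

Lemma omegaSS n : n.+2%:R * omega n.+2 = 2 * pi * omega n.
Proof. by rewrite -(wallisM n) /=; ring. Qed.

Lemma omega2 : omega 2 = pi.
Proof. by rewrite /= wallis0 wallis1; field. Qed.

Lemma omega3 : omega 3 = 4 / 3 * pi.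
Proof.
have := omegaSS 1; rewrite /= wallis0 => h.
by apply: (@mulfI _ 3); rewrite // h; field.
Qed.
End ball_volume.
Arguments tuple_ball {R} n c.

(** * An upper bound for pi, and the numerical inequality for dimensions at least 4 *)

Section pi_omega.
Context {R : realType}.

Lemma derive_ge0_le (f df : R -> R) (a b : R) : a <= b -> continuous f ->
  (forall x, a < x < b -> is_derive x 1 f (df x)) ->
  (forall x, a < x < b -> 0 <= df x) -> f a <= f b.
Proof.
rewrite le_eqVlt => /predU1P[<-//|ab] cf dF df0.
have dF' x : x \in `]a, b[ -> is_derive x 1 f (df x) by rewrite in_itv/=; exact: dF.
have cF' : {within `[a, b], continuous f}.
  by apply: continuous_in_subspaceT => x _; exact: cf.
have [c] := MVT ab dF' cF'.
rewrite in_itv/= => ci E; rewrite -subr_ge0 E mulr_ge0 ?subr_ge0//; last exact: ltW.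
exact: df0.
Qed.

Lemma sin_le_id (x : R) : 0 <= x -> sin x <= x.
Proof.
move=> x0; rewrite -subr_ge0.
have := @derive_ge0_le (fun y => y - sin y) (fun y => 1 - cos y) 0 x x0.
rewrite sin0 subr0; apply.
- by move=> y; apply: cvgB; [exact: cvg_id|exact: continuous_sin].
- by move=> y _; rewrite subr_ge0 cos_le1.
Qed.

(** Half-angle formula and sin y <= y for y = x/2. Squaring requires sin y >= 0; if sin y < 0 then y
    > pi >= 2, and the left side is already below -1. *)
Lemma cos_ge_quad (x : R) : 0 <= x -> 1 - x ^+ 2 / 2 <= cos x.
Proof.
move=> x0; have x2 : 0 <= x / 2 by rewrite divr_ge0.
have -> : cos x = 1 - 2 * sin (x / 2) ^+ 2.
  have -> : cos x = cos (x / 2 + x / 2) by congr cos; field.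
  by rewrite cosD; have := cos2Dsin2 (x / 2); lra.
have := sin_le_id x2; have [s0|s0] := leP 0 (sin (x / 2)); first by nra.
have := @sin_ge0_pi R (x / 2); have [xp|xp] := leP (x / 2) pi.
  by rewrite x2 => /(_ isT); lra.
have := sin_geN1 (x / 2); have := @pi_ge2 R; nra.
Qed.

Lemma sin_ge_cub (x : R) : 0 <= x -> x - x ^+ 3 / 6 <= sin x.
Proof.
move=> x0; rewrite -subr_ge0.
have := @derive_ge0_le (fun y => sin y - (y - y ^+ 3 * 6^-1))
  (fun y => cos y - (1 - y ^+ 2 / 2)) 0 x x0.
rewrite sin0 expr0n/= mul0r !subr0 opprD; apply.
- move=> y; apply: cvgB; [exact: continuous_sin|apply: cvgB; [exact: cvg_id|]].
  by apply: cvgM; [exact: exprn_continuous|exact: cvg_cst].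
- move=> y _.
  have h := is_deriveM_fun (is_deriveX_fun 3 (is_derive_id y (1:R))) (is_derive_cst (6^-1:R) y 1).
  apply: (is_derive_eq (is_deriveB_fun (is_derive_sin y) (is_deriveB_fun (is_derive_id y (1:R)) h))).
  by rewrite /cst/=; field.
- by move=> y /andP[y0 _]; rewrite subr_ge0 cos_ge_quad// ltW.
Qed.

(** If pi > 19/6 then cos(19/12) > 0, whereas two angle doublings starting from the cubic lower
    bound for sin(19/48) make cos(19/12) negative. *)
Lemma pi_le : pi <= 19 / 6 :> R.
Proof.
rewrite leNgt; apply/negP => p.
have c0 (x : R) : 0 < x < pi / 2 -> 0 < cos x.
  by move=> xp; apply: cos_gt0_pihalf; have := @pi_gt0 R; lra.
have c1 : 0 < cos (19 / 12 : R) by apply: c0; lra.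
have c2 : 0 < cos (19 / 24 : R) by apply: c0; lra.
have h (x : R) : cos (x + x) = 1 - 2 * sin x ^+ 2 /\ cos (x + x) = 2 * cos x ^+ 2 - 1.
  by rewrite cosD; have := cos2Dsin2 x; split; lra.
have e1 : 19 / 12 = 19 / 24 + 19 / 24 :> R by lra.
have e2 : 19 / 24 = 19 / 48 + 19 / 48 :> R by lra.
have [_ h1] := h (19 / 24); have [h2 _] := h (19 / 48).
rewrite -e1 in h1; rewrite -e2 in h2.
have := @sin_ge_cub (19 / 48); have x0 : 0 <= 19 / 48 :> R by lra.
move=> /(_ x0) s1.
have s2 : 385 / 1000 <= sin (19 / 48 : R) by apply: le_trans s1; lra.
have : cos (19 / 24 : R) <= 704 / 1000 by rewrite h2; nra.
by move=> ?; nra.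
Qed.

Let s : R := pi / Num.sqrt 2.

Lemma pi_sqrt2_sq : s ^+ 2 = pi ^+ 2 / 2.
Proof. by rewrite expr_div_n sqr_sqrtr. Qed.

Lemma pi_sqrt2_gt0 : 0 < s.
Proof. by rewrite divr_gt0 ?pi_gt0// sqrtr_gt0. Qed.

Lemma bernoulli_le (x : R) n : 0 <= x -> 1 + n%:R * x <= (1 + x) ^+ n.
Proof.
move=> x0; elim: n => [|n IH]; first by rewrite mul0r addr0 expr0.
rewrite exprS -natr1; apply: (@le_trans _ _ ((1 + x) * (1 + n%:R * x))).
  by have n0 : 0 <= n%:R :> R by []; nra.
by rewrite ler_wpM2l//; lra.
Qed.

(** Induction in steps of two, following [omegaSS]. From n to n + 2 the left side is multiplied by
    (pi^2 / 2) (n + 4) / (n + 2), the right side by 2 pi (1 + 2/n)^(n/2), which is at least 3 pi.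
    The inequality fails for m = 2 and m = 3. *)
Lemma omega_ge m : (4 <= m)%N ->
  s ^+ m * (m.+2%:R / 2) <= omega m * Num.sqrt m%:R ^+ m.
Proof.
have s2 := pi_sqrt2_sq; have s0 := pi_sqrt2_gt0.
have ps := @pi_le; have pg := @pi_ge2 R.
suff H k : s ^+ (k + 4) * ((k + 4).+2%:R / 2) <= omega (k + 4) * Num.sqrt (k + 4)%:R ^+ (k + 4) /\
    s ^+ (k + 5) * ((k + 5).+2%:R / 2) <= omega (k + 5) * Num.sqrt (k + 5)%:R ^+ (k + 5).
  by move=> m4; have [+ _] := H (m - 4)%N; rewrite subnK.
elim: k => [|k [IH1 IH2]].
  rewrite !add0n; split.
    have o4 : omega 4 = pi ^+ 2 / 2 :> R.
      by apply: (@mulfI _ 4%:R); rewrite ?pnatr_eq0// omegaSS omega2; field.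
    have -> : s ^+ 4 = (s ^+ 2) ^+ 2 by rewrite -exprM.
    have -> : Num.sqrt 4 ^+ 4 = 16 :> R.
      by rewrite (_ : 4%N = (2 * 2)%N)// (exprM _ 2 2) sqr_sqrtr//; ring.
    have P1 : pi ^+ 2 <= 361 / 36 :> R by nra.
    have P0 : 0 <= pi ^+ 2 :> R by exact: sqr_ge0.
    rewrite o4 s2 (_ : 6%:R / 2 = 3 :> R); last by lra.
    move: (pi ^+ 2) P1 P0 => P P1 P0; nra.
  have o5 : omega 5 = 8 * pi ^+ 2 / 15 :> R.
    by apply: (@mulfI _ 5%:R); rewrite ?pnatr_eq0// omegaSS omega3; field.
  have q2 : 2 <= Num.sqrt 5 :> R by rewrite -[X in X <= _]ger0_norm// -sqrtr_sqr ler_sqrt//; lra.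
  have s94 : s <= 9 / 4.
    rewrite leNgt; apply/negP => h; have : 81 / 16 < s ^+ 2 by nra.
    by rewrite s2; nra.
  have s3 : s ^+ 3 <= (9 / 4) ^+ 3 by rewrite lerXn2r ?nnegrE//; lra.
  have -> : s ^+ 5 = pi ^+ 2 / 2 * s ^+ 3 by rewrite -s2 -exprD.
  have -> : Num.sqrt 5 ^+ 5 = 25 * Num.sqrt 5 :> R.
    by rewrite (exprD _ (2 * 2) 1) expr1 exprM sqr_sqrtr//; congr (_ * _); ring.
  rewrite o5; have p2 : 0 < pi ^+ 2 :> R by rewrite exprn_gt0// pi_gt0.
  have : s ^+ 3 * (7 / 4) <= 40 / 3 * Num.sqrt 5 by lra.
  by move=> h; nra.
split; first by move: IH2; rewrite addSnnS.
rewrite !addSnnS; move: IH1; set n := (k + 4)%N.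
rewrite (_ : (k + 6)%N = n.+2); last by rewrite /n !addnS.
move=> IH.
have n4 : (4 <= n)%N by rewrite /n addnC.
have n0 : 0 < n%:R :> R by rewrite ltr0n (leq_trans _ n4).
have N4 : 4 <= n%:R :> R by rewrite ler_nat.
pose q : R := Num.sqrt n%:R; pose q2 : R := Num.sqrt n.+2%:R.
rewrite -/q in IH; rewrite -/q2.
have q0 : 0 < q by rewrite sqrtr_gt0.
have q20 : 0 < q2 by rewrite sqrtr_gt0 ltr0n.
(* After squaring this is (1 + 2/n)^n >= 9/4, and Bernoulli even gives 3. *)
have Q : 3 / 2 * q ^+ n <= q2 ^+ n.
  rewrite -(@ler_pXn2r _ 2)// ?nnegrE ?mulr_ge0 ?exprn_ge0 ?(ltW q0) ?(ltW q20)//.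
  rewrite exprMn -!exprM !(mulnC n) !exprM !sqr_sqrtr ?ler0n//.
  have -> : n.+2%:R = n%:R * (1 + 2 / n%:R) :> R.
    by rewrite -addn2 natrD; field; exact: lt0r_neq0.
  rewrite [X in _ <= X]exprMn [X in X <= _]mulrC ler_wpM2l ?exprn_ge0 ?ler0n//.
  have x0 : 0 <= 2 / n%:R :> R by rewrite divr_ge0.
  apply: le_trans (bernoulli_le n x0).
  by rewrite mulrCA divff ?lt0r_neq0//; lra.
have o := @omegaSS R n; have og := @omega_gt0 R n.
have -> : omega n.+2 * q2 ^+ n.+2 = 2 * pi * omega n * q2 ^+ n.
  have q22 : q2 ^+ 2 = n.+2%:R by rewrite sqr_sqrtr// ler0n.
  by rewrite -(addn2 n) exprD addn2 q22 -o; ring.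
have -> : s ^+ n.+2 = s ^+ n * (pi ^+ 2 / 2) by rewrite -s2 -exprD addn2.
have sn0 : 0 < s ^+ n by rewrite exprn_gt0.
have qn0 : 0 < q ^+ n by rewrite exprn_gt0.
apply: (@le_trans _ _ (2 * pi * omega n * (3 / 2 * q ^+ n))); last first.
  by rewrite ler_wpM2l// ltW// !mulr_gt0// pi_gt0.
apply: (@le_trans _ _ (3 * pi * (s ^+ n * (n.+2%:R / 2)))); last first.
  rewrite (_ : 2 * pi * _ * _ = 3 * pi * (omega n * q ^+ n)); last by field.
  by rewrite ler_wpM2l// mulr_ge0// pi_ge0.
rewrite (_ : 3 * pi * _ = s ^+ n * (3 * pi * (n.+2%:R / 2))); last by ring.
rewrite -mulrA ler_wpM2l ?(ltW sn0)//.
rewrite -(addn4 n) -(addn2 n) (natrD _ n 4) (natrD _ n 2).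
have P1 : pi ^+ 2 <= 19 / 6 * pi :> R by rewrite expr2 ler_wpM2r// pi_ge0.
have p0 : 0 <= pi :> R by exact: pi_ge0.
(* After division by pi what remains is pi (n + 4) <= 6 (n + 2), which follows from pi <= 19/6 and n
   >= 4. *)
clear - P1 p0 N4; move: (pi ^+ 2) P1 => P P1; set p : R := pi in P1 p0 *; set N : R := n%:R in N4 *.
have h1 : P * (N + 4) <= 19 / 6 * p * (N + 4) by rewrite ler_wpM2r//; lra.
have h2 : 0 <= p * (N - 4) by rewrite mulr_ge0//; lra.
lra.
Qed.
End pi_omega.

(** * Supporting half-spaces *)

Section dot_product.
Context {R : realType}.

Lemma cvg_sum_seq (T : Type) (I : Type) (r : seq I) (F : set_system T) {FF : Filter F}
    (f : I -> T -> R) (l : I -> R) :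
  (forall i, f i x @[x --> F] --> l i) ->
  (\sum_(i <- r) f i x) @[x --> F] --> \sum_(i <- r) l i.
Proof.
move=> fl; elim: r => [|i r IH].
  by rewrite big_nil; under eq_fun do rewrite big_nil; exact: cvg_cst.
by rewrite big_cons; under eq_fun do rewrite big_cons; apply: cvgD.
Qed.

Section dotv_theory.
Variable n : nat.
Implicit Types (v w : 'rV[R]_n) (s : R).

Lemma dotvC v w : dotv v w = dotv w v.
Proof. by apply: eq_bigr => i _; rewrite mulrC. Qed.

Lemma dotvDl u v w : dotv (u + v) w = dotv u w + dotv v w.
Proof. by rewrite -big_split; apply: eq_bigr => i _; rewrite mxE mulrDl. Qed.

Lemma dotvZl s v w : dotv (s *: v) w = s * dotv v w.
Proof. by rewrite mulr_sumr; apply: eq_bigr => i _; rewrite mxE mulrA. Qed.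

Lemma dotvNl v w : dotv (- v) w = - dotv v w.
Proof. by rewrite -scaleN1r dotvZl mulN1r. Qed.

Lemma dotvBl u v w : dotv (u - v) w = dotv u w - dotv v w.
Proof. by rewrite dotvDl dotvNl. Qed.

Lemma dotvDr u v w : dotv w (u + v) = dotv w u + dotv w v.
Proof. by rewrite dotvC dotvDl !(dotvC w). Qed.

Lemma dotvZr s v w : dotv w (s *: v) = s * dotv w v.
Proof. by rewrite dotvC dotvZl (dotvC w). Qed.

Lemma dotvBr u v w : dotv w (u - v) = dotv w u - dotv w v.
Proof. by rewrite dotvC dotvBl !(dotvC w). Qed.

Lemma dotv_ge0 v : 0 <= dotv v v.
Proof. by apply: sumr_ge0 => i _; rewrite -expr2 sqr_ge0. Qed.

Lemma dotv_gt0 v : v != 0 -> 0 < dotv v v.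
Proof.
move=> v0; rewrite lt_neqAle dotv_ge0 andbT eq_sym; apply: contra v0.
rewrite psumr_eq0 => [/allP h|i _]; last by rewrite -expr2 sqr_ge0.
apply/eqP/rowP => i; rewrite mxE; have := h i; rewrite mem_index_enum.
by move=> /(_ isT)/=; rewrite mulf_eq0 orbb => /eqP.
Qed.

Lemma enorm_sq v : enorm v ^+ 2 = dotv v v.
Proof. by rewrite sqr_sqrtr// dotv_ge0. Qed.

Lemma enorm_ge0 v : 0 <= enorm v. Proof. exact: sqrtr_ge0. Qed.

Lemma enormZ s v : 0 <= s -> enorm (s *: v) = s * enorm v.
Proof.
move=> s0; rewrite /enorm dotvZl dotvZr mulrA sqrtrM ?mulr_ge0//.
by rewrite -expr2 sqrtr_sqr ger0_norm.
Qed.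

(** Cauchy-Schwarz, from the squared length of v - (v . w) w. *)
Lemma dotv_unit_le v w : enorm w = 1 -> dotv v w <= enorm v.
Proof.
move=> w1; have ww : dotv w w = 1 by rewrite -enorm_sq w1 expr1n.
have : 0 <= dotv (v - dotv v w *: w) (v - dotv v w *: w) by exact: dotv_ge0.
rewrite dotvBl !dotvBr !dotvZl !dotvZr ww (dotvC w v) -enorm_sq => h.
have := enorm_ge0 v; have [//|k] := leP (dotv v w) (enorm v); nra.
Qed.

Lemma continuous_coord (i : 'I_n) : continuous (fun v : 'rV[R]_n => v 0 i).
Proof. exact: coord_continuous. Qed.

Lemma continuous_dotv2 (T : topologicalType) (f g : T -> 'rV[R]_n) :
  continuous f -> continuous g -> continuous (fun x => dotv (f x) (g x)).
Proof.
move=> cf cg x; rewrite /dotv; apply: cvg_sum_seq => i.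
apply: cvgM.
- exact: (continuous_comp (cf x) (@continuous_coord i (f x))).
- exact: (continuous_comp (cg x) (@continuous_coord i (g x))).
Qed.

Lemma coord_le_mx_norm v i : `|v 0 i| <= `|v|.
Proof.
rewrite [leRHS]/Num.Def.normr /= mx_normrE; apply/bigmax_geP; right => /=.
by exists (0, i).
Qed.
End dotv_theory.
End dot_product.

Section continuous_vector.
Context {R : realType} {V : normedModType R} {T : topologicalType}.
Implicit Types (f g : T -> V).

Lemma continuousZ_fun (h : T -> R) f : continuous h -> continuous f ->
  continuous (fun x => h x *: f x).
Proof. by move=> ch cf x; exact: (cvgZ (ch x) (cf x)). Qed.

Lemma continuousD_fun f g : continuous f -> continuous g ->
  continuous (fun x => f x + g x).
Proof. by move=> cf cg x; exact: (cvgD (cf x) (cg x)). Qed.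

Lemma continuousB_fun f g : continuous f -> continuous g ->
  continuous (fun x => f x - g x).
Proof. by move=> cf cg x; exact: (cvgB (cf x) (cg x)). Qed.

Lemma continuous_id_fun : continuous (fun x : T => x).
Proof. by move=> x; exact: cvg_id. Qed.
End continuous_vector.

Lemma closure_sub_closed (T : topologicalType) (A C : set T) :
  closed C -> A `<=` C -> closure A `<=` C.
Proof.
by move=> cC AC x /(closure_subset AC); move/closure_id : cC => <-.
Qed.

Section convex_domain.
Context {R : realType} {n : nat}.
Variable Omega : set 'rV[R]_n.
Hypothesis oOmega : open Omega.
Hypothesis cOmega : convex_set (Omega : set (convex_lmodType 'rV[R]_n)).

Lemma convex_comb x y s : Omega x -> Omega y -> 0 <= s <= 1 ->
  Omega (s *: x + (1 - s) *: y).
Proof.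
move=> Ox Oy /andP[s0 s1].
have := @cOmega x y (Itv01 s0 s1) (mem_set Ox) (mem_set Oy). by move=> /set_mem.
Qed.

(** For the fixed combination c, the map [f] sends p to the point that completes p to c. It is
    continuous and takes y to x; as Omega is open, some p in Omega near y is still sent into
    Omega. *)
Lemma convex_closure x y s : Omega x -> closure Omega y -> 0 < s <= 1 ->
  Omega (s *: x + (1 - s) *: y).
Proof.
move=> Ox cy /andP[s0 s1]; set c := _ + _.
pose f (p : 'rV[R]_n) := s^-1 *: (c - (1 - s) *: p).
have fy : f y = x by rewrite /f /c addrK scalerA mulVf ?scale1r// gt_eqF.
have cf : continuous f.
  apply: continuousZ_fun; first exact: cst_continuous.
  apply: continuousB_fun; first exact: cst_continuous.
  by apply: continuousZ_fun; [exact: cst_continuous|exact: continuous_id_fun].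
have : nbhs y (f @^-1` Omega).
  by apply: cf; rewrite fy; exact: open_nbhs_nbhs.
move=> /cy [p [Op Ofp]].
have -> : c = s *: f p + (1 - s) *: p.
  by rewrite /f scalerA divff ?gt_eqF// scale1r subrK.
by apply: convex_comb => //; rewrite (ltW s0).
Qed.

Hypothesis bOmega : bounded_set Omega.

Lemma compact_closure : compact (closure Omega).
Proof.
apply: bounded_closed_compact; last exact: closed_closure.
have [M [Mr HM]] := bOmega; exists M; split=> // x Mx.
apply: closure_sub_closed; last exact: HM.
rewrite (_ : [set _ | _] = (fun v : 'rV[R]_n => `|v|) @^-1` [set r | r <= x])//.
by apply: closed_comp => [v _|]; [exact: norm_continuous|exact: closed_le].
Qed.

(** The direction from q to its nearest point p of the closure separates: if (y - p) . (p - q) < 0,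
    moving p slightly towards y would bring it closer to q. *)
Lemma separate_point (q o : 'rV[R]_n) : Omega o -> ~ closure Omega q ->
  exists nu : 'rV[R]_n, enorm nu = 1 /\ forall y, closure Omega y -> 0 <= dotv (y - q) nu.
Proof.
move=> Oo nq.
have cf : continuous (fun y : 'rV[R]_n => dotv (y - q) (y - q)).
  by apply: continuous_dotv2; apply: continuousB_fun;
    [exact: continuous_id_fun|exact: cst_continuous
    |exact: continuous_id_fun|exact: cst_continuous].
have Q0 : closure Omega !=set0 by exists o; exact: subset_closure.
have [p] := EVT_min_rV Q0 compact_closure (continuous_subspaceT cf).
rewrite inE => cp pmin.
have pq : p - q != 0 by apply: contra_not_neq nq => /eqP; rewrite subr_eq0 => /eqP <-.
set a := dotv (p - q) (p - q).
have a0 : 0 < a by exact: dotv_gt0.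
have main y : Omega y -> 0 <= dotv (y - p) (p - q).
  move=> Oy; rewrite leNgt; apply/negP => b0.
  set b := dotv (y - p) (p - q) in b0; set c := dotv (y - p) (y - p).
  have c0 : 0 <= c by exact: dotv_ge0.
  (* This step makes 2 s b + s^2 c, the change of the squared distance, negative; the [+ 1] covers c
     = 0. *)
  pose s := Num.min 1 (- b / (c + 1)).
  have s0 : 0 < s by rewrite lt_min ltr01/= divr_gt0//; lra.
  have s1 : s <= 1 by rewrite ge_min lexx.
  have sc : s * (c + 1) <= - b.
    by rewrite -ler_pdivlMr; [rewrite ge_min lexx orbT|lra].
  have /mem_set/pmin : closure Omega (s *: y + (1 - s) *: p).
    by apply: subset_closure; apply: convex_closure => //; rewrite s0.
  rewrite (_ : _ + _ - q = (p - q) + s *: (y - p)); last first.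
    by rewrite scalerBr scalerBl scale1r; apply/rowP => i; rewrite !mxE; ring.
  have E (u v : 'rV[R]_n) : dotv (u + s *: v) (u + s *: v) =
      dotv u u + 2 * s * dotv v u + s * s * dotv v v.
    by rewrite dotvDl !dotvDr !dotvZl !dotvZr (dotvC u v); ring.
  rewrite E -/a -/b -/c => h; nra.
have e0 : 0 < enorm (p - q) by rewrite sqrtr_gt0.
exists ((enorm (p - q))^-1 *: (p - q)); split.
  by rewrite enormZ ?invr_ge0 ?enorm_ge0// mulVf// gt_eqF.
have cl : closed [set y : 'rV[R]_n | 0 <= dotv (y - q) (p - q)].
  rewrite (_ : [set _ | _] = (fun y : 'rV[R]_n => dotv (y - q) (p - q)) @^-1` [set r | 0 <= r])//.
  apply: closed_comp => [v _|]; last exact: closed_ge.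
  move: v; apply: continuous_dotv2; last exact: cst_continuous.
  by apply: continuousB_fun; [exact: continuous_id_fun|exact: cst_continuous].
move=> y cy; rewrite dotvZr mulr_ge0 ?invr_ge0 ?(ltW e0)//.
apply: (closure_sub_closed cl) cy => z Oz /=.
rewrite (_ : z - q = (z - p) + (p - q)); last by rewrite addrA subrK.
by rewrite dotvDl addr_ge0 ?main// ltW.
Qed.

Lemma cluster_ge0 (T : topologicalType) (F : set_system T) (p : T) (f : T -> R) :
  cluster F p -> {for p, continuous f} ->
  (forall e, 0 < e -> F [set x | - e <= f x]) -> 0 <= f p.
Proof.
move=> Fp cf Fe; rewrite leNgt; apply/negP => f0.
have e0 : 0 < - f p / 2 by rewrite divr_gt0// oppr_gt0.
have : nbhs p (f @^-1` [set r | r < f p / 2]).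
  apply: cf; apply: open_nbhs_nbhs; split; first exact: open_lt.
  by rewrite /=; lra.
by move=> /(Fp _ _ (Fe _ e0)) [x /= [h1 h2]]; move: h1 h2; lra.
Qed.

(* [nu] is a cluster point of unit normals separating [Omega] from the exterior
   points [z + t w + t^2 (z - o)], [t -> 0], with [o] in [Omega]; the quadratic
   term only serves to leave the closure. *)
Lemma support_direction (z w : 'rV[R]_n) : Omega !=set0 -> closure Omega z ->
  (forall t, 0 <= t -> ~ Omega (z + t *: w)) ->
  exists2 nu, inward_unit_support Omega z nu & dotv w nu <= 0.
Proof.
move=> [] o Oo cz wz.
pose t (k : nat) : R := k.+1%:R^-1.
have t0 k : 0 < t k by rewrite invr_gt0.
pose q k := z + t k *: w + t k ^+ 2 *: (z - o).
have nq k : ~ closure Omega (q k).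
  move=> cq; set e := t k ^+ 2; have e0 : 0 < e by rewrite exprn_gt0.
  (* With this weight the combination of [o] and [q k] cancels the quadratic term and lands on the
     ray from z along w, which avoids Omega. *)
  pose s := e / (1 + e); have s0 : 0 < s by rewrite divr_gt0//; lra.
  have s1 : s <= 1 by rewrite ler_pdivrMr; lra.
  have E : s *: o + (1 - s) *: q k = z + (t k / (1 + e)) *: w.
    apply/rowP => i; rewrite /q !mxE /s -/e; field.
    by rewrite gt_eqF//; lra.
  apply: (wz (t k / (1 + e))); first by rewrite divr_ge0// ltW//; lra.
  by rewrite -E; apply: convex_closure => //; rewrite s0.
have /choice[nu Hnu] k := separate_point Oo (nq k).
pose S := [set v : 'rV[R]_n | dotv v v = 1].
have cS : compact S.
  apply: bounded_closed_compact.
    exists 1; split=> // x x1 v Sv /=; rewrite (le_trans _ (ltW x1))//.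
    rewrite [leLHS]/Num.Def.normr/= mx_normrE; apply/bigmax_leP; split=> // -[i j] _ /=.
    rewrite (ord1 i) -(@ler_pXn2r _ 2)// ?nnegrE// expr1n real_normK ?num_real//.
    by rewrite -Sv /dotv (bigD1 j)//= expr2 lerDl sumr_ge0// => l _; rewrite -expr2 sqr_ge0.
  rewrite (_ : S = (fun v : 'rV[R]_n => dotv v v) @^-1` [set 1])//.
  apply: closed_comp => [v _|]; last exact: closed_eq.
  by move: v; apply: continuous_dotv2; exact: continuous_id_fun.
have Sn k : dotv (nu k) (nu k) = 1.
  by have [h _] := Hnu k; rewrite -enorm_sq h expr1n.
have FS : (nu @ \oo) S by exists 0%N => // k _; exact: Sn.
have [v [Sv cv]] := cS (nu @ \oo) _ FS.
have bd (a : 'rV[R]_n) k : dotv a (nu k) <= enorm a by apply: dotv_unit_le; have [] := Hnu k.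
have tcvg (c e : R) : 0 < e -> \forall k \near \oo, c * t k <= e.
  move=> e0.
  have : (fun k => c * t k) @ \oo --> c * 0 by exact: (cvgM (cvg_cst c) (@cvg_harmonic R)).
  rewrite mulr0 => /cvgrPdist_le /(_ e e0); apply: filterS => k.
  by rewrite sub0r normrN => /(le_trans (ler_norm _)).
have t1 k : t k <= 1 by rewrite invf_le1// ler1n.
exists v.
  split; first by rewrite /enorm Sv sqrtr1.
  move=> y Oy; apply: (cluster_ge0 cv).
    by move: (v); apply: continuous_dotv2; [exact: cst_continuous|exact: continuous_id_fun].
  move=> e e0; suff: \forall k \near \oo, - e <= dotv (y - z) (nu k) by [].
  near=> k.
  have [_ /(_ y (subset_closure Oy))] := Hnu k.
  rewrite /q (_ : y - _ = (y - z) - (t k *: w + t k ^+ 2 *: (z - o))); last first.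
    by rewrite !opprD !addrA.
  rewrite dotvBl (dotvDl (t k *: w)) !dotvZl => h.
  have : (enorm (- w) + enorm (o - z)) * t k <= e by near: k; exact: tcvg.
  have h1 := bd (- w) k; rewrite dotvNl in h1.
  have h2 : - dotv (z - o) (nu k) <= enorm (o - z) by rewrite -dotvNl opprB bd.
  have E0 := enorm_ge0 (o - z); have tk := t0 k; have tk1 := t1 k => h3.
  have h4 : t k * - dotv w (nu k) <= t k * enorm (- w) by rewrite ler_wpM2l// ltW.
  have h5 : t k ^+ 2 * - dotv (z - o) (nu k) <= t k ^+ 2 * enorm (o - z).
    by rewrite ler_wpM2l// sqr_ge0.
  have h6 : t k ^+ 2 * enorm (o - z) <= t k * enorm (o - z).
    by rewrite ler_wpM2r// expr2 ler_piMl// ltW.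
  lra.
have : 0 <= dotv (- w) v; last by rewrite dotvNl oppr_ge0.
apply: (cluster_ge0 cv).
  by move: (v); apply: continuous_dotv2; [exact: cst_continuous|exact: continuous_id_fun].
move=> e e0; suff: \forall k \near \oo, - e <= dotv (- w) (nu k) by [].
near=> k.
(* Separation is now tested at z itself and divided by [t k], which leaves -w as the leading
   term. *)
have [_ /(_ z cz)] := Hnu k.
rewrite /q (_ : z - _ = t k *: (- w + t k *: (o - z))); last first.
  by apply/rowP => i; rewrite !mxE; ring.
rewrite dotvZl pmulr_rge0// (dotvDl (- w)) dotvZl => h.
have : enorm (o - z) * t k <= e by near: k; exact: tcvg.
by have h2 := bd (o - z) k; have := t0 k; nra.
Unshelve. all: by end_near.
Qed.

(** If the ray from x along nu missed Omega, some supporting normal nu' would satisfy nu . nu' <= 0,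
    while uniqueness gives nu' = nu and nu . nu = 1. One point of the ray in Omega suffices, by
    convexity and since x lies in the closure. *)
Lemma interior_normal_in (x nu : 'rV[R]_n) : Omega !=set0 -> closure Omega x ->
  ~ Omega x -> interior_unit_normal Omega x nu -> \forall t \near 0^'+, Omega (x + t *: nu).
Proof.
move=> O0 cx nOx [[nu1 _] nuq].
have nn : dotv nu nu = 1 by rewrite -enorm_sq nu1 expr1n.
have [[t [t0 Ot]]|] := pselect (exists t, 0 < t /\ Omega (x + t *: nu)).
  near=> s.
  have s0 : 0 < s by [].
  have st : s <= t by near: s; exact: nbhs_right_le.
  rewrite (_ : _ + _ = (s / t) *: (x + t *: nu) + (1 - s / t) *: x); last first.
    apply/rowP => i; rewrite !mxE; field.
    by rewrite gt_eqF.
  by apply: convex_closure => //; rewrite divr_gt0//= ler_pdivrMr// mul1r.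
move=> nO; have [t t0|nu' snu' h] := @support_direction x nu O0 cx.
  move: t0; rewrite le_eqVlt => /predU1P[<-|t0].
    by rewrite scale0r addr0.
  by move=> Ot; apply: nO; exists t.
by move: h; rewrite (nuq _ snu') nn; lra.
Unshelve. all: by end_near.
Qed.
End convex_domain.

(** * The barrier *)

Section line_derivative.
Context {R : realType}.

(** The two difference quotients coincide; this reduces directional derivatives to one real
    variable. *)
Lemma is_derive_line (V : normedModType R) (u : V -> R) (x v : V) (s d : R) :
  is_derive (x + s *: v) v u d -> is_derive s (1 : R) (fun r : R => u (x + r *: v)) d.
Proof.
have E : (fun h : R => h^-1 *: (u (x + (h *: (1 : R) + s) *: v) - u (x + s *: v))) =
    (fun h : R => h^-1 *: (u (h *: v + (x + s *: v)) - u (x + s *: v))).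
  apply/funext => h; congr (_ *: (u _ - _)).
  by rewrite scalerDl addrCA /GRing.scale/= mulr1.
move=> [du Du]; split.
  by rewrite /derivable/= E.
by rewrite -Du /derive/= E.
Qed.

(** If l > 0, then near 0 [dg] exceeds [dg 0] on the right and is below it on the left. The mean
    value theorem and maximality give c > 0 with dg c <= 0 and b < 0 with dg b >= 0, so that [dg 0]
    would be both negative and positive. *)
Lemma second_derivative_max (g dg : R -> R) (l : R) :
  (\forall s \near (0 : R), is_derive s (1 : R) g (dg s)) ->
  is_derive (0 : R) (1 : R) dg l ->
  (\forall s \near (0 : R), g s <= g 0) -> l <= 0.
Proof.
move=> nd dl nm; rewrite leNgt; apply/negP => l0.
have nl : \forall h \near (0 : R)^', 0 < h^-1 * (dg h - dg 0).
  have [ddg Dl] := dl.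
  have : h^-1 *: (dg (h *: (1:R) + 0) - dg 0) @[h --> (0:R)^'] --> l.
    by rewrite -Dl; exact: ddg.
  move=> /(cvgr_gt l) /(_ _ l0); apply: filterS => h.
  by rewrite /GRing.scale/= mulr1 addr0.
have [e e0 He] : exists2 e : R, 0 < e & forall h, `|h| < e ->
    [/\ is_derive h (1 : R) g (dg h), g h <= g 0 &
        (h != 0 -> 0 < h^-1 * (dg h - dg 0))].
  have /nbhs_ballP[e /= e0 He] : \forall h \near (0 : R),
      [/\ is_derive h (1 : R) g (dg h), g h <= g 0 &
        (h != 0 -> 0 < h^-1 * (dg h - dg 0))].
    by near=> h; split; near: h.
  by exists e => // h he; apply: He; rewrite /ball/= sub0r normrN.
have dg_h h : `|h| < e -> {for h, continuous g}.
  move=> /He[dh _ _]; apply: differentiable_continuous; apply/derivable1_diffP.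
  exact: ex_derive.
have E2 : `|e / 2| < e by rewrite gtr0_norm ?divr_gt0//; lra.
have c1 : {within `[0, e / 2], continuous g}.
  apply: continuous_in_subspaceT => x; rewrite inE/= in_itv/= => xe.
  by apply: dg_h; rewrite ltr_norml; lra.
have c2 : {within `[- (e / 2), 0], continuous g}.
  apply: continuous_in_subspaceT => x; rewrite inE/= in_itv/= => xe.
  by apply: dg_h; rewrite ltr_norml; lra.
have d1 x : x \in `]0, e / 2[ -> is_derive x (1 : R) g (dg x).
  rewrite in_itv/= => xe; have xl : `|x| < e by rewrite ltr_norml; lra.
  by have [] := He x xl.
have d2 x : x \in `]- (e / 2), 0[ -> is_derive x (1 : R) g (dg x).
  rewrite in_itv/= => xe; have xl : `|x| < e by rewrite ltr_norml; lra.
  by have [] := He x xl.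
have [|c ci Ec] := MVT _ d1 c1; first by rewrite divr_gt0.
have [|b bi Eb] := MVT _ d2 c2; first by rewrite oppr_lt0 divr_gt0.
rewrite in_itv/= in ci; rewrite in_itv/= in bi.
have [|_ g1 _] := He (e / 2); first exact: E2.
have [|_ g2 _] := He (- (e / 2)); first by rewrite normrN.
have [|_ _ hc] := He c; first by rewrite ltr_norml; lra.
have [|_ _ hb] := He b; first by rewrite ltr_norml; lra.
have dc : dg c <= 0.
  by have : 0 <= - dg c * (e / 2); [lra|rewrite pmulr_lge0; lra].
have db : 0 <= dg b.
  by have : 0 <= dg b * (e / 2); [lra|rewrite pmulr_lge0; lra].
have : 0 < dg c - dg 0.
  by have := hc _; rewrite pmulr_rgt0 ?invr_gt0; [apply; rewrite gt_eqF//; lra|lra].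
have : dg b - dg 0 < 0.
  by have := hb _; rewrite nmulr_rgt0 ?invr_lt0; [apply; rewrite lt_eqF//; lra|lra].
lra.
Unshelve. all: by end_near.
Qed.
End line_derivative.

Section torsion.
Context {R : realType} {n : nat}.
Variables (Omega : set 'rV[R]_n) (u : 'rV[R]_n -> R).
Hypothesis hOmega : bounded_convex_domain Omega.
Hypothesis hu : torsion_function Omega u.

Let e_ (i : 'I_n) : 'rV[R]_n := delta_mx 0 i.

Lemma torsion_open : open Omega. Proof. by case: hOmega. Qed.

Lemma torsion_boundary y : closure Omega y -> ~ Omega y -> u y = 0.
Proof.
move=> cy nOy; have [_ _ _ h] := hu; apply: h; split=> //.
by move/interior_id : torsion_open => ->.
Qed.

Lemma torsion_max : exists2 x0, closure Omega x0 & forall y, closure Omega y -> u y <= u x0.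
Proof.
have [Ne bO oO cO] := hOmega; have [_ cu _ _] := hu.
have Q0 : closure Omega !=set0 by case: Ne => a Oa; exists a; exact: subset_closure.
have [c cc hc] := EVT_max_rV Q0 (compact_closure bO) cu.
exists c; first by rewrite inE in cc.
by move=> y cy; apply: hc; rewrite inE.
Qed.

Lemma near_line (A : set 'rV[R]_n) (y v : 'rV[R]_n) : open A -> A y ->
  \forall s \near (0 : R), A (y + s *: v).
Proof.
move=> oA Ay.
have c : continuous (fun s : R => y + s *: v).
  apply: continuousD_fun; first exact: cst_continuous.
  by apply: continuousZ_fun; [exact: continuous_id_fun|exact: cst_continuous].
by apply: c; rewrite scale0r addr0; exact: open_nbhs_nbhs.
Qed.

Lemma dotv_e (nu : 'rV[R]_n) i : dotv (e_ i) nu = nu 0 i.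
Proof.
rewrite /dotv (bigD1 i)//= mxE !eqxx mul1r big1 ?addr0// => j ji.
by rewrite mxE (negbTE ji) andbF mul0r.
Qed.

Section barrier.
Variables (z nu : 'rV[R]_n) (M : R).
Hypothesis hnu : inward_unit_support Omega z nu.
Hypothesis hM : forall y, closure Omega y -> u y <= M.
Hypothesis M0 : 0 <= M.
Let L := Num.sqrt (2 * M).
Let h (y : 'rV[R]_n) := dotv (y - z) nu.

Let L2 : L ^+ 2 = 2 * M. Proof. by rewrite sqr_sqrtr// mulr_ge0. Qed.
Let L0 : 0 <= L. Proof. exact: sqrtr_ge0. Qed.
Let nn : dotv nu nu = 1. Proof. by rewrite -enorm_sq hnu.1 expr1n. Qed.

Let ch : continuous h.
Proof.
apply: continuous_dotv2; last exact: cst_continuous.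
by apply: continuousB_fun; [exact: continuous_id_fun|exact: cst_continuous].
Qed.

Let h_ge0 y : closure Omega y -> 0 <= h y.
Proof.
have cl : closed (h @^-1` [set r | 0 <= r]).
  by apply: closed_comp => [v _|]; [exact: ch|exact: closed_ge].
by apply: (closure_sub_closed cl) => w; exact: hnu.2.
Qed.

(* Maximum principle on the slab [h <= L] for [u - L h + (1/2 + e) h^2], which
   is strictly subharmonic: on the boundary it is at most [e L^2], where [u = 0]
   because [h <= L], and on [h = L] because [u <= M = L^2 / 2]. *)
Lemma torsion_barrier y : closure Omega y -> h y <= L ->
  u y <= L * h y - h y ^+ 2 / 2.
Proof.
have [Ne bO oO cO] := hOmega; have [C2 cu lap _] := hu.
(* The perturbation by e makes the contradiction at an interior maximum strict; its cost e L^2 tends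
   to 0. *)
move: y; suff main e y : 0 < e -> closure Omega y -> h y <= L ->
    u y - L * h y + h y ^+ 2 / 2 <= e * L ^+ 2.
  move=> y cy hy; rewrite -subr_le0 opprB addrA addrAC.
  have H e : 0 < e -> u y - L * h y + h y ^+ 2 / 2 <= e * L ^+ 2.
    by move=> e0; exact: main.
  have [Lz|Ln] := eqVneq L 0.
    by have := H 1 ltr01; rewrite {2}Lz expr0n/= mulr0; lra.
  have Lp : 0 < L ^+ 2 by rewrite exprn_gt0// lt_neqAle eq_sym Ln.
  rewrite leNgt; apply/negP => k.
  have := H ((u y - L * h y + h y ^+ 2 / 2) / 2 / L ^+ 2).
  rewrite divr_gt0//; last by rewrite divr_gt0//; lra.
  by move=> /(_ isT); rewrite divfK ?gt_eqF//; lra.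
move=> e0 cy hy.
pose D := closure Omega `&` h @^-1` [set r | r <= L].
pose v y := u y - L * h y + (1 / 2 + e) * h y ^+ 2.
have cD : compact D.
  apply: compact_closedI; first exact: compact_closure.
  by apply: closed_comp => [w _|]; [exact: ch|exact: closed_le].
have cv : {within D, continuous v}.
  have cu' : {within D, continuous u} by apply: continuous_subspaceW cu => w [].
  have cp : continuous (fun y => - (L * h y) + (1 / 2 + e) * (h y * h y)).
    have cp : continuous (fun r : R => - (L * r) + (1 / 2 + e) * (r * r)).
      move=> r; apply: cvgD; [apply: cvgN; apply: cvgM|apply: cvgM; last apply: cvgM];
        by [exact: cvg_cst|exact: cvg_id].
    by move=> w; exact: (continuous_comp (@ch w) (cp (h w))).
  rewrite (_ : v = u \+ (fun y => - (L * h y) + (1 / 2 + e) * (h y * h y))).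
    by move=> w; apply: cvgD; [exact: cu'|exact: (continuous_subspaceT cp)].
  by apply/funext => w; rewrite /v/= addrA expr2.
have D0 : D !=set0 by exists y.
have [m] := EVT_max_rV D0 cD cv; rewrite inE => -[cm hm] mmax.
have vy : v y <= v m by apply: mmax; rewrite inE.
suff vm : v m <= e * L ^+ 2.
  have : 0 <= e * h y ^+ 2 by rewrite mulr_ge0 ?sqr_ge0// ltW.
  by move: vy; rewrite {1}/v mulrDl; lra.
have hm0 := h_ge0 cm.
have hmL : h m ^+ 2 <= L ^+ 2 by rewrite lerXn2r ?nnegrE.
have [Om|nOm] := pselect (Omega m); last first.
  by rewrite /v torsion_boundary// /=; rewrite /= in hm; nra.
have [hL|hL] := eqVneq (h m) L.
  by rewrite /v hL mulrDl -!expr2 L2; have := hM cm; lra.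
exfalso.
have {}hm : h m < L by rewrite lt_neqAle hL.
have hline s i : h (m + s *: e_ i) = h m + s * nu 0 i.
  by rewrite /h addrAC (dotvDl (m - z)) dotvZl dotv_e.
(* At a maximum of [v] inside Omega with h < L, each pure second partial of [v] is at most 0,
   whereas their sum is -1 + (1 + 2 e) = 2 e. *)
have li i : partial i (partial i u) m + (1 + 2 * e) * nu 0 i ^+ 2 <= 0.
  pose g (s : R) := v (m + s *: e_ i).
  pose dg (s : R) := partial i u (m + s *: e_ i) - L * nu 0 i +
     (1 + 2 * e) * ((h m + s * nu 0 i) * nu 0 i).
  have nO : \forall s \near (0 : R), Omega (m + s *: e_ i) by exact: near_line.
  have dlin (s : R) : is_derive s (1 : R) (fun s => h m + s * nu 0 i) (nu 0 i).
    apply: (is_derive_eq (is_deriveD_fun (is_derive_cst (h m) s (1:R))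
      (is_deriveM_fun (is_derive_id s (1:R)) (is_derive_cst (nu 0 i) s (1:R))))).
    by rewrite /cst mulr0 addr0 add0r mul1r.
  apply: (@second_derivative_max _ g dg).
  - near=> s.
    have Os : Omega (m + s *: e_ i) by near: s.
    have [_ /(_ i)[du _] _] := C2 _ Os.
    have h1 : is_derive s (1 : R) (fun r => u (m + r *: e_ i)) (partial i u (m + s *: e_ i)).
      by apply: is_derive_line; exact: derivableP.
    have -> : g = fun s => u (m + s *: e_ i) - L * (h m + s * nu 0 i) +
        (1 / 2 + e) * (h m + s * nu 0 i) ^+ 2.
      by apply/funext => r; rewrite /g /v hline.
    have h2 := is_deriveM_fun (is_derive_cst L s (1:R)) (dlin s).
    have h3 := is_deriveM_fun (is_derive_cst (1 / 2 + e) s (1:R)) (is_deriveX_fun 2 (dlin s)).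
    apply: (is_derive_eq (is_deriveD_fun (is_deriveB_fun h1 h2) h3)).
    by rewrite /dg /cst/=; field.
  - have [_ _ /(_ i i)[du _]] := C2 _ Om.
    have h1 : is_derive (0 : R) (1 : R) (fun r : R => partial i u (m + r *: e_ i))
        (partial i (partial i u) m).
      by apply: is_derive_line; rewrite scale0r addr0; exact: derivableP.
    have h2 := is_deriveM_fun (is_derive_cst (1 + 2 * e) (0:R) (1:R))
      (is_deriveM_fun (dlin 0) (is_derive_cst (nu 0 i) (0:R) (1:R))).
    apply: (is_derive_eq (is_deriveD_fun (is_deriveB_fun h1 (is_derive_cst (L * nu 0 i) (0:R) (1:R))) h2)).
    by rewrite /cst/=; field.
  - have nh : \forall s \near (0 : R), h (m + s *: e_ i) < L.
      apply: (near_line (A := h @^-1` [set r | r < L])) => //.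
      by apply: open_comp => [w _|]; [exact: ch|exact: open_lt].
    near=> s; rewrite /g scale0r addr0; apply: mmax; rewrite inE; split.
      by apply: subset_closure; near: s.
    by rewrite /= ltW//; near: s.
have : \sum_(i < n) (partial i (partial i u) m + (1 + 2 * e) * nu 0 i ^+ 2) <= 0.
  by apply: sumr_le0.
rewrite big_split/= -mulr_sumr (_ : \sum_(i < n) nu 0 i ^+ 2 = 1); last first.
  by rewrite -nn; apply: eq_bigr => i _; rewrite expr2.
by have := lap _ Om; rewrite /laplacian; lra.
Unshelve. all: by end_near.
Qed.
End barrier.
End torsion.

(** * Truncation of the torsion function *)

Section composition.
Context {R : realType}.

Lemma is_derive_line_at (V : normedModType R) (u : V -> R) (x v : V) (d : R) :
  is_derive (0 : R) (1 : R) (fun r : R => u (x + r *: v)) d -> is_derive x v u d.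
Proof.
have E : (fun h : R => h^-1 *: (u (x + (h *: (1 : R) + 0) *: v) - u (x + 0 *: v))) =
    (fun h : R => h^-1 *: (u (h *: v + x) - u x)).
  apply/funext => h; rewrite scale0r !addr0; congr (_ *: (u _ - _)).
  by rewrite addrC /GRing.scale/= mulr1.
move=> [du Du]; split.
  by move: du; rewrite /derivable/= E.
by rewrite -Du /derive/= E.
Qed.

Lemma is_derive_comp_real (V : normedModType R) (psi : R -> R) (u : V -> R) (x v : V)
    (d du : R) :
  is_derive (u x) (1 : R) psi d -> is_derive x v u du ->
  is_derive x v (fun y => psi (u y)) (d * du).
Proof.
move=> hp hu; apply: is_derive_line_at.
have h1 : is_derive (0 : R) (1 : R) (fun r : R => u (x + r *: v)) du.
  by apply: is_derive_line; rewrite scale0r addr0.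
have := @is_derive1_comp _ psi (fun r : R => u (x + r *: v)) 0 d du _ h1.
rewrite scale0r addr0 => /(_ hp) h2; apply: (is_derive_eq h2).
by rewrite mulrC.
Qed.

(** At 0 the difference quotient is that of [p] on the right and 0 on the left, and both tend to dp
    0 = 0. Applied to a function and then to its derivative, this makes the extension by 0 twice
    differentiable. *)
Lemma is_derive_pos_part (p dp : R -> R) (x : R) :
  (forall y : R, 0 <= y -> is_derive y (1 : R) p (dp y)) -> p 0 = 0 -> dp 0 = 0 ->
  is_derive x (1 : R) (fun y : R => p (Num.max y 0)) (dp (Num.max x 0)).
Proof.
move=> hp p0 dp0; have [x0|x0|x0] := ltgtP x 0.
- rewrite dp0; have h := is_derive_cst (0 : R) x (1 : R); apply: (near_eq_is_derive _ h).
  near=> y; have y0 : y < 0 by near: y; exact: lt_nbhsl.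
  by rewrite max_r ?p0// ltW.
- have h := hp x (ltW x0); apply: (near_eq_is_derive _ h).
  near=> y; have y0 : 0 < y by near: y; exact: lt_nbhsr.
  by rewrite max_l// ltW.
subst x; rewrite dp0.
have [ddp Dp] := hp 0 (lexx _).
have cp : h^-1 *: (p (h *: (1 : R) + 0) - p 0) @[h --> (0 : R)^'] --> dp 0.
  by rewrite -Dp; exact: ddp.
rewrite dp0 in cp.
have c2 : h^-1 *: (p (Num.max (h *: (1 : R) + 0) 0) - p (Num.max 0 0)) @[h --> (0 : R)^'] --> (0 : R).
  apply/cvgrPdist_le => e e0; move/cvgrPdist_le : cp => /(_ e e0).
  apply: filterS => h; rewrite maxxx /GRing.scale/= mulr1 addr0.
  have [h0|h0] := leP 0 h; first by [].
  by rewrite subrr mulr0 subrr normr0 => _; exact: ltW.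
split; first by apply/cvg_ex; exists 0.
exact: (cvg_lim _ c2).
Unshelve. all: by end_near.
Qed.

Variable a : R.
Hypothesis a0 : 0 < a.

(* [y^3 / (y + a)^2] is convex with slope in [0, 1], and extended by 0 it is C^2:
   composing [u - a] with it keeps the Laplacian at least -1. *)
Let p (y : R) := y ^+ 3 * (y + a)^-1 ^+ 2.
Let dp (y : R) := y ^+ 2 * (y + 3 * a) * (y + a)^-1 ^+ 3.
Let ddp (y : R) := 6 * a ^+ 2 * y * (y + a)^-1 ^+ 4.

Definition trunc (x : R) : R := p (Num.max x 0).
Definition dtrunc (x : R) : R := dp (Num.max x 0).
Definition ddtrunc (x : R) : R := ddp (Num.max x 0).

Let ya (y : R) : 0 <= y -> y + a != 0. Proof. by move=> y0; rewrite lt0r_neq0// ltr_wpDl. Qed.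

Let is_derive_inv (y : R) : 0 <= y ->
  is_derive y (1 : R) (fun z => (z + a)^-1) (- (y + a)^-1 ^+ 2).
Proof.
move=> y0.
have h := is_deriveD_fun (is_derive_id y (1:R)) (is_derive_cst a y (1:R)).
apply: (is_derive_eq (@is_deriveV _ (fun z => z + a) _ _ _ (ya y0) h)).
by rewrite addr0 /GRing.scale/= mulr1 exprVn.
Qed.

Lemma is_derive_trunc (x : R) : is_derive x (1 : R) trunc (dtrunc x).
Proof.
apply: is_derive_pos_part => [y y0||]; last 2 first.
- by rewrite /p expr0n/= mul0r.
- by rewrite /dp expr0n/= !mul0r.
have h := is_deriveM_fun (is_deriveX_fun 3 (is_derive_id y (1:R)))
  (is_deriveX_fun 2 (is_derive_inv y0)).
by apply: (is_derive_eq h); rewrite /dp/=; field; exact: ya.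
Qed.

Lemma is_derive_dtrunc (x : R) : is_derive x (1 : R) dtrunc (ddtrunc x).
Proof.
apply: is_derive_pos_part => [y y0||]; last 2 first.
- by rewrite /dp expr0n/= !mul0r.
- by rewrite /ddp mulr0 mul0r.
have h0 := is_deriveD_fun (is_derive_id y (1:R)) (is_derive_cst (3 * a) y (1:R)).
have h := is_deriveM_fun (is_deriveM_fun (is_deriveX_fun 2 (is_derive_id y (1:R))) h0)
  (is_deriveX_fun 3 (is_derive_inv y0)).
by apply: (is_derive_eq h); rewrite /ddp/cst/=; field; exact: ya.
Qed.

Lemma continuous_ddtrunc : continuous ddtrunc.
Proof.
move=> x; have m0 : 0 <= Num.max x 0 by rewrite le_max lexx orbT.
have cm : {for x, continuous (fun y : R => Num.max y 0)}.
  by apply: (@continuous_max R R id (cst 0)); [exact: cvg_id|exact: cvg_cst].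
apply: (@continuous_comp _ _ _ (fun y : R => Num.max y 0) ddp); first exact: cm.
apply: cvgM; first by apply: cvgM; [exact: cvg_cst|exact: cvg_id].
apply: (@continuous_comp _ _ _ (fun y : R => (y + a)^-1) (fun z => z ^+ 4)).
  by apply: cvgV; [exact: ya|apply: cvgD; [exact: cvg_id|exact: cvg_cst]].
exact: exprn_continuous.
Qed.

Lemma trunc_le0 x : x <= 0 -> [/\ trunc x = 0, dtrunc x = 0 & ddtrunc x = 0].
Proof.
move=> x0; rewrite /trunc /dtrunc /ddtrunc max_r//.
by split; rewrite /p /dp /ddp ?expr0n/= ?mulr0 !mul0r.
Qed.

Lemma trunc_bounds x : [/\ 0 <= trunc x, 0 <= dtrunc x <= 1 & 0 <= ddtrunc x].
Proof.
rewrite /trunc /dtrunc /ddtrunc; set y := Num.max x 0.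
have y0 : 0 <= y by rewrite le_max lexx orbT.
have ya0 : 0 < y + a by rewrite ltr_wpDl.
have i0 : 0 <= (y + a)^-1 by rewrite invr_ge0 ltW.
have a1 := ltW a0.
split.
- by rewrite mulr_ge0 ?exprn_ge0.
- apply/andP; split; first by rewrite !mulr_ge0 ?exprn_ge0 ?addr_ge0 ?mulr_ge0.
  rewrite /dp exprVn ler_pdivrMr ?exprn_gt0//.
  have -> : 1 * (y + a) ^+ 3 = y ^+ 2 * (y + 3 * a) + (3 * a ^+ 2 * y + a ^+ 3) by ring.
  by rewrite lerDl addr_ge0 ?mulr_ge0 ?exprn_ge0.
- by rewrite !mulr_ge0 ?exprn_ge0.
Qed.

Lemma trunc_le x : 0 <= x -> trunc x <= x.
Proof.
move=> x0; have a1 := ltW a0; have xa : 0 < x + a by rewrite ltr_wpDl.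
rewrite /trunc max_l// /p exprVn ler_pdivrMr ?exprn_gt0//.
by rewrite exprS ler_wpM2l// lerXn2r ?nnegrE ?lerDl// ltW.
Qed.

(** Where u >= a, this makes the truncation of u - a lose at most 3 a with respect to u. *)
Lemma trunc_ge x : 0 <= x -> x - 2 * a <= trunc x.
Proof.
move=> x0; have a1 := ltW a0; have xa : 0 < x + a by rewrite ltr_wpDl.
rewrite /trunc max_l// /p exprVn ler_pdivlMr ?exprn_gt0//.
have -> : (x - 2 * a) * (x + a) ^+ 2 = x ^+ 3 - (3 * x * a ^+ 2 + 2 * a ^+ 3) by ring.
by rewrite lerBlDr lerDl addr_ge0 ?mulr_ge0 ?exprn_ge0.
Qed.
End composition.

Section truncation.
Context {R : realType} {n : nat}.
Variables (Omega : set 'rV[R]_n) (u : 'rV[R]_n -> R).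
Hypothesis hOmega : bounded_convex_domain Omega.
Hypothesis hu : torsion_function Omega u.
Variable a : R.
Hypothesis a0 : 0 < a.

Let e_ (i : 'I_n) : 'rV[R]_n := delta_mx 0 i.

(** The values of u outside the closure are arbitrary, so the extension by 0 tests membership in
    Omega instead of composing u with the truncation. *)
Let glue (f : 'rV[R]_n -> R) (x : 'rV[R]_n) : R := if x \in Omega then f x else 0.

Let near_in x : Omega x -> \forall y \near x, Omega y.
Proof. by move=> Ox; apply: open_nbhs_nbhs; split => //; exact: torsion_open hOmega. Qed.

(** Since u vanishes on the boundary and is continuous on the closure, near a point outside Omega
    the truncation at level a is identically 0 in Omega. This is why gluing with 0 preserves
    regularity. *)
Let near_out (x : 'rV[R]_n) : ~ Omega x -> \forall y \near x, Omega y -> u y < a.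
Proof.
move=> nOx; have [_ cu _ _] := hu.
have [cx|ncx] := pselect (closure Omega x).
  have E : u x = 0 by exact: torsion_boundary hOmega hu _ cx nOx.
  move/subspace_continuousP : cu => /(_ x cx) h.
  have {}h : u @ within (closure Omega) (nbhs x) --> (0 : R) by rewrite -E.
  move: h => /(cvgr_lt 0) /(_ _ a0); rewrite near_withinE.
  by apply: filterS => y /[swap] Oy; apply; exact: subset_closure.
have : \forall y \near x, (~` closure Omega) y.
  by apply: open_nbhs_nbhs; split => //; apply: closed_openC; exact: closed_closure.
by apply: filterS => y + Oy; case; exact: subset_closure.
Qed.

Let glue_in f x : Omega x -> \forall y \near x, f y = glue f y.
Proof. by move=> /near_in; apply: filterS => y Oy; rewrite /glue mem_set. Qed.

Let glue_out f x : (forall y, Omega y -> u y < a -> f y = 0) -> ~ Omega x ->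
  \forall y \near x, 0 = glue f y.
Proof.
move=> f0 /near_out; apply: filterS => y uy; rewrite /glue.
by case: ifPn => // /set_mem Oy; rewrite f0// uy.
Qed.

Let continuous_glue f : (forall x, Omega x -> {for x, continuous f}) ->
  (forall y, Omega y -> u y < a -> f y = 0) -> continuous (glue f).
Proof.
move=> cf f0 x; have [Ox|nOx] := pselect (Omega x).
  have h := glue_in f Ox; rewrite /continuous_at -(nbhs_singleton h).
  exact: (cvg_trans (near_eq_cvg h) (cf _ Ox)).
have h := glue_out f0 nOx; rewrite /continuous_at -(nbhs_singleton h).
exact: (cvg_trans (near_eq_cvg h) (cvg_cst (0 : R))).
Qed.

Let is_derive_glue f df (v : 'rV[R]_n) :
  (forall x, Omega x -> is_derive x v f (df x)) ->
  (forall y, Omega y -> u y < a -> f y = 0 /\ df y = 0) ->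
  forall x, is_derive x v (glue f) (glue df x).
Proof.
move=> hf f0 x; have [Ox|nOx] := pselect (Omega x).
  have h := hf x Ox; rewrite {2}/glue mem_set//.
  by apply: (near_eq_is_derive _ h); exact: glue_in.
have h := is_derive_cst (0 : R) x v; rewrite {2}/glue memNset//.
by apply: (near_eq_is_derive _ h); apply: glue_out => // y Oy /f0[].
Qed.

(** [P] and [Q] are the first and the pure second partials of [T], by the chain rule. *)
Let T x := trunc a (u x - a).
Let D x := dtrunc a (u x - a).
Let D2 x := ddtrunc a (u x - a).
Let P i x := D x * partial i u x.
Let Q i x := D2 x * partial i u x * partial i u x + D x * partial i (partial i u) x.

Let TD0 y : u y < a -> [/\ T y = 0, D y = 0 & D2 y = 0].
Proof. by move=> uy; apply: trunc_le0; lra. Qed.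

Let dT i x : Omega x -> is_derive x (e_ i) T (P i x).
Proof.
have [C2 _ _ _] := hu => /C2[_ /(_ i)[du _] _].
have h1 := is_deriveB_fun (derivableP du) (is_derive_cst a x (e_ i)).
apply: (is_derive_eq (is_derive_comp_real (is_derive_trunc a0 _) h1)).
by rewrite subr0.
Qed.

Let dP i x : Omega x -> is_derive x (e_ i) (P i) (Q i x).
Proof.
have [C2 _ _ _] := hu => /C2[_ /(_ i)[du _] /(_ i i)[ddu _]].
have h1 := is_deriveB_fun (derivableP du) (is_derive_cst a x (e_ i)).
have h2 := is_derive_comp_real (is_derive_dtrunc a0 _) h1.
apply: (is_derive_eq (is_deriveM_fun h2 (derivableP ddu))).
by rewrite subr0.
Qed.

Let cua x : Omega x -> {for x, continuous (fun y => u y - a)}.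
Proof.
have [C2 _ _ _] := hu => /C2[cu _ _].
exact: (cvgB cu (cvg_cst a)).
Qed.

Let cT x : Omega x -> {for x, continuous T}.
Proof.
move=> Ox; apply: (continuous_comp (cua Ox)).
exact: (is_derive_continuous (is_derive_trunc a0)).
Qed.

Let cD x : Omega x -> {for x, continuous D}.
Proof.
move=> Ox; apply: (continuous_comp (cua Ox)).
exact: (is_derive_continuous (is_derive_dtrunc a0)).
Qed.

Let cD2 x : Omega x -> {for x, continuous D2}.
Proof. by move=> Ox; apply: (continuous_comp (cua Ox)); exact: continuous_ddtrunc. Qed.

Let cP i x : Omega x -> {for x, continuous (P i)}.
Proof.
have [C2 _ _ _] := hu => Ox; have [_ /(_ i)[_ cu] _] := C2 _ Ox.
exact: (cvgM (cD Ox) cu).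
Qed.

Let cQ i x : Omega x -> {for x, continuous (Q i)}.
Proof.
have [C2 _ _ _] := hu => Ox; have [_ /(_ i)[_ cu] /(_ i i)[_ ccu]] := C2 _ Ox.
exact: (cvgD (cvgM (cvgM (cD2 Ox) cu) cu) (cvgM (cD Ox) ccu)).
Qed.

Let bounded_glue f : continuous (glue f) -> exists C : R, forall x, `|glue f x| <= C.
Proof.
move=> cg; have [Ne bO _ _] := hOmega.
have Q0 : closure Omega !=set0 by case: Ne => y Oy; exists y; exact: subset_closure.
have cn : continuous (fun x => `|glue f x|).
  by move=> x; exact: (continuous_comp (@cg x) (@norm_continuous _ _ (glue f x))).
have [c _ hc] := EVT_max_rV Q0 (compact_closure bO) (continuous_subspaceT cn).
exists `|glue f c| => x; have [Ox|nOx] := pselect (Omega x).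
  by apply: hc; rewrite inE; exact: subset_closure.
by rewrite {1}/glue memNset// normr0.
Qed.

(** In Omega the Laplacian of [T] is [D2] |grad u|^2 - [D], at least -1 because [D2 >= 0] and
    [0 <= D <= 1]. The partials are bounded, being continuous and zero outside a set with compact
    closure. The clause on [B] hands every nonnegative pointwise bound of u on to f: the maximum as
    well as the barrier. *)
Lemma torsion_truncation : exists (f : 'rV[R]_n -> R) (p q : 'I_n -> 'rV[R]_n -> R),
  [/\ [/\ continuous f, forall i, continuous (p i), forall i, continuous (q i),
          forall i x, is_derive x (delta_mx 0 i) f (p i x) &
          forall i x, is_derive x (delta_mx 0 i) (p i) (q i x)],
      exists C, forall i x, `|p i x| <= C /\ `|q i x| <= C,
      forall x, -1 <= \sum_i q i x,
      forall x, [/\ 0 <= f x, ~ Omega x -> f x = 0 &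
                 forall B, 0 <= B -> (Omega x -> u x <= B) -> f x <= B] &
      forall x, Omega x -> a <= u x -> u x - 3 * a <= f x].
Proof.
have c1 : continuous (glue T).
  by apply: continuous_glue => [x /cT//|y Oy /TD0[]].
have c2 i : continuous (glue (P i)).
  by apply: continuous_glue => [x /cP//|y Oy /TD0[_ d _]]; rewrite /P d mul0r.
have c3 i : continuous (glue (Q i)).
  by apply: continuous_glue => [x /cQ//|y Oy /TD0[_ d d']]; rewrite /Q d d' !mul0r addr0.
exists (glue T), (fun i => glue (P i)), (fun i => glue (Q i)); split.
- split=> // i x.
    apply: is_derive_glue => [y|y _ /TD0[t d _]]; first exact: dT.
    by rewrite /P d mul0r.
  apply: is_derive_glue => [y|y _ /TD0[_ d d']]; first exact: dP.
  by rewrite /P /Q d d' !mul0r addr0.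
- have /choice[C1 hC1] i := bounded_glue (@c2 i).
  have /choice[C2 hC2] i := bounded_glue (@c3 i).
  exists (\sum_i (`|C1 i| + `|C2 i|)) => i x.
  have h : `|C1 i| + `|C2 i| <= \sum_i (`|C1 i| + `|C2 i|).
    by rewrite (bigD1 i)//= lerDl sumr_ge0// => j _; rewrite addr_ge0.
  have := hC1 i x; have := hC2 i x; have := ler_norm (C1 i); have := ler_norm (C2 i).
  have := normr_ge0 (C1 i); have := normr_ge0 (C2 i).
  by split; lra.
- move=> x; have [Ox|nOx] := pselect (Omega x); last first.
    by rewrite /glue memNset// big1 ?lerN10.
  rewrite /glue mem_set// /Q big_split/= -mulr_sumr.
  have [_ _ /(_ _ Ox) lap _] := hu.
  have -> : \sum_(i < n) partial i (partial i u) x = -1 by rewrite -lap opprK.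
  have [_ /andP[d0 d1] dd0] := trunc_bounds a0 (u x - a).
  have : 0 <= \sum_(i < n) D2 x * partial i u x * partial i u x.
    by apply: sumr_ge0 => i _; rewrite -mulrA mulr_ge0// -expr2 sqr_ge0.
  by rewrite -/(D x) in d0 d1; lra.
- move=> x; rewrite /glue; case: ifPn => [/set_mem Ox|/negP nOx].
    have [t0 _ _] := trunc_bounds a0 (u x - a); split=> // B B0 /(_ Ox) uB.
    have [ua|ua] := leP (u x) a.
      by rewrite /T; have [|-> _ _] := @trunc_le0 R a (u x - a); [lra|].
    have := @trunc_le R a a0 (u x - a); rewrite subr_ge0 => /(_ (ltW ua)) h.
    by apply: (le_trans h); apply: le_trans uB; rewrite gerBl ltW.
  by split.
- move=> x Ox ua; rewrite /glue mem_set// /T.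
  have := @trunc_ge R a a0 (u x - a); rewrite subr_ge0 => /(_ ua); lra.
Qed.
End truncation.

(** * Mean value inequality *)

Section ball_ibp.
Context {R : realType}.
Notation mR := (measurableTypeR R).
Notation leb := (@lebesgue_measure R).

Lemma integral_ball_line (P Q K : R -> R) (b : R) : 0 <= b ->
  (forall x, is_derive x (1 : R) P (Q x)) -> continuous Q -> continuous K ->
  (\int[leb]_(x in `](- b)%R, b[) (x * P x + K x)%:E =
   \int[leb]_(x in `](- b)%R, b[) ((b ^+ 2 - x ^+ 2) / 2 * Q x + K x)%:E)%E.
Proof.
move=> b0 dP cQ cK; have cP := is_derive_continuous dP.
have cH : continuous (fun x : R => (b ^+ 2 - x ^+ 2) / 2).
  move=> x; apply: cvgM; last exact: cvg_cst.
  by apply: cvgB; [exact: cvg_cst|exact: exprn_continuous].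
have c1 : continuous (fun x : R => x * P x + K x).
  by move=> x; apply: cvgD; [apply: cvgM; [exact: cvg_id|exact: cP]|exact: cK].
have c2 : continuous (fun x : R => (b ^+ 2 - x ^+ 2) / 2 * Q x + K x).
  by move=> x; apply: cvgD; [apply: cvgM; [exact: cH|exact: cQ]|exact: cK].
have oc (f : R -> R) : continuous f -> (\int[leb]_(x in `](- b)%R, b[) (f x)%:E =
    \int[leb]_(x in `[(- b)%R, b]) (f x)%:E)%E.
  move=> cf; rewrite -(@integral_itv_bndoo _ _ _ _ true false)//.
  apply/measurable_EFinP; apply: measurable_funTS; exact: continuous_measurable_fun.
rewrite !oc//.
have i1 := integrable_itv_continuous (- b) b c1.
have i2 := integrable_itv_continuous (- b) b c2.
have f2 : (\int[leb]_(x in `[(- b)%R, b]) ((b ^+ 2 - x ^+ 2) / 2 * Q x + K x)%:E)%E \is a fin_num.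
  exact: integrable_fin_num.
rewrite -[LHS](subeK _ f2)// -[RHS]add0e; congr (_ + _)%E.
rewrite -integralB//.
(* The difference of the two integrands is the derivative of [F], in which [K] has cancelled, and
   [F] vanishes at both endpoints. *)
pose F (x : R) := - ((b ^+ 2 - x ^+ 2) / 2 * P x).
pose G (x : R) := x * P x + K x - ((b ^+ 2 - x ^+ 2) / 2 * Q x + K x).
transitivity ((F b - F (- b))%:E)%E; last first.
  by rewrite /F sqrrN subrr !mul0r subrr.
apply: (@continuous_FTC _ F G).
- lra.
- by move=> x; apply: cvgB; [exact: c1|exact: c2].
- by move=> x; apply: cvgN; apply: cvgM; [exact: cH|exact: cP].
- move=> x _.
  have h1 := is_deriveM_fun (is_deriveB_fun (is_derive_cst (b ^+ 2) x (1 : R))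
    (is_deriveX_fun 2 (is_derive_id x (1 : R)))) (is_derive_cst (2^-1 : R) x (1 : R)).
  have h2 := is_deriveB_fun (is_derive_cst (0 : R) x (1 : R)) (is_deriveM_fun h1 (dP x)).
  have -> : F = (fun y => cst 0 y - (cst (b ^+ 2) y - id y ^+ 2) * cst 2^-1 y * P y).
    by apply/funext => y; rewrite /F /cst sub0r.
  by apply: (is_derive_eq h2); rewrite /G /cst/=; field.
Qed.

Variable n : nat.
Notation e_ i := (delta_mx 0 i : 'rV[R]_n).

(* Vanishes on the unit sphere and has gradient [- y], whence integration by
   parts without boundary terms. *)
Definition halfgap (y : 'rV[R]_n) : R := (1 - dotv y y) / 2.

Lemma continuous_halfgap : continuous halfgap.
Proof.
have cd : continuous (fun y : 'rV[R]_n => dotv y y).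
  by apply: continuous_dotv2; exact: continuous_id_fun.
have cp : continuous (fun r : R => (1 - r) / 2).
  move=> r; apply: cvgM; last exact: cvg_cst.
  by apply: cvgB; [exact: cvg_cst|exact: cvg_id].
by move=> y; exact: (continuous_comp (@cd y) (@cp _)).
Qed.

Lemma dotv_row_of (t : n.-tuple mR) : dotv (row_of t) (row_of t) = sqnorm t.
Proof. by apply: eq_bigr => i _; rewrite mxE expr2. Qed.

Lemma row_of_set_coord (t : n.-tuple mR) i (x : R) : row_of (set_coord t i x) = row_of (set_coord t i 0) + x *: e_ i.
Proof.
apply/rowP => j; rewrite !mxE !tnth_mktuple eqxx/=.
by case: eqVneq => _; rewrite ?add0r ?mulr1 ?mulr0 ?addr0.
Qed.

Lemma sqnorm_set_coord (t : n.-tuple mR) i (x : R) :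
  sqnorm (set_coord t i x) = sqnorm (set_coord t i 0) + x ^+ 2.
Proof.
rewrite /sqnorm (bigD1 i)//= [in RHS](bigD1 i)//= !tnth_mktuple eqxx expr0n/= add0r addrC.
by congr (_ + _); apply: eq_bigr => j ji; rewrite !tnth_mktuple (negbTE ji).
Qed.

Lemma measurable_ball_fun (F : 'rV[R]_n -> R) : continuous F ->
  measurable_fun (tuple_ball n 1) (fun t => (F (row_of t))%:E).
Proof.
move=> cF; apply/measurable_EFinP; apply: measurable_funTS.
exact: measurable_continuous_row_of.
Qed.

(** Let c be the squared norm of the other coordinates. The line misses the ball if c >= 1;
    otherwise it meets it where |x| < b with b^2 = 1 - c, and there [halfgap] equals (b^2 - x^2) /
    2. *)
Lemma ball_ibp_line (P Q K : 'rV[R]_n -> R) (i : 'I_n) (t : n.-tuple mR) :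
  (forall x, is_derive x (e_ i) P (Q x)) -> continuous Q -> continuous K ->
  (\int[leb]_x ((fun t => (row_of t 0 i * P (row_of t) + K (row_of t))%:E) \_ (tuple_ball n 1)) (set_coord t i x) =
   \int[leb]_x ((fun t => (halfgap (row_of t) * Q (row_of t) + K (row_of t))%:E) \_ (tuple_ball n 1)) (set_coord t i x))%E.
Proof.
move=> dP cQ cK.
pose c := sqnorm (set_coord t i 0); pose z := row_of (set_coord t i 0).
have zi : z 0 i = 0 by rewrite !mxE tnth_mktuple eqxx.
have [c1|c1] := leP 1 c.
  have out (f : n.-tuple mR -> \bar R) x : (f \_ (tuple_ball n 1)) (set_coord t i x) = 0%E.
    rewrite patchE memNset// /tuple_ball/= sqnorm_set_coord -/c; apply/negP; rewrite -leNgt.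
    by rewrite -[X in X <= _]addr0 lerD// sqr_ge0.
  by apply: eq_integral => x _; rewrite !out.
pose b := Num.sqrt (1 - c).
have b2 : b ^+ 2 = 1 - c by rewrite sqr_sqrtr// subr_ge0 ltW.
have b0 : 0 < b by rewrite sqrtr_gt0 subr_gt0.
have inE' (f : n.-tuple mR -> \bar R) : (\int[leb]_x (f \_ (tuple_ball n 1)) (set_coord t i x) =
    \int[leb]_(x in `](- b)%R, b[) f (set_coord t i x))%E.
  rewrite [RHS]integral_mkcond; apply: eq_integral => x _; rewrite !patchE.
  have -> // : (set_coord t i x \in tuple_ball n 1) = (x \in `](- b)%R, b[%classic).
  apply/idP/idP; rewrite !inE/= in_itv/= /tuple_ball/= sqnorm_set_coord -/c => h.
    by apply/andP; split; nra.
  by move: h => /andP[]; nra.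
have cz : continuous (fun x : R => z + x *: e_ i).
  apply: continuousD_fun; first exact: cst_continuous.
  by apply: continuousZ_fun; [exact: continuous_id_fun|exact: cst_continuous].
rewrite !inE'.
transitivity (\int[leb]_(x in `](- b)%R, b[)
    (x * P (z + x *: e_ i) + K (z + x *: e_ i))%:E)%E.
  apply: eq_integral => x _; rewrite row_of_set_coord -/z; congr (_ * _ + _)%:E.
  by rewrite mxE zi add0r !mxE !eqxx mulr1.
transitivity (\int[leb]_(x in `](- b)%R, b[)
    ((b ^+ 2 - x ^+ 2) / 2 * Q (z + x *: e_ i) + K (z + x *: e_ i))%:E)%E.
  apply: (@integral_ball_line (fun x => P (z + x *: e_ i)) (fun x => Q (z + x *: e_ i))
    (fun x => K (z + x *: e_ i))); first exact: ltW.
  - by move=> x; exact: is_derive_line.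
  - by move=> x; exact: (continuous_comp (@cz x) (@cQ _)).
  - by move=> x; exact: (continuous_comp (@cz x) (@cK _)).
apply: eq_integral => x _; rewrite row_of_set_coord -/z; congr (_ * _ + _)%:E.
by rewrite /halfgap -row_of_set_coord dotv_row_of sqnorm_set_coord -/c b2; field.
Qed.

(* Adding the same [K] to both sides keeps the integrands nonnegative, so that
   Tonelli applies and no integrability has to be proved. *)
Lemma ball_ibp (P Q K : 'rV[R]_n -> R) (i : 'I_n) :
  (forall x, is_derive x (e_ i) P (Q x)) -> continuous P -> continuous Q -> continuous K ->
  (forall t, tuple_ball n 1 t -> 0 <= row_of t 0 i * P (row_of t) + K (row_of t)) ->
  (forall t, tuple_ball n 1 t -> 0 <= halfgap (row_of t) * Q (row_of t) + K (row_of t)) ->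
  (\int[lebesgue_n n]_(t in tuple_ball n 1) (row_of t 0 i * P (row_of t) + K (row_of t))%:E =
   \int[lebesgue_n n]_(t in tuple_ball n 1) (halfgap (row_of t) * Q (row_of t) + K (row_of t))%:E)%E.
Proof.
move=> dP cP cQ cK p0 q0; have mb := @measurable_tuple_ball R n 1.
have cA : continuous (fun y : 'rV[R]_n => y 0 i * P y + K y).
  move=> y; exact: (cvgD (cvgM (@continuous_coord _ _ i y) (cP y)) (cK y)).
have cB : continuous (fun y : 'rV[R]_n => halfgap y * Q y + K y).
  move=> y; exact: (cvgD (cvgM (@continuous_halfgap y) (cQ y)) (cK y)).
have mA := measurable_ball_fun cA; have mB := measurable_ball_fun cB.
rewrite integral_mkcond [RHS]integral_mkcond.
have E t := ball_ibp_line t dP cQ cK.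
have gA t : (0 <= ((fun t => (row_of t 0 i * P (row_of t) + K (row_of t))%:E) \_ (tuple_ball n 1)) t)%E.
  by rewrite patchE; case: ifPn => // /set_mem bt; rewrite lee_fin p0.
have gB t : (0 <= ((fun t => (halfgap (row_of t) * Q (row_of t) + K (row_of t))%:E) \_ (tuple_ball n 1)) t)%E.
  by rewrite patchE; case: ifPn => // /set_mem bt; rewrite lee_fin q0.
have mA' := (measurable_restrictT _ mb).1 mA.
have mB' := (measurable_restrictT _ mb).1 mB.
apply/eqP; rewrite eq_le; apply/andP; split; apply: (le_integral_lines (i := i)) => // t.
  by rewrite E.
by rewrite -E.
Qed.
End ball_ibp.

(** * Derivatives along rays from continuous partial derivatives *)

Section directional_derivative.
Context {R : realType}.

Lemma mean_value_at0 (g dg : R -> R) (h : R) :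
  (forall s, is_derive s (1 : R) g (dg s)) ->
  exists2 c, `|c| <= `|h| & g h - g 0 = dg c * h.
Proof.
move=> dG; have cg := is_derive_continuous dG.
have cw (a b : R) : {within `[a, b], continuous g}.
  by apply: continuous_in_subspaceT => x _; exact: cg.
have [h0|h0] := leP 0 h.
  have [c] := MVT_segment h0 (fun x _ => dG x) (cw 0 h).
  rewrite in_itv/= => /andP[c0 ch] ->; exists c; last by rewrite subr0.
  by rewrite !ger0_norm.
have [c] := MVT_segment (ltW h0) (fun x _ => dG x) (cw h 0).
rewrite in_itv/= => /andP[hc c0] E; exists c; last by lra.
by rewrite !ler0_norm ?lerN2// ltW.
Qed.

Variable V : normedModType R.

(** Move by h v, then by h w. On the second leg the mean value theorem gives the increment through
    [b] at an intermediate point, and continuity of [b] at x gives the limit. Iterated over the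
    coordinates, this produces all directional derivatives. *)
Lemma is_derive_addv (f a b : V -> R) (v w x : V) :
  is_derive x v f (a x) -> (forall y, is_derive y w f (b y)) -> {for x, continuous b} ->
  is_derive x (v + w) f (a x + b x).
Proof.
move=> [dv Dv] dw cb.
have cvg1 : h^-1 *: (f (h *: v + x) - f x) @[h --> (0 : R)^'] --> a x.
  by rewrite -Dv; exact: dv.
have mv (h : R) : exists c, `|c| <= `|h| /\
    f (h *: v + x + h *: w) - f (h *: v + x) = b (h *: v + x + c *: w) * h.
  have [c ch E] := @mean_value_at0 (fun s => f (h *: v + x + s *: w))
    (fun s => b (h *: v + x + s *: w)) h (fun s => is_derive_line (dw _)).
  by exists c; split=> //; rewrite -E scale0r addr0.
have /choice[c Hc] := mv.
have cvg2 : b (h *: v + x + c h *: w) @[h --> (0 : R)^'] --> b x.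
  have c0 : c h @[h --> (0 : R)^'] --> (0 : R).
    apply/cvgrPdist_le => e e0; near=> h; rewrite sub0r normrN.
    apply: (le_trans (Hc h).1); near: h; apply: dnbhs0_le; exact: e0.
  have i0 : (h : R) @[h --> (0 : R)^'] --> (0 : R) by exact: nbhs_dnbhs.
  have cx : (h *: v + x + c h *: w) @[h --> (0 : R)^'] --> 0 *: v + x + 0 *: w.
    apply: cvgD; last exact: (cvgZ c0 (cvg_cst w)).
    by apply: cvgD; [exact: (cvgZ i0 (cvg_cst v))|exact: cvg_cst].
  rewrite !scale0r add0r addr0 in cx.
  exact: (cvg_comp _ _ cx cb).
have cvg3 : h^-1 *: (f (h *: (v + w) + x) - f x) @[h --> (0 : R)^'] --> a x + b x.
  apply: cvg_trans (cvgD cvg1 cvg2); apply: near_eq_cvg; near=> h.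
  have h0 : h != 0 by near: h; exact: nbhs_dnbhs_neq.
  have [_ E] := Hc h.
  have Eb : b (h *: v + x + c h *: w) =
      h^-1 *: (f (h *: v + x + h *: w) - f (h *: v + x)).
    by rewrite E -[RHS]/(h^-1 * (_ * h)) mulrC mulfK.
  transitivity (h^-1 *: (f (h *: v + x) - f x) + b (h *: v + x + c h *: w)) => //.
  rewrite Eb -scalerDr (scalerDr h v w) (addrAC (h *: v)).
  by congr (_ *: _); ring.
split; first by apply/cvg_ex; exists (a x + b x).
exact: (cvg_lim _ cvg3).
Unshelve. all: by end_near.
Qed.
End directional_derivative.

Section partials.
Context {R : realType} {n : nat}.
Variables (f : 'rV[R]_n -> R) (p : 'I_n -> 'rV[R]_n -> R).
Hypothesis dp : forall i x, is_derive x (delta_mx 0 i) f (p i x).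
Hypothesis cp : forall i, continuous (p i).

Lemma is_derive_partials (x y : 'rV[R]_n) : is_derive x y f (\sum_i y 0 i * p i x).
Proof.
pose w (s : seq 'I_n) : 'rV[R]_n := \sum_(i <- s) y 0 i *: delta_mx 0 i.
have main s : forall z, is_derive z (w s) f (\sum_(i <- s) y 0 i * p i z).
  elim: s => [|i s IH] z.
    rewrite /w !big_nil; split; first exact: derivable0.
    exact: derive0.
  rewrite /w !big_cons (addrC (y 0 i *: _)) (addrC (y 0 i * _)).
  apply: (@is_derive_addv _ _ f (fun z => \sum_(i <- s) y 0 i * p i z)
    (fun z => y 0 i * p i z)).
  - move=> z'; apply: is_derive_line_at.
    have h1 := is_derive_cst (y 0 i) (0 : R) (1 : R).
    have h2 := is_deriveM_fun (is_derive_id (0 : R) (1 : R)) h1.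
    have h3 : is_derive ((fun r : R => r * y 0 i) 0) (1 : R)
        (fun r : R => f (z' + r *: delta_mx 0 i)) (p i z').
      by apply: is_derive_line; rewrite mul0r scale0r addr0.
    have := @is_derive_comp_real _ _ (fun r : R => f (z' + r *: delta_mx 0 i))
      (fun r : R => r * y 0 i) 0 1 (p i z') _ h3 h2.
    rewrite /cst mul1r mulr0 addr0 mulrC; congr (is_derive _ _ _ _).
    by apply/funext => r; rewrite scalerA.
  - exact: (cvgM (cvg_cst (y 0 i)) (@cp i z)).
have := main (index_enum _) x; rewrite /w.
by rewrite -(row_sum_delta y).
Qed.

Lemma is_derive_ray (x y : 'rV[R]_n) (s : R) :
  is_derive s (1 : R) (fun r => f (x + r *: y)) (\sum_i y 0 i * p i (x + s *: y)).
Proof. by apply: is_derive_line; exact: is_derive_partials. Qed.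
End partials.

Lemma continuous_sum_fun {R : realType} (T : topologicalType) (I : Type) (r : seq I)
    (F : I -> T -> R) : (forall i, continuous (F i)) ->
  continuous (fun x => \sum_(i <- r) F i x).
Proof. by move=> cF x; apply: cvg_sum_seq => i; exact: cF. Qed.

Section ball_integrals.
Context {R : realType} {n : nat}.
Notation mR := (measurableTypeR R).
Notation leb := (@lebesgue_measure R).
Notation B := (@tuple_ball R n 1).
Let mB : measurable B := @measurable_tuple_ball R n 1.

Lemma tuple_ball_coord (t : n.-tuple mR) i : B t -> `|row_of t 0 i| <= 1.
Proof.
rewrite /tuple_ball/= => Bt; rewrite -(@ler_pXn2r _ 2)// ?nnegrE// expr1n real_normK ?num_real//.
rewrite (le_trans _ (ltW Bt))// mxE /sqnorm (bigD1 i)//= lerDl sumr_ge0// => j _.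
exact: sqr_ge0.
Qed.

Lemma halfgap_ball (t : n.-tuple mR) : B t -> 0 <= halfgap (row_of t).
Proof. by rewrite /halfgap dotv_row_of /tuple_ball/= => h; rewrite divr_ge0// subr_ge0 ltW. Qed.

Lemma integral_ball_cst (c : R) : (\int[lebesgue_n n]_(t in B) c%:E = (c * omega n)%:E)%E.
Proof. rewrite EFinM -lebesgue_n_tuple_ball; exact: integral_cst. Qed.

Lemma ge0_integral_ballD (F G : 'rV[R]_n -> R) : continuous F -> continuous G ->
  (forall t, B t -> 0 <= F (row_of t)) -> (forall t, B t -> 0 <= G (row_of t)) ->
  (\int[lebesgue_n n]_(t in B) (F (row_of t) + G (row_of t))%:E =
   \int[lebesgue_n n]_(t in B) (F (row_of t))%:E + \int[lebesgue_n n]_(t in B) (G (row_of t))%:E)%E.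
Proof.
move=> cF cG F0 G0; under eq_integral do rewrite EFinD.
rewrite ge0_integralD//; [exact: measurable_ball_fun|exact: measurable_ball_fun].
Qed.

Lemma ge0_integral_ballZ (c : R) (F : 'rV[R]_n -> R) : 0 <= c -> continuous F ->
  (forall t, B t -> 0 <= F (row_of t)) ->
  (\int[lebesgue_n n]_(t in B) (c * F (row_of t))%:E = c%:E * \int[lebesgue_n n]_(t in B) (F (row_of t))%:E)%E.
Proof.
move=> c0 cF F0; under eq_integral do rewrite EFinM.
rewrite ge0_integralZl//; exact: measurable_ball_fun.
Qed.

Lemma ge0_integral_ball_sum (F : 'I_n -> 'rV[R]_n -> R) : (forall i, continuous (F i)) ->
  (forall i t, B t -> 0 <= F i (row_of t)) ->
  (\int[lebesgue_n n]_(t in B) (\sum_i F i (row_of t))%:E =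
   \sum_i \int[lebesgue_n n]_(t in B) (F i (row_of t))%:E)%E.
Proof.
move=> cF F0; under eq_integral do rewrite -sumEFin.
rewrite ge0_integral_sum//; by move=> i; exact: measurable_ball_fun.
Qed.

Lemma is_derive_coord (i : 'I_n) (x : 'rV[R]_n) :
  is_derive x (delta_mx 0 i) (fun y : 'rV[R]_n => y 0 i) (1 : R).
Proof.
apply: is_derive_line_at.
have h := is_deriveD_fun (is_derive_cst (x 0 i) (0:R) (1:R)) (is_derive_id (0:R) (1:R)).
rewrite (_ : (fun r : R => _) = (fun r : R => cst (x 0 i) r + id r)); last first.
  by apply/funext => r; rewrite !mxE !eqxx mulr1.
by apply: (is_derive_eq h); rewrite add0r.
Qed.

(** Integration by parts with P = y_i shows that y_i^2 and [halfgap] have the same integral h, for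
    each i. Since 1 is 2 halfgap plus the sum of the y_i^2, the volume equals (n + 2) h. *)
Lemma integral_halfgap :
  (\int[lebesgue_n n]_(t in B) (halfgap (row_of t))%:E = (omega n / n.+2%:R)%:E)%E.
Proof.
set h := (X in X = _).
have cst0 (c : R) : continuous (fun _ : 'rV[R]_n => c) by exact: cst_continuous.
have sq i : (\int[lebesgue_n n]_(t in B) (row_of t 0 i * row_of t 0 i + 0)%:E = h)%E.
  have c1 : continuous (fun y : 'rV[R]_n => y 0 i) by exact: continuous_coord.
  have := @ball_ibp R n (fun y => y 0 i) (fun=> 1) (fun=> 0) i
    (fun x => is_derive_coord i x) c1 (cst0 1) (cst0 0) => E.
  rewrite E; first by apply: eq_integral => t _; rewrite mulr1 addr0.
  - by move=> t _; rewrite addr0 -expr2 sqr_ge0.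
  - by move=> t Bt; rewrite addr0 mulr1 halfgap_ball.
have h0 : (0 <= h)%E by apply: integral_ge0 => t Bt; rewrite lee_fin halfgap_ball.
have csq i : continuous (fun y : 'rV[R]_n => y 0 i * y 0 i + 0).
  move=> y; exact: (cvgD (cvgM (@continuous_coord _ _ i y) (@continuous_coord _ _ i y)) (@cst0 0 y)).
have sq0 i t : B t -> 0 <= row_of t 0 i * row_of t 0 i + 0.
  by move=> _; rewrite addr0 -expr2 sqr_ge0.
have cs : continuous (fun y : 'rV[R]_n => \sum_i (y 0 i * y 0 i + 0)).
  by apply: continuous_sum_fun => i; exact: csq.
have : ((omega n)%:E = n.+2%:R%:E * h)%E.
  transitivity (\int[lebesgue_n n]_(t in B)
      (2 * halfgap (row_of t) + \sum_i (row_of t 0 i * row_of t 0 i + 0))%:E)%E.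
    rewrite -[omega n]mul1r -integral_ball_cst; apply: eq_integral => t _; congr EFin.
    rewrite (eq_bigr (fun i => row_of t 0 i * row_of t 0 i)) => [|i _]; last by rewrite addr0.
    by rewrite -/(dotv (row_of t) (row_of t)) /halfgap; field.
  rewrite (@ge0_integral_ballD (fun y => 2 * halfgap y) (fun y => \sum_i (y 0 i * y 0 i + 0)))//.
  - rewrite (@ge0_integral_ballZ 2 (@halfgap R n))//; last 2 first.
    + exact: continuous_halfgap.
    + exact: halfgap_ball.
    rewrite (@ge0_integral_ball_sum (fun i y => y 0 i * y 0 i + 0))//.
    rewrite (eq_bigr (fun=> h)) => [|i _]; last exact: sq.
    have -> : (n.+2%:R%:E * h = 2%:E * h + n%:R%:E * h)%E.
      by rewrite -ge0_muleDl// -EFinD -natrD add2n.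
    by congr (_ + _)%E; rewrite sumr_const card_ord mule_natl.
  - by move=> y; exact: (cvgM (@cst0 2 y) (@continuous_halfgap _ _ y)).
  - by move=> t Bt; rewrite mulr_ge0// halfgap_ball.
  - by move=> t Bt; apply: sumr_ge0 => i _; exact: (sq0 i t Bt).
(* [h] is an extended real so far; an infinite value contradicts the finite volume. *)
case: h h0 {sq} => [x _|_|//].
- by rewrite -EFinM => -[->]; congr EFin; field.
- by rewrite gt0_muley// lte_fin.
Qed.
End ball_integrals.

Section mean_value.
Context {R : realType} {n : nat}.
Notation mR := (measurableTypeR R).
Notation leb := (@lebesgue_measure R).
Notation B := (@tuple_ball R n 1).
Let mB : measurable B := @measurable_tuple_ball R n 1.
Notation e_ i := (delta_mx 0 i : 'rV[R]_n).

Variables (f : 'rV[R]_n -> R) (p q : 'I_n -> 'rV[R]_n -> R) (C : R).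
Hypothesis cf : continuous f.
Hypothesis cp : forall i, continuous (p i).
Hypothesis cq : forall i, continuous (q i).
Hypothesis df : forall i x, is_derive x (e_ i) f (p i x).
Hypothesis dp : forall i x, is_derive x (e_ i) (p i) (q i x).
Hypothesis C0 : 0 <= C.
Hypothesis pqC : forall i x, `|p i x| <= C /\ `|q i x| <= C.
Hypothesis lap : forall x, -1 <= \sum_i q i x.
Hypothesis f0 : forall x, 0 <= f x.

Variable x0 : 'rV[R]_n.

Let aff l (y : 'rV[R]_n) := x0 + l *: y.

Let caff l : continuous (aff l).
Proof.
apply: continuousD_fun; first exact: cst_continuous.
by apply: continuousZ_fun; [exact: cst_continuous|exact: continuous_id_fun].
Qed.

(** The radial derivative, that is, the derivative in l of f(x0 + l y). *)
Let S l (y : 'rV[R]_n) : R := \sum_i y 0 i * p i (aff l y).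

Let cpa i l : continuous (fun y => p i (aff l y)).
Proof. by move=> y; exact: (continuous_comp (@caff l y) (@cp i _)). Qed.

Let cqa i l : continuous (fun y => q i (aff l y)).
Proof. by move=> y; exact: (continuous_comp (@caff l y) (@cq i _)). Qed.

Let cst0 (c : R) : continuous (fun _ : 'rV[R]_n => c).
Proof. exact: cst_continuous. Qed.

Let cS l : continuous (S l).
Proof.
apply: continuous_sum_fun => i y; exact: (cvgM (@continuous_coord _ _ i y) (@cpa i l y)).
Qed.

Let term_ge0 i l t : B t -> 0 <= row_of t 0 i * p i (aff l (row_of t)) + C.
Proof.
move=> Bt; have := tuple_ball_coord i Bt; have [] := pqC i (aff l (row_of t)).
rewrite !ler_norml; move: (row_of t 0 i) (p i _) => a b; nra.
Qed.

Let SC_ge0 l t : B t -> 0 <= S l (row_of t) + n%:R * C.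
Proof.
move=> Bt; have -> : n%:R * C = \sum_(i < n) C by rewrite sumr_const card_ord mulr_natl.
by rewrite -big_split; apply: sumr_ge0 => i _; exact: term_ge0.
Qed.

Let dpa i l (y : 'rV[R]_n) :
  is_derive y (e_ i) (fun y => p i (aff l y)) (l * q i (aff l y)).
Proof.
apply: is_derive_line_at.
have h2 := is_deriveM_fun (is_derive_id (0 : R) (1 : R)) (is_derive_cst l (0 : R) (1 : R)).
have h3 : is_derive ((fun r : R => r * l) 0) (1 : R)
    (fun r : R => p i (aff l y + r *: e_ i)) (q i (aff l y)).
  by apply: is_derive_line; rewrite mul0r scale0r addr0; exact: dp.
have := @is_derive_comp_real _ _ (fun r : R => p i (aff l y + r *: e_ i))
  (fun r : R => r * l) 0 1 (q i (aff l y)) _ h3 h2.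
rewrite /cst mul1r mulr0 addr0 mulrC.
rewrite (_ : (fun r : R => p i (aff l (y + r *: e_ i))) =
  (fun r : R => p i (aff l y + (r * l) *: e_ i)))//.
by apply/funext => r; rewrite /aff scalerDr addrA scalerA mulrC.
Qed.

Let h : R := omega n / n.+2%:R.

(** By parts in each coordinate, the integral of [S l] is that of l halfgap times the Laplacian of f
    at x0 + l y, hence at least -l h. The constant n C stands on both sides to keep the integrands
    nonnegative. *)
Lemma ball_radial_ge l : 0 <= l ->
  ((n%:R * C * omega n)%:E <=
    \int[lebesgue_n n]_(t in B) (S l (row_of t) + n%:R * C)%:E + (l * h)%:E)%E.
Proof.
move=> l0.
(* [C] compensates y_i p_i on the unit ball, and [l * C * halfgap y] compensates l halfgap q_i. *)
pose K (y : 'rV[R]_n) := C + l * C * halfgap y.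
have cH := @continuous_halfgap R n.
have cK : continuous K.
  by move=> y; exact: (cvgD (@cst0 C y) (cvgM (@cst0 (l * C) y) (@cH y))).
have lC0 : 0 <= l * C by rewrite mulr_ge0.
pose A i (y : 'rV[R]_n) := y 0 i * p i (aff l y) + K y.
pose D i (y : 'rV[R]_n) := halfgap y * (l * q i (aff l y)) + K y.
have A0 i t : B t -> 0 <= A i (row_of t).
  move=> Bt; rewrite /A /K addrA addr_ge0 ?term_ge0// mulr_ge0//; exact: halfgap_ball.
have D0 i t : B t -> 0 <= D i (row_of t).
  move=> Bt; have H0 := halfgap_ball Bt; have [_] := pqC i (aff l (row_of t)).
  rewrite ler_norml => /andP[q1 _].
  have -> : D i (row_of t) = C + (l * halfgap (row_of t)) * (q i (aff l (row_of t)) + C).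
    by rewrite /D /K; ring.
  have qC : 0 <= q i (aff l (row_of t)) + C by rewrite -lerBlDr sub0r.
  by rewrite addr_ge0// mulr_ge0// mulr_ge0.
have cA i : continuous (A i).
  by move=> y; exact: (cvgD (cvgM (@continuous_coord _ _ i y) (@cpa i l y)) (@cK y)).
have cD i : continuous (D i).
  move=> y; exact: (cvgD (cvgM (@cH y) (cvgM (@cst0 l y) (@cqa i l y))) (@cK y)).
have clq i : continuous (fun y => l * q i (aff l y)).
  by move=> y; exact: (cvgM (@cst0 l y) (@cqa i l y)).
have E i : (\int[lebesgue_n n]_(t in B) (A i (row_of t))%:E = \int[lebesgue_n n]_(t in B) (D i (row_of t))%:E)%E.
  exact: (@ball_ibp R n (fun y => p i (aff l y)) (fun y => l * q i (aff l y)) K i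
    (dpa i l) (@cpa i l) (@clq i) cK (@A0 i) (@D0 i)).
have ES : (\int[lebesgue_n n]_(t in B) (\sum_i A i (row_of t))%:E =
    \int[lebesgue_n n]_(t in B) (\sum_i D i (row_of t))%:E)%E.
  by rewrite !ge0_integral_ball_sum//; apply: eq_bigr => i _; exact: E.
pose H (y : 'rV[R]_n) := n%:R * (l * C) * halfgap y.
have nlC : 0 <= n%:R * (l * C) by rewrite mulr_ge0.
have cHn : continuous H by move=> y; exact: (cvgM (@cst0 _ y) (@cH y)).
have H0 t : B t -> 0 <= H (row_of t) by move=> Bt; rewrite mulr_ge0// halfgap_ball.
have IH : (\int[lebesgue_n n]_(t in B) (H (row_of t))%:E = (n%:R * (l * C) * h)%:E)%E.
  rewrite (@ge0_integral_ballZ _ _ _ (@halfgap R n))//; last exact: halfgap_ball.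
  by rewrite integral_halfgap -EFinM.
have cSC : continuous (fun y => S l y + n%:R * C).
  by move=> y; exact: (cvgD (@cS l y) (@cst0 _ y)).
have EA : (\int[lebesgue_n n]_(t in B) (\sum_i A i (row_of t))%:E =
   \int[lebesgue_n n]_(t in B) (S l (row_of t) + n%:R * C)%:E + (n%:R * (l * C) * h)%:E)%E.
  rewrite -IH -(@ge0_integral_ballD _ _ (fun y => S l y + n%:R * C) H)//; last exact: SC_ge0.
  apply: eq_integral => t _; congr EFin; rewrite big_split/= -addrA; congr (_ + _).
  by rewrite sumr_const card_ord /K /H -mulr_natl; ring.
have cDs : continuous (fun y => \sum_i D i y) by exact: continuous_sum_fun.
have Ds0 t : B t -> 0 <= \sum_i D i (row_of t).
  by move=> Bt; apply: sumr_ge0 => i _; exact: D0.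
pose H1 (y : 'rV[R]_n) := l * halfgap y.
have cH1 : continuous H1 by move=> y; exact: (cvgM (@cst0 _ y) (@cH y)).
have H10 t : B t -> 0 <= H1 (row_of t) by move=> Bt; rewrite mulr_ge0// halfgap_ball.
have IH1 : (\int[lebesgue_n n]_(t in B) (H1 (row_of t))%:E = (l * h)%:E)%E.
  rewrite (@ge0_integral_ballZ _ _ _ (@halfgap R n))//; last exact: halfgap_ball.
  by rewrite integral_halfgap -EFinM.
have nC : 0 <= n%:R * C by rewrite mulr_ge0.
have : ((n%:R * C * omega n + n%:R * (l * C) * h)%:E <=
    \int[lebesgue_n n]_(t in B) (\sum_i D i (row_of t))%:E + (l * h)%:E)%E.
  rewrite -IH1 -(@ge0_integral_ballD _ _ (fun y => \sum_i D i y) H1)//.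
  rewrite EFinD -IH -integral_ball_cst -(@ge0_integral_ballD _ _ (fun=> n%:R * C) H)//.
  apply: ge0_le_integral => //.
  - by move=> t Bt; rewrite lee_fin addr_ge0// H0.
  - apply: (@measurable_ball_fun R n (fun y => n%:R * C + H y)).
    by move=> y; exact: (cvgD (@cst0 _ y) (@cHn y)).
  - apply: (@measurable_ball_fun R n (fun y => \sum_i D i y + H1 y)).
    by move=> y; exact: (cvgD (@cDs y) (@cH1 y)).
  - move=> t Bt; rewrite lee_fin big_split/= sumr_const card_ord /K -mulr_natl.
    rewrite -mulr_sumr -mulr_sumr /H /H1.
    have := lap (aff l (row_of t)); have := halfgap_ball Bt.
    move: (halfgap _) (\sum_i q i _) => g s g0 s1.
    have lg : 0 <= l * g * (s + 1) by rewrite !mulr_ge0//; lra.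
    lra.
rewrite -ES EA EFinD addeAC leeD2rE// => /le_trans; apply.
Qed.

Let proj (s : n.+1.-tuple mR) : n.-tuple mR := [tuple of behead s].
Let jaff (s : n.+1.-tuple mR) : n.-tuple mR :=
  [tuple (x0 0 i + tnth s ord0 * tnth (proj s) i)%R | i < n].

Let mproj : measurable_fun setT proj.
Proof. exact: measurable_behead. Qed.

Let mjaff : measurable_fun setT jaff.
Proof.
apply/measurable_fun_tnthP => i.
rewrite (_ : _ \o _ = fun s => (x0 0 i + tnth s ord0 * tnth (proj s) i)%R); last first.
  by apply/funext => t /=; rewrite tnth_mktuple.
apply: measurable_funD => //; apply: measurable_funM; first exact: measurable_tnth.
by apply: (measurableT_comp (@measurable_tnth _ _ _ i)); exact: mproj.
Qed.

Let jaffE (x : mR) (t : n.-tuple mR) : row_of (jaff [tuple of x :: t]) = aff x (row_of t).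
Proof.
apply/rowP => i; rewrite !mxE tnth_mktuple tnth0; congr (_ + _ * _).
by congr tnth; exact/val_inj.
Qed.

Let projE (x : mR) (t : n.-tuple mR) : proj [tuple of x :: t] = t.
Proof. exact/val_inj. Qed.

(** f(x0 + r y) - f(x0) is the integral of [S l y] over 0 <= l <= r. Integrated over the ball with
    the two integrals exchanged, it is at least the integral of -l h over [0, r], namely -h r^2 /
    2. *)
Lemma mean_value_ball r : 0 < r ->
  ((f x0 * omega n)%:E <= \int[lebesgue_n n]_(t in B) (f (x0 + r *: row_of t))%:E
     + (omega n / n.+2%:R * (r ^+ 2 / 2))%:E)%E.
Proof.
move=> r0.
(* Joint integrand in (l, y), with l as head coordinate; [I1] and [I2] are its two iterated
   integrals. *)
pose g (s : n.+1.-tuple mR) : R := \1_(`[0, r]%classic : set mR) (tnth s ord0) *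
  (\1_B (proj s) * (\sum_i tnth (proj s) i * p i (row_of (jaff s)) + n%:R * C)).
have gE (x : mR) (t : n.-tuple mR) : g [tuple of x :: t] = \1_(`[0, r]%classic : set mR) x *
    (\1_B t * (S x (row_of t) + n%:R * C)).
  rewrite /g tnth0 projE jaffE; congr (_ * (_ * (_ + _))).
  by apply: eq_bigr => i _; rewrite mxE.
have g0 s : (0 <= (g s)%:E)%E.
  rewrite (tuple_eta s) gE lee_fin mulr_ge0// indicE.
  by case: (boolP (_ \in _)) => [/set_mem Bt|_]; rewrite ?mul0r// mul1r SC_ge0.
have mg : measurable_fun setT (fun s => (g s)%:E).
  apply/measurable_EFinP; apply: measurable_funM.
    apply: measurableT_comp; last exact: measurable_tnth.
    exact: measurable_indic.
  apply: measurable_funM.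
    by apply: (measurableT_comp _ mproj); exact: measurable_indic.
  apply: measurable_funD => //; apply: measurable_sum => i; apply: measurable_funM.
    by apply: (measurableT_comp (@measurable_tnth _ _ _ i)); exact: mproj.
  exact: (measurableT_comp (measurable_continuous_row_of (@cp i)) mjaff).
pose I (x : mR) : \bar R := (\int[lebesgue_n n]_t (g [tuple of x :: t])%:E)%E.
have mI : measurable_fun setT I.
  apply: (@measurable_fun_fubini_tonelli_F _ _ _ _ _ _ ((fun s => (g s)%:E) \o @tuple_cons R n)).
  - by apply: measurableT_comp => //; exact: measurable_tuple_cons.
  - by move=> x; exact: g0.
have I0 x : (0 <= I x)%E by exact: integral_ge0.
have IE x : I x = if x \in (`[0%R, r]%classic : set mR)
    then (\int[lebesgue_n n]_(t in B) (S x (row_of t) + n%:R * C)%:E)%E else 0%E.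
  rewrite /I; under eq_integral do rewrite gE.
  rewrite indicE; case: (boolP (_ \in _)) => _; last first.
    by under eq_integral do rewrite mul0r; rewrite integral0.
  rewrite [RHS]integral_mkcond; apply: eq_integral => t _.
  by rewrite patchE indicE ?mul1r; case: (_ \in _); rewrite ?mul1r ?mul0r.
have I1 : (\int[lebesgue_n n.+1]_s (g s)%:E = \int[leb]_(x in `[0%R, r]) I x)%E.
  rewrite (ge0_integral_lebesgue_nS mg g0) [RHS]integral_mkcond; apply: eq_integral => x _.
  by rewrite patchE; case: ifPn => // xr; rewrite -/(I x) IE ifN.
have J (t : n.-tuple mR) : (\int[leb]_(x in `[0%R, r]) (S x (row_of t) + n%:R * C)%:E =
    (f (x0 + r *: row_of t) + n%:R * C * r - f x0)%:E)%E.
  pose F x := f (x0 + x *: row_of t) + n%:R * C * x.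
  have dF x : is_derive x (1 : R) F (S x (row_of t) + n%:R * C).
    have d1 := is_derive_ray df cp x0 (row_of t) x.
    have d2 := is_deriveM_fun (is_derive_cst (n%:R * C) x (1 : R)) (is_derive_id x (1 : R)).
    by apply: (is_derive_eq (is_deriveD_fun d1 d2)); rewrite /cst mulr1 mul0r add0r.
  rewrite (@continuous_FTC _ F (fun x => S x (row_of t) + n%:R * C) 0 r (ltW r0))//.
  - by congr EFin; rewrite /F scale0r !addr0 mulr0 addr0.
  - move=> x; apply: cvgD; last exact: cvg_cst.
    apply: (@continuous_sum_fun R R _ _ (fun i x => row_of t 0 i * p i (x0 + x *: row_of t))) => i {}x.
    apply: cvgM; first exact: cvg_cst.
    have cl : {for x, continuous (fun x : R => x0 + x *: row_of t)}.
      by apply: cvgD; [exact: cvg_cst|exact: (cvgZ cvg_id (cvg_cst (row_of t)))].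
    exact: (continuous_comp cl (@cp i _)).
  - exact: (is_derive_continuous dF).
have I2 : (\int[lebesgue_n n.+1]_s (g s)%:E = \int[lebesgue_n n]_(t in B)
    (f (x0 + r *: row_of t) + n%:R * C * r - f x0)%:E)%E.
  rewrite (ge0_integral_lebesgue_nS2 mg g0) [RHS]integral_mkcond; apply: eq_integral => t _.
  rewrite patchE; under eq_integral do rewrite gE.
  rewrite indicE; case: (boolP (_ \in _)) => Bt; last first.
    by under eq_integral do rewrite mul0r mulr0; rewrite integral0.
  rewrite -J [RHS]integral_mkcond; apply: eq_integral => x _.
  by rewrite patchE indicE ?mul1r; case: (_ \in _); rewrite ?mul1r ?mul0r.
have nCr0 : 0 <= n%:R * C * r by rewrite !mulr_ge0// ltW.
have f0' t : B t -> 0 <= f (x0 + r *: row_of t) + n%:R * C * r - f x0.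
  move=> Bt; rewrite -lee_fin -J; apply: integral_ge0 => x _.
  by rewrite lee_fin SC_ge0.
have cfr : continuous (fun y : 'rV[R]_n => f (x0 + r *: y)).
  by move=> y; exact: (continuous_comp (@caff r y) (@cf _)).
have cfr' : continuous (fun y : 'rV[R]_n => f (x0 + r *: y) + n%:R * C * r - f x0).
  by move=> y; exact: (cvgB (cvgD (@cfr y) (@cst0 _ y)) (@cst0 _ y)).
have h0 : 0 <= h by rewrite divr_ge0// ltW// omega_gt0.
have Ih : (\int[leb]_(x in `[0%R, r]) (h * x)%:E = (h * (r ^+ 2 / 2))%:E)%E.
  pose F x : R := h * (x ^+ 2 / 2).
  have dF x : is_derive x (1 : R) F (h * x).
    have d := is_deriveM_fun (is_derive_cst h x (1 : R))
      (is_deriveM_fun (is_deriveX_fun 2 (is_derive_id x (1 : R))) (is_derive_cst (2^-1 : R) x (1 : R))).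
    by apply: (is_derive_eq d); rewrite /cst/=; field.
  rewrite (@continuous_FTC _ F (fun x => h * x) 0 r (ltW r0))//.
  - by congr EFin; rewrite /F expr0n/=; ring.
  - by move=> x; apply: cvgM; [exact: cvg_cst|exact: cvg_id].
  - exact: (is_derive_continuous dF).
have key : ((n%:R * C * r * omega n)%:E <=
    \int[lebesgue_n n]_(t in B) (f (x0 + r *: row_of t) + n%:R * C * r - f x0)%:E +
    (h * (r ^+ 2 / 2))%:E)%E.
  rewrite -I2 I1 -Ih -ge0_integralD//; last 3 first.
  - exact: measurable_funTS.
  - by move=> x; rewrite /= in_itv/= => /andP[x0' _]; rewrite lee_fin mulr_ge0.
  - by apply/measurable_EFinP; apply: measurable_funM.
  have <- : (\int[leb]_(x in `[0%R, r]) (n%:R * C * omega n)%:E =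
      (n%:R * C * r * omega n)%:E)%E.
    rewrite integral_cst// [X in (_ * X)%E]lebesgue_measure_itv/= lte_fin r0 sube0 -EFinM.
    by congr EFin; ring.
  apply: ge0_le_integral => //.
  - by move=> x _; rewrite lee_fin !mulr_ge0// ltW// omega_gt0.
  - apply: emeasurable_funD; first exact: measurable_funTS.
    by apply/measurable_EFinP; apply: measurable_funM.
  - move=> x xr; rewrite IE mem_set// (mulrC h x); apply: ball_radial_ge.
    by move: xr; rewrite /= in_itv/= => /andP[].
have om0 := omega_gt0 (R := R) n.
have E : (\int[lebesgue_n n]_(t in B) (f (x0 + r *: row_of t) + n%:R * C * r - f x0)%:E +
    (f x0 * omega n)%:E =
    \int[lebesgue_n n]_(t in B) (f (x0 + r *: row_of t))%:E + (n%:R * C * r * omega n)%:E)%E.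
  rewrite -!integral_ball_cst.
  rewrite -(@ge0_integral_ballD _ _ (fun y => f (x0 + r *: y) + n%:R * C * r - f x0)
    (fun=> f x0))//.
  rewrite -(@ge0_integral_ballD _ _ (fun y => f (x0 + r *: y)) (fun=> n%:R * C * r))//.
  by apply: eq_integral => t _; rewrite subrK.
rewrite -(@leeD2rE _ (n%:R * C * r * omega n)%:E)//.
rewrite [leRHS]addeAC -E [leRHS]addeAC [leLHS]addeC; exact: leeD key (lexx _).
Qed.
End mean_value.

(** * Comparison along rays *)

Section ray_comparison.
Context {R : realType} {n : nat}.
Notation mR := (measurableTypeR R).
Notation leb := (@lebesgue_measure R).

Definition tuple_norm (t : n.-tuple mR) : R := Num.sqrt (sqnorm t).

Lemma tuple_norm_ge0 t : 0 <= tuple_norm t. Proof. exact: sqrtr_ge0. Qed.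

Lemma measurable_tuple_norm : measurable_fun [set: n.-tuple mR] tuple_norm.
Proof.
apply: (measurableT_comp (f := @Num.sqrt R)); last exact: measurable_sqnorm.
by apply: continuous_measurable_fun => x; exact: sqrt_continuous.
Qed.

(** The inverse is rewritten as the power with exponent -1; both are 0 at the origin. *)
Lemma measurable_tuple_normV : measurable_fun [set: n.-tuple mR] (fun t => (tuple_norm t)^-1).
Proof.
rewrite (_ : (fun t => _) = (fun t => tuple_norm t `^ (-1))).
  exact: (measurableT_comp (measurable_powR _) measurable_tuple_norm).
by apply/funext => t; rewrite powR_inv1// tuple_norm_ge0.
Qed.

Lemma measurable_truth d (T : measurableType d) (b : T -> bool) :
  measurable_fun setT b -> measurable_fun setT (fun x => (b x)%:R : R).
Proof.
by move=> mb; apply: (measurableT_comp (f := fun c : bool => c%:R : R)).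
Qed.

Definition dilate (s : mR) (t : n.-tuple mR) := affine_tuple [tuple of nseq n 0] s t.

Lemma tuple_norm_dilate s t : 0 <= s -> tuple_norm (dilate s t) = s * tuple_norm t.
Proof.
by move=> s0; rewrite /tuple_norm /dilate sqnorm_affine_tuple0 sqrtrM ?sqr_ge0// sqrtr_sqr ger0_norm.
Qed.

Lemma dilate_dilate a b t : dilate a (dilate b t) = dilate (a * b) t.
Proof.
by apply: eq_from_tnth => i; rewrite !tnth_mktuple !tnth_nseq !add0r mulrA.
Qed.

Let proj (s : n.+1.-tuple mR) : n.-tuple mR := [tuple of behead s].
Let mproj : measurable_fun setT proj.
Proof. exact: measurable_behead. Qed.
Let projE (x : mR) (t : n.-tuple mR) : proj [tuple of x :: t] = t.
Proof. exact/val_inj. Qed.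

Let jdil (s : n.+1.-tuple mR) : n.-tuple mR := dilate (tnth s ord0) (proj s).
Let mjdil : measurable_fun setT jdil.
Proof.
apply/measurable_fun_tnthP => i.
rewrite (_ : _ \o _ = fun s => (tnth s ord0 * tnth (proj s) i)%R); last first.
  by apply/funext => t /=; rewrite tnth_mktuple tnth_nseq add0r.
apply: measurable_funM; first exact: measurable_tnth.
by apply: (measurableT_comp (@measurable_tnth _ _ _ i)); exact: mproj.
Qed.
Let jdilE (x : mR) (t : n.-tuple mR) : jdil [tuple of x :: t] = dilate x t.
Proof. by rewrite /jdil projE tnth0. Qed.

Lemma lebesgue_n_origin : (0 < n)%N -> lebesgue_n n [set t : n.-tuple mR | tuple_norm t = 0] = 0%E.
Proof.
move=> n0; set S := [set _ | _]; apply/eqP; rewrite eq_le measure_ge0 andbT.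
apply/lee_addgt0Pr => e e0; rewrite add0e.
(* As b <= 1 and n > 0, the ball of radius b has volume omega b^n <= omega b <= e. *)
pose b := Num.min 1 (e / omega n).
have om := omega_gt0 (R := R) n.
have b0 : 0 < b by rewrite lt_min ltr01 divr_gt0.
have mS : measurable S.
  rewrite (_ : S = tuple_norm @^-1` [set 0])//; rewrite -[X in measurable X]setTI.
  by apply: measurable_tuple_norm.
apply: (@le_trans _ _ (lebesgue_n n (tuple_ball n (b ^+ 2)))).
  apply: le_measure; rewrite ?inE//; first exact: measurable_tuple_ball.
  move=> t; rewrite /S /tuple_ball/= => nt.
  suff -> : sqnorm t = 0 by rewrite exprn_gt0.
  by rewrite -(sqr_sqrtr (sqnorm_ge0 t)) -/(tuple_norm t) nt expr0n.
rewrite lebesgue_n_tuple_ball_scale// lebesgue_n_tuple_ball -EFinM lee_fin -ler_pdivlMr//.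
have b1 : b <= 1 by rewrite /b ge_min lexx.
have b2 : b <= e / omega n by rewrite /b ge_min lexx orbT.
apply: le_trans b2; rewrite -[leRHS]expr1; exact: (ler_wiXn2l (ltW b0) b1).
Qed.

(* With this weight, [int_(s > 0) w (t / s) / s ds = 1] for every [t <> 0]. *)
Definition ray_weight (z : n.-tuple mR) : R := (tuple_norm z)^-1 * (1 < tuple_norm z)%R%:R.

Lemma ray_weight_ge0 z : 0 <= ray_weight z.
Proof. by rewrite mulr_ge0// invr_ge0 tuple_norm_ge0. Qed.

(** The radial integral of polar coordinates, for a vector z that need not be a unit vector. *)
Definition ray_integral (F : n.-tuple mR -> R) (z : n.-tuple mR) : \bar R :=
  (\int[leb]_(s in `]0%R, +oo[) (s ^+ n.-1 * F (dilate s z))%:E)%E.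

Let mh1 (F : n.-tuple mR -> R) : measurable_fun setT F ->
  measurable_fun setT (fun s : n.+1.-tuple mR => (F (proj s) * ((tuple_norm (proj s))^-1 *
    ((0 < tnth s ord0)%R && (tnth s ord0 < tuple_norm (proj s))%R)%:R))%:E).
Proof.
move=> mF; apply/measurable_EFinP; apply: measurable_funM; first exact: measurableT_comp.
apply: measurable_funM; first exact: (measurableT_comp measurable_tuple_normV).
have mt := @measurable_tnth _ mR n.+1 ord0.
apply: measurable_truth; apply: measurable_and; apply: measurable_fun_ltr => //.
exact: (measurableT_comp measurable_tuple_norm).
Qed.

Lemma measurable_ray_weight : measurable_fun setT ray_weight.
Proof.
apply: measurable_funM; first exact: measurable_tuple_normV.
apply: measurable_truth; apply: measurable_fun_ltr => //; exact: measurable_tuple_norm.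
Qed.

Let mh2 (F : n.-tuple mR -> R) : measurable_fun setT F ->
  measurable_fun setT (fun s : n.+1.-tuple mR => ((0 < tnth s ord0)%R%:R *
  ((tnth s ord0) ^+ n.-1 * F (jdil s) * ray_weight (proj s)))%:E).
Proof.
move=> mF; have mt := @measurable_tnth _ mR n.+1 ord0.
apply/measurable_EFinP; apply: measurable_funM.
  by apply: measurable_truth; apply: measurable_fun_ltr.
apply: measurable_funM; last exact: (measurableT_comp measurable_ray_weight).
apply: measurable_funM; last exact: measurableT_comp.
by apply: measurable_funX.
Qed.

Lemma measurable_dilate_fun (F : n.-tuple mR -> R) (k : nat) z : measurable_fun setT F ->
  measurable_fun setT (fun s : mR => (s ^+ k * F (dilate s z))%:E).
Proof.
move=> mF; apply/measurable_EFinP; apply: measurable_funM; first exact: measurable_funX.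
apply: (measurableT_comp mF); apply/measurable_fun_tnthP => i.
rewrite (_ : _ \o _ = fun s => (s * tnth z i)%R); last first.
  by apply/funext => t /=; rewrite tnth_mktuple tnth_nseq add0r.
by apply: measurable_funM.
Qed.

(** Polar coordinates without a measure on the sphere: insert 1 as the integral of 1/|t| over 0 < s
    < |t|, exchange the integrals, substitute t = s z with Jacobian s^n, and exchange back. The
    factor 1/|s z| = 1/(s |z|) reduces s^n to s^(n-1). *)
Lemma integral_rays (F : n.-tuple mR -> R) : (0 < n)%N ->
  measurable_fun setT F -> (forall t, 0 <= F t) ->
  (\int[lebesgue_n n]_t (F t)%:E = \int[lebesgue_n n]_z ((ray_weight z)%:E * ray_integral F z))%E.
Proof.
move=> n0 mF F0.
pose h1 (s : n.+1.-tuple mR) : R := F (proj s) * ((tuple_norm (proj s))^-1 *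
  ((0 < tnth s ord0)%R && (tnth s ord0 < tuple_norm (proj s))%R)%:R).
pose h2 (s : n.+1.-tuple mR) : R := (0 < tnth s ord0)%R%:R *
  ((tnth s ord0) ^+ n.-1 * F (jdil s) * ray_weight (proj s)).
have h10 s : (0 <= (h1 s)%:E)%E by rewrite lee_fin !mulr_ge0// invr_ge0 tuple_norm_ge0.
have h20 s : (0 <= (h2 s)%:E)%E.
  rewrite lee_fin /h2; have [x0|x0] := ltP 0 (tnth s ord0); last by rewrite mul0r.
  by rewrite mul1r mulr_ge0 ?ray_weight_ge0// mulr_ge0// exprn_ge0// ltW.
have mf1 : measurable_fun setT (fun s => (h1 s)%:E) by exact: mh1.
have mf2 : measurable_fun setT (fun s => (h2 s)%:E) by exact: mh2.
transitivity (\int[lebesgue_n n.+1]_s (h1 s)%:E)%E.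
  rewrite (ge0_integral_lebesgue_nS2 mf1 h10).
  (* At t = 0 the inserted factor is 0 instead of 1, so the origin is removed from both
     integrals. *)
  have mN : measurable [set t : n.-tuple mR | tuple_norm t = 0].
    rewrite (_ : [set t | _] = tuple_norm @^-1` [set 0])//; rewrite -[X in measurable X]setTI.
    by apply: measurable_tuple_norm.
  rewrite (ge0_negligible_integral mN)//; last 3 first.
  - exact/measurable_EFinP.
  - by move=> t _; rewrite lee_fin.
  - exact: lebesgue_n_origin.
  rewrite [RHS](ge0_negligible_integral mN)//; last 3 first.
  - apply: (@measurable_fun_fubini_tonelli_G _ _ _ _ _ _ ((fun s => (h1 s)%:E) \o @tuple_cons R n)).
    + by apply: measurableT_comp => //; exact: measurable_tuple_cons.
    + by move=> x; exact: h10.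
  - by move=> t _; exact: integral_ge0.
  - exact: lebesgue_n_origin.
  apply: eq_integral => t /set_mem[_ /= /eqP nt].
  have nt0 : 0 < tuple_norm t by rewrite lt_neqAle eq_sym nt tuple_norm_ge0.
  transitivity (\int[leb]_(x in `]0%R, (tuple_norm t)[) (F t * (tuple_norm t)^-1)%:E)%E.
    rewrite integral_cst// [X in (_ * X)%E]lebesgue_measure_itv/= lte_fin nt0 sube0 -EFinM.
    by congr EFin; rewrite mulfVK.
  rewrite [LHS]integral_mkcond; apply: eq_integral => x _.
  rewrite patchE mem_setE in_itv/= /h1 projE tnth0.
  by case: (_ && _); rewrite /= ?mulr1 ?mulr0.
transitivity (\int[lebesgue_n n.+1]_s (h2 s)%:E)%E.
  rewrite (ge0_integral_lebesgue_nS mf1 h10) (ge0_integral_lebesgue_nS mf2 h20).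
  apply: eq_integral => x _.
  have [x0|x0] := ltP 0 x; last first.
    rewrite !integral0_eq// => t _; rewrite /h1 /h2 tnth0 (ltNge 0) x0/=.
      by rewrite mul0r.
    by rewrite !mulr0.
  have mx : measurable_fun setT (fun t : n.-tuple mR => (h1 ([tuple of x :: t]) )%:E).
    apply: (measurableT_comp mf1); exact: measurable_cons.
  rewrite (ge0_integral_lebesgue_n_affine [tuple of nseq n 0] x0)//.
  rewrite -ge0_integralZl//; last 2 first.
  - apply: (measurableT_comp mx); exact: measurable_affine_tuple.
  - by rewrite lee_fin exprn_ge0// ltW.
  apply: eq_integral => t _; rewrite -EFinM; congr EFin.
  rewrite -/(dilate x t) /h1 /h2 !projE !tnth0 jdilE x0 tuple_norm_dilate ?(ltW x0)// mul1r/=.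
  rewrite ltr_pMr// /ray_weight -(prednK n0) exprSr invfM.
  have x0' : x != 0 by rewrite gt_eqF.
  rewrite -[RHS]mulr1 -(mulfV x0').
  by rewrite -pred_Sn; ring.
rewrite (ge0_integral_lebesgue_nS2 mf2 h20); apply: eq_integral => z _.
rewrite /ray_integral -ge0_integralZl//; last 3 first.
- by apply: measurable_funTS; exact: measurable_dilate_fun.
- move=> x; rewrite /= in_itv/= andbT => x0.
  by rewrite lee_fin mulr_ge0// exprn_ge0// ltW.
- by rewrite lee_fin ray_weight_ge0.
rewrite [RHS]integral_mkcond; apply: eq_integral => x _.
rewrite patchE mem_setE in_itv/= andbT /h2 projE tnth0 jdilE.
by case: (0 < x); rewrite ?mul0r// mul1r mulrC EFinM.
Qed.

Lemma ray_integralE (F : n.-tuple mR -> R) z :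
  (ray_integral F z = \int[leb]_s ((0 < s)%R%:R * (s ^+ n.-1 * F (dilate s z)))%:E)%E.
Proof.
rewrite /ray_integral integral_mkcond; apply: eq_integral => x _.
by rewrite patchE mem_setE in_itv/= andbT; case: (0 < x); rewrite ?mul1r ?mul0r.
Qed.

Let ray0 (F : n.-tuple mR -> R) (x : mR) z : (forall t, 0 <= F t) ->
  (0 <= ((0 < x)%R%:R * (x ^+ n.-1 * F (dilate x z)))%:E)%E.
Proof.
move=> F0; rewrite lee_fin; have [x0|x0] := ltP 0 x; last by rewrite mul0r.
by rewrite mul1r mulr_ge0// exprn_ge0// ltW.
Qed.

Lemma ray_integral_ge0 (F : n.-tuple mR -> R) z : (forall t, 0 <= F t) -> (0 <= ray_integral F z)%E.
Proof. by move=> F0; rewrite ray_integralE; apply: integral_ge0 => x _; exact: ray0. Qed.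

Lemma measurable_ray_integral (F : n.-tuple mR -> R) : measurable_fun setT F ->
  (forall t, 0 <= F t) -> measurable_fun setT (ray_integral F).
Proof.
move=> mF F0.
rewrite (_ : ray_integral F = fun z =>
    (\int[leb]_s ((0 < s)%R%:R * (s ^+ n.-1 * F (dilate s z)))%:E)%E); last first.
  by apply/funext => z; rewrite ray_integralE.
pose h (s : n.+1.-tuple mR) := ((0 < tnth s ord0)%R%:R *
  ((tnth s ord0) ^+ n.-1 * F (jdil s)))%:E.
have mh : measurable_fun setT h.
  have mt := @measurable_tnth _ mR n.+1 ord0.
  apply/measurable_EFinP; apply: measurable_funM.
    by apply: measurable_truth; apply: measurable_fun_ltr.
  by apply: measurable_funM; [exact: measurable_funX|exact: measurableT_comp].
rewrite (_ : (fun z => _) = fun z => (\int[leb]_s (h \o @tuple_cons R n) (s, z))%E).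
  apply: (@measurable_fun_fubini_tonelli_G _ _ _ _ _ _ (h \o @tuple_cons R n)).
  - by apply: measurableT_comp => //; exact: measurable_tuple_cons.
  - by move=> x; rewrite /= /h; exact: ray0.
by apply/funext => z; apply: eq_integral => x _; rewrite /= /h jdilE tnth0.
Qed.

(** Homogeneity of degree -n in z, by which rays only have to be compared for unit vectors. *)
Lemma ray_integral_dilate (F : n.-tuple mR -> R) (b : R) z : (0 < n)%N ->
  measurable_fun setT F -> (forall t, 0 <= F t) -> 0 < b ->
  (ray_integral F z = (b ^+ n)%:E * ray_integral F (dilate b z))%E.
Proof.
move=> n0 mF F0 b0.
have mray w : measurable_fun setT (fun x : mR =>
    ((0 < x)%R%:R * (x ^+ n.-1 * F (dilate x w)))%:E).
  apply/measurable_EFinP; apply: measurable_funM.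
    by apply: measurable_truth; apply: measurable_fun_ltr.
  by apply/measurable_EFinP; exact: measurable_dilate_fun.
rewrite !ray_integralE (ge0_integral_leb_affine 0 b0)//; last by move=> x; exact: ray0.
rewrite -ge0_integralZl//; last 3 first.
- apply: (measurableT_comp (mray z)).
  by apply: measurable_funD => //; exact: measurable_funM.
- by move=> x _; exact: ray0.
- by rewrite lee_fin ltW.
rewrite -ge0_integralZl//; last 2 first.
- by move=> x _; exact: ray0.
- by rewrite lee_fin exprn_ge0// ltW.
apply: eq_integral => x _; rewrite -!EFinM; congr EFin.
rewrite add0r pmulr_rgt0// dilate_dilate (mulrC b x) -(prednK n0) exprS exprMn -pred_Sn.
by ring.
Qed.

Lemma le_integral_rays (F1 F2 : n.-tuple mR -> R) : (0 < n)%N ->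
  measurable_fun setT F1 -> measurable_fun setT F2 ->
  (forall t, 0 <= F1 t) -> (forall t, 0 <= F2 t) ->
  (forall e, (sqnorm e = 1)%R -> ray_integral F1 e <= ray_integral F2 e)%E ->
  (\int[lebesgue_n n]_t (F1 t)%:E <= \int[lebesgue_n n]_t (F2 t)%:E)%E.
Proof.
move=> n0 m1 m2 p1 p2 F12; rewrite !integral_rays//.
have mr : measurable_fun setT (fun z => (ray_weight z)%:E).
  by apply/measurable_EFinP; exact: measurable_ray_weight.
apply: ge0_le_integral => //.
- by move=> z _; rewrite mule_ge0 ?lee_fin ?ray_weight_ge0 ?ray_integral_ge0.
- by apply: emeasurable_funM => //; exact: measurable_ray_integral.
- by apply: emeasurable_funM => //; exact: measurable_ray_integral.
move=> z _; have [z1|z1] := ltP 1 (tuple_norm z); last first.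
  by rewrite /ray_weight ltNge z1/= mulr0 !mul0e.
have z0 : 0 < tuple_norm z by apply: lt_trans z1.
have z0' : 0 < (tuple_norm z)^-1 by rewrite invr_gt0.
apply: lee_wpmul2l; first by rewrite lee_fin ray_weight_ge0.
rewrite (ray_integral_dilate z n0 m1 p1 z0') (ray_integral_dilate z n0 m2 p2 z0').
apply: lee_wpmul2l; first by rewrite lee_fin exprn_ge0// ltW.
apply: F12; rewrite /dilate sqnorm_affine_tuple0 -[sqnorm z]sqr_sqrtr ?sqnorm_ge0// -/(tuple_norm z).
by rewrite -exprMn mulVf ?expr1n// gt_eqF.
Qed.
End ray_comparison.

(** * The torsion function along rays *)

Section exit_distance.
Context {R : realType} {n : nat}.
Variables (Omega : set 'rV[R]_n) (u : 'rV[R]_n -> R).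
Hypothesis hOmega : bounded_convex_domain Omega.
Hypothesis hu : torsion_function Omega u.

(** [rho] is the supremum of the parameters s >= 0 inside Omega: convexity makes them an interval
    starting at 0, and openness excludes the endpoint. *)
Lemma ray_exit (x0 w : 'rV[R]_n) : Omega x0 -> w != 0 ->
  exists rho : R, [/\ 0 < rho, closure Omega (x0 + rho *: w), ~ Omega (x0 + rho *: w) &
    forall s, 0 <= s -> Omega (x0 + s *: w) <-> s < rho].
Proof.
move=> Ox0 w0; have [Ne bO oO cO] := hOmega.
have cl : continuous (fun s : R => x0 + s *: w).
  by move=> s; apply: cvgD; [exact: cvg_cst|exact: (cvgZ cvg_id (cvg_cst w))].
pose A := [set s : R | 0 <= s /\ Omega (x0 + s *: w)].
have A0 : A 0 by split=> //; rewrite scale0r addr0.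
have ubA : has_ubound A.
  have [K [Kr HK]] := bO; exists ((K + 1 + `|x0|) / `|w|) => s [s0 Os].
  rewrite ler_pdivlMr ?normr_gt0//.
  have : `|x0 + s *: w| <= K + 1 by apply: (HK (K + 1)); rewrite ?ltrDl.
  have := ler_normB (x0 + s *: w) x0.
  by rewrite addrAC subrr add0r normrZ ger0_norm//; lra.
have hsA : has_sup A by split => //; exists 0.
have oA : open [set s : R | Omega (x0 + s *: w)].
  by apply: open_comp => // s _; exact: cl.
have down s t : 0 <= s -> s <= t -> Omega (x0 + t *: w) -> Omega (x0 + s *: w).
  move=> s0 st Ot; have [t0|t0] := leP t 0.
    by have -> : s = t by apply/eqP; rewrite eq_le st (le_trans t0 s0).
  have := convex_comb cO (s := s / t) Ot Ox0; rewrite ler_pdivrMr// mul1r st divr_ge0 ?(ltW t0)//.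
  move=> /(_ isT); congr Omega.
  by rewrite scalerDr scalerA divfK ?gt_eqF// addrAC -scalerDl (addrC (s / t)) subrK scale1r.
pose rho := sup A.
have nO : ~ Omega (x0 + rho *: w).
  move=> Or; have := open_nbhs_nbhs (conj oA Or) => /nbhs_ballP[e /= e0 He].
  have r0 : 0 <= rho by apply: sup_ubound.
  have : A (rho + e / 2).
    split; first by rewrite addr_ge0// divr_ge0// ltW.
    by apply: He; rewrite /ball/= opprD addrA subrr sub0r normrN gtr0_norm; lra.
  by move=> /(sup_ubound ubA); rewrite -/rho; lra.
have r0 : 0 < rho.
  rewrite lt_neqAle sup_ubound// andbT; apply/eqP => r0; apply: nO.
  by rewrite -r0 scale0r addr0.
exists rho; split=> //.
- have cA : closed [set s : R | closure Omega (x0 + s *: w)].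
    by apply: closed_comp => [s _|]; [exact: cl|exact: closed_closure].
  apply: (closure_sub_closed cA (A := A)); last by apply: closure_sup => //; exists 0.
  by move=> s [_ Os]; exact: subset_closure.
- move=> s s0; split=> [Os|sr].
    rewrite ltNge; apply/negP => rs; apply: nO; apply: down Os => //; exact: ltW.
  have rs0 : 0 < rho - s by rewrite subr_gt0.
  have [t [t0 Ot] st] := sup_adherent rs0 hsA.
  by apply: down Ot => //; move: st; rewrite -/rho; lra.
Qed.

Variables (x0 e : 'rV[R]_n).
Hypothesis Ox0 : Omega x0.
Hypothesis max0 : forall y, closure Omega y -> u y <= u x0.
Hypothesis u0 : 0 < u x0.
Hypothesis e1 : dotv e e = 1.
Notation L := (Num.sqrt (2 * u x0)).

(** Lengths are in units of L. Along the ray the height above the supporting hyperplane at the exit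
    point is (rho' - s) k, where k <= 1 is the cosine of the angle between -e and nu. A height below
    L at x0 would give u x0 < L^2 / 2 = u x0; hence rho' k >= L and rho >= 1. As L h - h^2 / 2
    increases for h <= L, the height may be replaced by the larger L (rho - s). *)
Lemma ray_barrier : exists2 rho : R, 1 <= rho &
  forall s, 0 <= s ->
    (Omega (x0 + (L * s) *: e) <-> s < rho) /\
    (rho - 1 <= s < rho ->
       u (x0 + (L * s) *: e) <= L ^+ 2 * (1 / 2 - (1 - rho + s) ^+ 2 / 2)).
Proof.
have [Ne bO oO cO] := hOmega.
have L0 : 0 < L by rewrite sqrtr_gt0 mulr_gt0.
have L2 : L ^+ 2 = 2 * u x0 by rewrite sqr_sqrtr// mulr_ge0// ltW.
have e0 : e != 0.
  by apply/eqP => e0; move: e1; rewrite e0 /dotv big1 ?(eqP (oner_eq0 _))// => [|i _];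
    rewrite ?mxE ?mul0r// => /esym/eqP; rewrite oner_eq0.
have [rho' [r0 cz nz Hr]] := ray_exit Ox0 e0.
set z := x0 + rho' *: e in cz nz.
(* With w = 0 this is just the existence of a supporting half-space at z. *)
have [nu hnu _] : exists2 nu, inward_unit_support Omega z nu & dotv 0 nu <= 0.
  by apply: support_direction => // t _; rewrite scaler0 addr0.
pose k := - dotv e nu.
have hE s : dotv (x0 + s *: e - z) nu = (rho' - s) * k.
  rewrite /z opprD addrACA subrr add0r -scaleNr -scalerDl dotvZl /k; ring.
have k1 : k <= 1.
  rewrite /k -dotvNl; apply: (le_trans (dotv_unit_le _ hnu.1)).
  by rewrite /enorm dotvNl dotvC dotvNl e1 opprK sqrtr1.
have k0 : L <= rho' * k.
  have := hE 0; rewrite scale0r addr0 subr0 => h0; rewrite -h0 leNgt; apply/negP => hl.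
  have := torsion_barrier hOmega hu hnu max0 (ltW u0) (subset_closure Ox0) (ltW hl).
  by move: hl L2; set h := dotv _ _ => hl L2; nra.
have kp : 0 < k by rewrite -(pmulr_rgt0 _ r0); exact: lt_le_trans k0.
exists (rho' / L).
  by rewrite ler_pdivlMr// mul1r (le_trans k0)// ler_piMr// ltW.
move=> s s0; split.
  by rewrite ltr_pdivlMr// mulrC; apply: Hr; rewrite mulr_ge0// ltW.
set rho := rho' / L; have rE : rho' = L * rho by rewrite /rho mulrC divfK// gt_eqF.
move=> /andP[rs sr].
have Oy : Omega (x0 + (L * s) *: e).
  by apply/Hr; [rewrite mulr_ge0// ltW|rewrite rE ltr_pM2l].
have hy := hE (L * s).
have hd : 0 <= L * (rho - s) <= L by rewrite mulr_ge0 ?(ltW L0)//=; [rewrite ler_piMr; lra|lra].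
have hle : (rho' - L * s) * k <= L * (rho - s).
  by rewrite rE -mulrBr ler_piMr//; case/andP: hd.
have := torsion_barrier hOmega hu hnu max0 (ltW u0) (subset_closure Oy).
rewrite hy => /(_ _)/le_trans; apply; first by lra.
move: hle; set h := _ * k => hle; nra.
Qed.
End exit_distance.

(** * Integral bounds along a single ray in dimensions 2 and 3 *)

Section ray_estimates.
Context {R : realType}.
Notation mR := (measurableTypeR R).
Notation leb := (@lebesgue_measure R).

(** No constant term: the integrands are s or s^2, the Jacobian for n = 2 or 3, times a polynomial
    of degree at most 2. *)
Definition quartic (a b c d s : R) : R := a * s + b * s ^+ 2 + c * s ^+ 3 + d * s ^+ 4.
Definition quartic_prim (a b c d s : R) : R :=
  a / 2 * s ^+ 2 + b / 3 * s ^+ 3 + c / 4 * s ^+ 4 + d / 5 * s ^+ 5.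

Lemma is_derive_quartic a b c d s :
  is_derive s (1 : R) (quartic_prim a b c d) (quartic a b c d s).
Proof.
have m k (x : R) := is_deriveM_fun (is_derive_cst x s (1 : R)) (is_deriveX_fun k (is_derive_id s (1 : R))).
have h := is_deriveD_fun (is_deriveD_fun (is_deriveD_fun (m 2 (a / 2)) (m 3 (b / 3)))
  (m 4 (c / 4))) (m 5 (d / 5)).
by apply: (is_derive_eq h); rewrite /cst/= /quartic; field.
Qed.

Lemma continuous_quartic a b c d : continuous (quartic a b c d).
Proof.
move=> s; have m k (x : R) : (x * y ^+ k) @[y --> s] --> x * s ^+ k.
  by apply: cvgM; [exact: cvg_cst|exact: exprn_continuous].
by apply: cvgD (m 4 d); apply: cvgD (m 3 c); apply: cvgD (m 2 b);
  apply: cvgM; [exact: cvg_cst|exact: cvg_id].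
Qed.

Lemma integral_quartic a b c d x y : x <= y ->
  (\int[leb]_(s in `[x, y]) (quartic a b c d s)%:E =
   (quartic_prim a b c d y - quartic_prim a b c d x)%:E)%E.
Proof.
move=> xy; have dF := is_derive_quartic a b c d.
apply: (continuous_FTC xy) => //; first exact: continuous_quartic.
exact: (is_derive_continuous dF).
Qed.

Definition piece (x y : R) (P : R -> R) (s : R) : R := (x <= s <= y)%R%:R * P s.

Lemma integral_piece a b c d (x y : R) : 0 <= x -> x <= y ->
  (\int[leb]_(s in `]0%R, +oo[) (piece x y (quartic a b c d) s)%:E =
   (quartic_prim a b c d y - quartic_prim a b c d x)%:E)%E.
Proof.
move=> x0 xy; rewrite -integral_quartic// [LHS]integral_mkcond [RHS]integral_mkcond.
apply: eq_integral => s _; rewrite !patchE !mem_setE !in_itv/= andbT /piece.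
have [s0|s0] := ltP 0 s; first by case: ifP => _; rewrite ?mul1r ?mul0r.
(* The closed interval may contain s = 0, which the half-line omits, but the quartic vanishes
   there. *)
case: ifPn => // /andP[xs sy]; have -> : s = 0 by apply/eqP; rewrite eq_le s0 (le_trans x0).
by rewrite /quartic !expr0n/= !mulr0 !addr0.
Qed.

Lemma measurable_piece x y a b c d : measurable_fun setT (piece x y (quartic a b c d)).
Proof.
apply: measurable_funM; last first.
  apply: continuous_measurable_fun; exact: continuous_quartic.
by apply: measurable_truth; apply: measurable_and; apply: measurable_fun_ler.
Qed.

(** The pieces stand for the plateau where g <= K / 2, the barrier layer before the exit, and the
    auxiliary mass on the unit ball. They are added, hence may overlap. *)
Lemma integral_le_pieces (h : R -> R) (a1 b1 c1 d1 x1 y1 a2 b2 c2 d2 x2 y2 a3 b3 c3 d3 x3 y3 : R) :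
  measurable_fun setT h -> (forall s, 0 < s -> 0 <= h s) ->
  0 <= x1 -> x1 <= y1 -> 0 <= x2 -> x2 <= y2 -> 0 <= x3 -> x3 <= y3 ->
  (forall s, x1 <= s <= y1 -> 0 <= quartic a1 b1 c1 d1 s) ->
  (forall s, x2 <= s <= y2 -> 0 <= quartic a2 b2 c2 d2 s) ->
  (forall s, x3 <= s <= y3 -> 0 <= quartic a3 b3 c3 d3 s) ->
  (forall s, 0 < s -> h s <= piece x1 y1 (quartic a1 b1 c1 d1) s +
    piece x2 y2 (quartic a2 b2 c2 d2) s + piece x3 y3 (quartic a3 b3 c3 d3) s) ->
  (\int[leb]_(s in `]0%R, +oo[) (h s)%:E <=
   ((quartic_prim a1 b1 c1 d1 y1 - quartic_prim a1 b1 c1 d1 x1) +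
    (quartic_prim a2 b2 c2 d2 y2 - quartic_prim a2 b2 c2 d2 x2) +
    (quartic_prim a3 b3 c3 d3 y3 - quartic_prim a3 b3 c3 d3 x3))%:E)%E.
Proof.
move=> mh h0 x1p xy1 x2p xy2 x3p xy3 p1 p2 p3 hle.
have pp x y a b c d : (forall s, x <= s <= y -> 0 <= quartic a b c d s) ->
    forall s, 0 <= piece x y (quartic a b c d) s.
  by move=> H s; rewrite /piece; case: (boolP (_ <= _ <= _)) => [/H|_]; rewrite ?mul1r ?mul0r.
have mp x y a b c d : measurable_fun (`]0%R, +oo[%classic : set mR)
    (fun s => (piece x y (quartic a b c d) s)%:E).
  by apply: measurable_funTS; apply/measurable_EFinP; exact: measurable_piece.
rewrite EFinD [in leRHS]EFinD -!integral_piece//.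
rewrite -ge0_integralD//; last 2 first.
- by move=> s _; rewrite lee_fin pp.
- by move=> s _; rewrite lee_fin pp.
rewrite -ge0_integralD//; last 3 first.
- by move=> s _; rewrite -EFinD lee_fin addr_ge0 ?pp.
- exact: emeasurable_funD.
- by move=> s _; rewrite lee_fin pp.
apply: ge0_le_integral => //.
- by move=> s; rewrite /= in_itv/= andbT => s0; rewrite lee_fin h0.
- by apply: measurable_funTS; exact/measurable_EFinP.
- by apply: emeasurable_funD => //; exact: emeasurable_funD.
- by move=> s; rewrite /= in_itv/= andbT => s0; rewrite -!EFinD lee_fin hle.
Qed.

Lemma integral_ray_power n (rho k : R) : 0 <= rho ->
  (\int[leb]_(s in `]0%R, +oo[) (s ^+ n * (k * (s < rho)%R%:R))%:E =
   (k * (rho ^+ n.+1 / n.+1%:R))%:E)%E.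
Proof.
move=> r0; pose F (s : R) := k * (s ^+ n.+1 / n.+1%:R).
have cp : continuous (fun s : R => k * s ^+ n).
  by move=> s; apply: cvgM; [exact: cvg_cst|exact: exprn_continuous].
have dF (s : R) : is_derive s (1 : R) F (k * s ^+ n).
  have d := is_deriveM_fun (is_derive_cst k s (1 : R))
    (is_deriveM_fun (is_deriveX_fun n.+1 (is_derive_id s (1 : R)))
      (is_derive_cst (n.+1%:R^-1 : R) s (1 : R))).
  by apply: (is_derive_eq d); rewrite /cst/=; field; rewrite addrC natr1 pnatr_eq0.
transitivity (\int[leb]_(s in `]0%R, rho[) (k * s ^+ n)%:E)%E.
  rewrite [LHS]integral_mkcond [RHS]integral_mkcond; apply: eq_integral => s _.
  rewrite !patchE !mem_setE !in_itv/= andbT.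
  by case: (0 < s) => //=; case: (s < rho); rewrite ?mulr1 ?mulr0// mulrC.
have mp : measurable_fun (`]0%R, rho[%classic : set mR) (fun s : mR => (k * s ^+ n)%:E).
  by apply: measurable_funTS; apply/measurable_EFinP; exact: continuous_measurable_fun.
rewrite -(@integral_itv_bndoo _ _ _ _ true false)//.
rewrite (@continuous_FTC _ F (fun s => k * s ^+ n) 0 rho r0)//.
- by congr EFin; rewrite /F expr0n/= mul0r mulr0 subr0.
- exact: (is_derive_continuous dF).
Qed.
End ray_estimates.

Section planar_and_spatial_rays.
Context {R : realType}.
Notation mR := (measurableTypeR R).
Notation leb := (@lebesgue_measure R).
Variables (g : R -> R) (K rho : R).
Hypothesis mg : measurable_fun setT (g : mR -> R).
Hypothesis K0 : 0 <= K.
Hypothesis rho1 : 1 <= rho.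
Hypothesis g0 : forall s : R, 0 < s -> 0 <= g s.
Hypothesis gout : forall s : R, 0 < s -> rho <= s -> g s = 0.
Hypothesis gcap : forall s : R, 0 < s -> g s <= K / 2.
Hypothesis gbar : forall s : R, 0 < s -> rho - 1 <= s < rho ->
  g s <= K * (1 / 2 - (1 - rho + s) ^+ 2 / 2).

Let h n (c r : R) (s : R) : R :=
  s ^+ n * (g s * (s ^+ 2 < r)%R%:R + c * K * (s ^+ 2 < 1)%R%:R).

Let mh n c r : measurable_fun setT (h n c r : mR -> R).
Proof.
have mt (k : R) : measurable_fun setT (fun s : mR => (s ^+ 2 < k)%R%:R : R).
  by apply: measurable_truth; apply: measurable_fun_ltr => //; exact: measurable_funX.
apply: measurable_funM; first exact: measurable_funX.
by apply: measurable_funD; apply: measurable_funM.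
Qed.

Let h0 n (c r s : R) : 0 <= c -> 0 < s -> 0 <= h n c r s.
Proof.
move=> c0 s0; rewrite mulr_ge0 ?exprn_ge0 ?(ltW s0)// addr_ge0// !mulr_ge0//.
exact: g0.
Qed.

Let sq1 (s : R) : 0 < s -> s ^+ 2 < 1 -> s <= 1.
Proof. by move=> s0 h1; nra. Qed.

Let piece_ge0 (x y : R) P (s : R) : (forall s : R, x <= s <= y -> 0 <= P s) -> 0 <= piece x y P s.
Proof.
by move=> H; rewrite /piece; case: (boolP (_ <= _ <= _)) => [/H|_]; rewrite ?mul1r ?mul0r.
Qed.

Let pieceE (x y : R) P (s : R) : x <= s <= y -> piece x y P s = P s.
Proof. by rewrite /piece => ->; rewrite mul1r. Qed.

Let h_pieces n (c r s p1 p2 p3 : R) : 0 <= c -> 0 < s ->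
  (s ^+ 2 < r -> s ^+ n * g s <= p1 + p2) -> 0 <= p1 + p2 -> 0 <= p3 ->
  (s <= 1 -> s ^+ n * (c * K) <= p3) -> h n c r s <= p1 + p2 + p3.
Proof.
move=> c0 s0 H1 p0 p30 H2; rewrite /h mulrDr lerD//.
  by case: (boolP (_ < r)) => [/H1|_]; rewrite ?mulr1 ?mulr0.
by case: (boolP (_ < 1)) => [/(sq1 s0)/H2|_]; rewrite ?mulr1 ?mulr0.
Qed.

(* For [rho <= 2] the restriction [s^2 < 2] is dropped; the loss is made up for by
   the mass [2 / 15] on the unit ball, which the ray meets entirely as [1 <= rho]. *)
Lemma planar_ray :
  (\int[leb]_(s in `]0%R, +oo[) (s ^+ 1 * (g s * (s ^+ 2 < 2)%R%:R +
     2 / 15 * K * (s ^+ 2 < 1)%R%:R))%:E <= (2 / 5 * K * (rho ^+ 2 / 2))%:E)%E.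
Proof.
have q3 (s : R) : 0 <= s <= 1 -> 0 <= quartic (2 / 15 * K) 0 0 0 s.
  by move=> /andP[s0 _]; rewrite /quartic !mul0r !addr0 mulr_ge0// mulr_ge0.
have q1 (y s : R) : 0 <= s <= y -> 0 <= quartic (K / 2) 0 0 0 s.
  by move=> /andP[s0 _]; rewrite /quartic !mul0r !addr0 mulr_ge0// mulr_ge0.
have [r2|r2] := leP rho 2.
  pose b1 := K / 2 * (1 - (1 - rho) ^+ 2); pose b2 := - (K * (1 - rho)).
  have E2 (s : R) : quartic b1 b2 (- (K / 2)) 0 s = s * (K * (1 / 2 - (1 - rho + s) ^+ 2 / 2)).
    by rewrite /quartic /b1 /b2; field.
  have q2 (s : R) : rho - 1 <= s <= rho -> 0 <= quartic b1 b2 (- (K / 2)) 0 s.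
    move=> /andP[s1 s2]; have s0 : 0 <= s by apply: le_trans s1; rewrite subr_ge0.
    have s0' : 0 <= 1 - rho + s by lra.
    have s1' : 1 - rho + s <= 1 by lra.
    rewrite E2; apply: mulr_ge0 => //; apply: mulr_ge0 => //; nra.
  apply: (@le_trans _ (\bar R)); first apply: (@integral_le_pieces _ (h 1 (2 / 15) 2)
    (K / 2) 0 0 0 0 (rho - 1) b1 b2 (- (K / 2)) 0 (rho - 1) rho (2 / 15 * K) 0 0 0 0 1) => //.
  - exact: mh.
  - by move=> s s0; exact: h0.
  - by rewrite subr_ge0.
  - by rewrite subr_ge0.
  - by rewrite gerBl.
  - exact: q1.
  - move=> s s0; apply: h_pieces => //.
    + move=> _; have [sr|sr] := leP rho s.
        rewrite (gout s0 sr) mulr0 addr_ge0//; apply: piece_ge0; [exact: q1|exact: q2].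
      have [s1|s1] := leP (rho - 1) s.
        rewrite -[leLHS]add0r lerD//; first by apply: piece_ge0; exact: q1.
        rewrite pieceE ?s1 ?(ltW sr)// E2 expr1 ler_wpM2l// ?(ltW s0)//.
        by apply: gbar => //; rewrite s1 sr.
      rewrite -[leLHS]addr0 lerD//; last by apply: piece_ge0; exact: q2.
      rewrite pieceE ?(ltW s0) ?(ltW s1)// /quartic !mul0r !addr0 expr1 mulrC ler_wpM2r// ?(ltW s0)//.
      exact: gcap.
    + by rewrite addr_ge0//; apply: piece_ge0; [exact: q1|exact: q2].
    + exact: piece_ge0.
    + by move=> s1; rewrite pieceE ?s1 ?(ltW s0)// /quartic !mul0r !addr0 expr1 mulrC.
  rewrite lee_fin /quartic_prim /b1 /b2.
  rewrite -subr_ge0; set D := (X in 0 <= X).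
  (* For rho - 1 in [0, 1] this slack is least at rho = 1, where it is K / 120: the constants 2/15
     and 2/5 leave little room. *)
  have -> : D = K * ((1 + 8 * (rho - 1) - 6 * (rho - 1) ^+ 2) / 120).
    by rewrite /D; field.
  have a0 : 0 <= rho - 1 by rewrite subr_ge0.
  have a1 : rho - 1 <= 1 by rewrite lerBlDr.
  by apply: mulr_ge0 => //; apply: divr_ge0 => //; nra.
(* For rho > 2 the cut at sqrt 2 is kept, and the cap K / 2 is enough without the barrier; the
   second piece is degenerate. *)
have s2 : Num.sqrt 2 ^+ 2 = 2 :> R by rewrite sqr_sqrtr.
have s20 : 0 <= Num.sqrt 2 :> R by exact: sqrtr_ge0.
apply: (@le_trans _ (\bar R)); first apply: (@integral_le_pieces _ (h 1 (2 / 15) 2)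
    (K / 2) 0 0 0 0 (Num.sqrt 2) (K / 2) 0 0 0 0 0 (2 / 15 * K) 0 0 0 0 1) => //.
- exact: mh.
- by move=> s s0; exact: h0.
- exact: q1.
- exact: q1.
- move=> s s0; apply: h_pieces => //.
  + move=> ss; have sq : s <= Num.sqrt 2.
      by rewrite -(@ler_pXn2r _ 2)// ?nnegrE ?(ltW s0)// s2 ltW.
    rewrite -[leLHS]addr0 lerD//; last by apply: piece_ge0; exact: q1.
    rewrite pieceE ?(ltW s0) ?sq// /quartic !mul0r !addr0 expr1 mulrC ler_wpM2r// ?(ltW s0)//.
    exact: gcap.
  + by rewrite addr_ge0//; apply: piece_ge0; exact: q1.
  + exact: piece_ge0.
  + by move=> s1; rewrite pieceE ?s1 ?(ltW s0)// /quartic !mul0r !addr0 expr1 mulrC.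
rewrite lee_fin /quartic_prim.
have s3 : Num.sqrt 2 ^+ 3 = 2 * Num.sqrt 2 :> R by rewrite exprS s2 mulrC.
rewrite -subr_ge0; set D := (X in 0 <= X).
have -> : D = K * (rho ^+ 2 / 5 - Num.sqrt 2 ^+ 2 / 4 - 1 / 15).
  by rewrite /D; field.
by apply: mulr_ge0 => //; rewrite s2; nra.
Qed.
(** As in the plane, with Jacobian s^2: the barrier without the cut at sqrt 3 for rho <= 2, the cap
    with the cut for rho > 2. The margin allows an auxiliary mass 0, kept in the formula to match
    [ray_comparison_bound]. *)
Lemma spatial_ray :
  (\int[leb]_(s in `]0%R, +oo[) (s ^+ 2 * (g s * (s ^+ 2 < 3)%R%:R +
     0 * K * (s ^+ 2 < 1)%R%:R))%:E <= (3 / 8 * K * (rho ^+ 3 / 3))%:E)%E.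
Proof.
have q3 (s : R) : 0 <= s <= 1 -> 0 <= quartic 0 0 0 0 s.
  by move=> _; rewrite /quartic !mul0r !addr0.
have q1 (y s : R) : 0 <= s <= y -> 0 <= quartic 0 (K / 2) 0 0 s.
  by move=> /andP[s0 _]; rewrite /quartic !mul0r !addr0 ?add0r mulr_ge0 ?sqr_ge0// divr_ge0.
have [r2|r2] := leP rho 2.
  pose b1 := K / 2 * (1 - (1 - rho) ^+ 2); pose b2 := - (K * (1 - rho)).
  have E2 (s : R) : quartic 0 b1 b2 (- (K / 2)) s = s ^+ 2 * (K * (1 / 2 - (1 - rho + s) ^+ 2 / 2)).
    by rewrite /quartic /b1 /b2; field.
  have q2 (s : R) : rho - 1 <= s <= rho -> 0 <= quartic 0 b1 b2 (- (K / 2)) s.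
    move=> /andP[s1 s2]; have s0 : 0 <= s by apply: le_trans s1; rewrite subr_ge0.
    have s0' : 0 <= 1 - rho + s by lra.
    have s1' : 1 - rho + s <= 1 by lra.
    rewrite E2; apply: mulr_ge0; rewrite ?sqr_ge0//; apply: mulr_ge0 => //; nra.
  apply: (@le_trans _ (\bar R)); first apply: (@integral_le_pieces _ (h 2 0 3)
    0 (K / 2) 0 0 0 (rho - 1) 0 b1 b2 (- (K / 2)) (rho - 1) rho 0 0 0 0 0 1) => //.
  - exact: mh.
  - by move=> s s0; exact: h0.
  - by rewrite subr_ge0.
  - by rewrite subr_ge0.
  - by rewrite gerBl.
  - exact: q1.
  - move=> s s0; apply: h_pieces => //.
    + move=> _; have [sr|sr] := leP rho s.
        rewrite (gout s0 sr) mulr0 addr_ge0//; apply: piece_ge0; [exact: q1|exact: q2].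
      have [s1|s1] := leP (rho - 1) s.
        rewrite -[leLHS]add0r lerD//; first by apply: piece_ge0; exact: q1.
        rewrite pieceE ?s1 ?(ltW sr)// E2 ler_wpM2l ?sqr_ge0//.
        by apply: gbar => //; rewrite s1 sr.
      rewrite -[leLHS]addr0 lerD//; last by apply: piece_ge0; exact: q2.
      rewrite pieceE ?(ltW s0) ?(ltW s1)// /quartic !mul0r !addr0 add0r mulrC ler_wpM2r ?sqr_ge0//.
      exact: gcap.
    + by rewrite addr_ge0//; apply: piece_ge0; [exact: q1|exact: q2].
    + exact: piece_ge0.
    + by move=> s1; rewrite pieceE ?s1 ?(ltW s0)// /quartic !mul0r !addr0 mulr0.
  rewrite lee_fin /quartic_prim /b1 /b2.
  rewrite -subr_ge0; set D := (X in 0 <= X).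
  have -> : D = K * ((7 + 15 * (rho - 1) + 5 * (rho - 1) ^+ 2 - 5 * (rho - 1) ^+ 3) / 120).
    by rewrite /D; field.
  have a0 : 0 <= rho - 1 by rewrite subr_ge0.
  have a1 : rho - 1 <= 1 by rewrite lerBlDr.
  by apply: mulr_ge0 => //; apply: divr_ge0 => //; nra.
have s2 : Num.sqrt 3 ^+ 2 = 3 :> R by rewrite sqr_sqrtr.
have s20 : 0 <= Num.sqrt 3 :> R by exact: sqrtr_ge0.
apply: (@le_trans _ (\bar R)); first apply: (@integral_le_pieces _ (h 2 0 3)
    0 (K / 2) 0 0 0 (Num.sqrt 3) 0 (K / 2) 0 0 0 0 0 0 0 0 0 1) => //.
- exact: mh.
- by move=> s s0; exact: h0.
- exact: q1.
- exact: q1.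
- move=> s s0; apply: h_pieces => //.
  + move=> ss; have sq : s <= Num.sqrt 3.
      by rewrite -(@ler_pXn2r _ 2)// ?nnegrE ?(ltW s0)// s2 ltW.
    rewrite -[leLHS]addr0 lerD//; last by apply: piece_ge0; exact: q1.
    rewrite pieceE ?(ltW s0) ?sq// /quartic !mul0r !addr0 add0r mulrC ler_wpM2r ?sqr_ge0//.
    exact: gcap.
  + by rewrite addr_ge0//; apply: piece_ge0; exact: q1.
  + exact: piece_ge0.
  + by move=> s1; rewrite pieceE ?s1 ?(ltW s0)// /quartic !mul0r !addr0 mulr0.
rewrite lee_fin /quartic_prim.
have s3 : Num.sqrt 3 ^+ 3 = 3 * Num.sqrt 3 :> R by rewrite exprS s2 mulrC.
rewrite -subr_ge0; set D := (X in 0 <= X).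
have -> : D = K * (rho ^+ 3 / 8 - Num.sqrt 3 ^+ 3 / 6).
  by rewrite /D; field.
have r0 : 0 <= rho by exact: le_trans rho1.
have r3 : 2 ^+ 3 <= rho ^+ 3 by apply: lerXn2r; rewrite ?nnegrE// ltW.
have s32 : Num.sqrt 3 <= 2 :> R by nra.
by apply: mulr_ge0 => //; rewrite s3; lra.
Qed.
End planar_and_spatial_rays.

(** * Lower bound on the volume *)

Section rescaled_volume_ge.
Context {R : realType} {n : nat}.
Notation mR := (measurableTypeR R).
Variables (Omega : set 'rV[R]_n) (u : 'rV[R]_n -> R).
Hypothesis hOmega : bounded_convex_domain Omega.
Hypothesis hu : torsion_function Omega u.
Variable x0 : 'rV[R]_n.
Hypothesis Ox0 : Omega x0.
Hypothesis u0 : 0 < u x0.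
Notation K := (2 * u x0).
Notation L := (Num.sqrt K).

Let K0 : 0 < K. Proof. by rewrite mulr_gt0. Qed.
Let L0 : 0 < L. Proof. by rewrite sqrtr_gt0. Qed.
Let L2 : L ^+ 2 = K. Proof. by rewrite sqr_sqrtr// ltW. Qed.

Lemma row_of_affine_tuple (b : R) (t : n.-tuple mR) :
  row_of (affine_tuple [tuple x0 0 i | i < n] b t) = x0 + b *: row_of t.
Proof. by apply/rowP => i; rewrite !mxE !tnth_mktuple. Qed.

(** Omega seen from x0 in units of L; the ball of the mean value inequality becomes
    [tuple_ball n n%:R], of radius sqrt n. *)
Definition rescaled_domain := [set t : n.-tuple mR | Omega (x0 + L *: row_of t)].

Let continuous_aff (b : R) : continuous (fun y : 'rV[R]_n => x0 + b *: y).
Proof.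
apply: continuousD_fun; first exact: cst_continuous.
by apply: continuousZ_fun; [exact: cst_continuous|exact: continuous_id_fun].
Qed.

Lemma measurable_rescaled_domain : measurable rescaled_domain.
Proof.
apply: (@measurable_open_row_of _ _ [set y | Omega (x0 + L *: y)]).
by apply: open_comp => [y _|]; [exact: continuous_aff|exact: torsion_open].
Qed.

Lemma lebesgue_rescaled : (lebesgue_rV Omega = (L ^+ n)%:E * lebesgue_n n rescaled_domain)%E.
Proof.
have mO := measurable_open_row_of (torsion_open hOmega).
rewrite /lebesgue_rV -lebesgue_nE -/((@row_of R n) @^-1` Omega).
rewrite (lebesgue_n_integral_indic mO) (lebesgue_n_integral_indic measurable_rescaled_domain).
rewrite (ge0_integral_lebesgue_n_affine [tuple x0 0 i | i < n] L0)//; last first.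
  exact: measurable_tuple_indic.
congr (_ * _)%E; apply: eq_integral => t _; congr EFin; congr (nat_of_bool _)%:R.
by apply/idP/idP; rewrite !inE /= row_of_affine_tuple.
Qed.

Lemma rescaled_finite : (lebesgue_n n rescaled_domain < +oo)%E.
Proof.
have [_ [k [kr Hk]] _ _] := hOmega.
pose C := (k + 1 + `|x0|) / L.
pose b := 1 + n%:R * C ^+ 2.
have nC : 0 <= n%:R * C ^+ 2 by rewrite mulr_ge0// sqr_ge0.
have b0 : 0 < b by rewrite /b ltr_wpDr.
apply: (@le_lt_trans _ _ (lebesgue_n n (tuple_ball n (b ^+ 2)))).
  apply: le_measure; rewrite ?inE; [exact: measurable_rescaled_domain|exact: measurable_tuple_ball|].
  move=> t Ot; rewrite /tuple_ball/=.
  have bi i : tnth t i ^+ 2 <= C ^+ 2.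
    have h1 : `|x0 + L *: row_of t| <= k + 1 by apply: (Hk (k + 1)); rewrite ?ltrDl.
    have h2 := ler_normB (x0 + L *: row_of t) x0.
    rewrite addrAC subrr add0r normrZ (ger0_norm (ltW L0)) in h2.
    have h3 : `|tnth t i| <= `|row_of t|.
      by have := coord_le_mx_norm (row_of t) i; rewrite mxE.
    have h4 : `|tnth t i| <= C.
      rewrite ler_pdivlMr// mulrC (le_trans (ler_wpM2l (ltW L0) h3))//; lra.
    by rewrite -(real_normK (num_real _)) lerXn2r// nnegrE// (le_trans _ h4).
  have : sqnorm t <= n%:R * C ^+ 2.
    rewrite /sqnorm (le_trans (ler_sum _ (fun i _ => bi i)))// sumr_const card_ord.
    by rewrite mulr_natl.
  by rewrite /b; nra.
by rewrite lebesgue_n_tuple_ball_scale// lebesgue_n_tuple_ball -EFinM ltry.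
Qed.

(* [c] weighs an auxiliary mass on the unit ball, which only the planar case
   needs. *)
Lemma rescaled_volume_ge (c c' : R) : (0 < n)%N -> 0 <= c ->
  (forall f : 'rV[R]_n -> R, continuous f -> (forall x, 0 <= f x) ->
    (forall x, ~ Omega x -> f x = 0) ->
    (forall x B, 0 <= B -> (Omega x -> u x <= B) -> f x <= B) ->
    (\int[lebesgue_n n]_t (f (x0 + L *: row_of t) * \1_(tuple_ball n n%:R) t +
         c * K * \1_(tuple_ball n 1) t)%:E <=
     \int[lebesgue_n n]_t (c' * K * \1_rescaled_domain t)%:E)%E) -> 0 <= c' ->
  (Num.sqrt n%:R) ^+ n * omega n / n.+2%:R + c * omega n <=
    c' * fine (lebesgue_n n rescaled_domain).
Proof.
move=> n0 c0 Hf c'0.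
set W := fine _.
have EW : lebesgue_n n rescaled_domain = W%:E.
  by rewrite /W fineK// ge0_fin_numE// rescaled_finite.
have mO := measurable_rescaled_domain.
have mb c1 := @measurable_tuple_ball R n c1.
have om := omega_gt0 (R := R) n.
pose s : R := Num.sqrt n%:R.
have s0 : 0 < s by rewrite sqrtr_gt0 ltr0n.
have s2 : s ^+ 2 = n%:R by rewrite sqr_sqrtr.
(* Mean value inequality for the truncation at level a, which costs at most 3 a at x0; a tends to 0
   at the end. *)
have key a : 0 < a -> a <= u x0 ->
    s ^+ n * (omega n * K / n.+2%:R - 3 * a * omega n) + c * K * omega n <= c' * K * W.
  move=> a0 au.
  have [f [p [q [[cf cp cq df dp] [C HC] lap fb fx]]]] := torsion_truncation hOmega hu a0.
  have f0 x : 0 <= f x by have [] := fb x.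
  have C0 : 0 <= C.
    by have [h _] := HC (Ordinal n0) x0; exact: le_trans h.
  have r0 : 0 < L * s by rewrite mulr_gt0.
  have mv := mean_value_ball cf cp cq df dp C0 HC lap f0 x0 r0.
  have hf := Hf f cf f0 (fun x => let: And3 _ h _ := fb x in h)
    (fun x => let: And3 _ _ h := fb x in h).
  set IB := (\int[lebesgue_n n]_(t in tuple_ball n 1) _)%E in mv.
  have IB0 : (0 <= IB)%E by apply: integral_ge0 => t _; rewrite lee_fin.
  have mfr b : measurable_fun setT (fun t : n.-tuple mR => f (x0 + b *: row_of t)).
    apply: (@measurable_continuous_row_of _ _ (fun y => f (x0 + b *: y))) => y.
    exact: (continuous_comp (@continuous_aff b y) (@cf _)).
  have EJ : (\int[lebesgue_n n]_t (f (x0 + L *: row_of t) * \1_(tuple_ball n n%:R) t)%:E =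
      (s ^+ n)%:E * IB)%E.
    rewrite (ge0_integral_lebesgue_n_affine [tuple of nseq n 0] s0); last 2 first.
    - by apply/measurable_EFinP; apply: measurable_funM => //; exact: measurable_indic.
    - by move=> t; rewrite lee_fin mulr_ge0.
    congr (_ * _)%E; rewrite /IB [RHS]integral_mkcond; apply: eq_integral => t _.
    rewrite patchE indicE.
    have -> : (affine_tuple [tuple of nseq n 0] s t \in tuple_ball n n%:R) = (t \in tuple_ball n 1).
      apply/idP/idP; rewrite !inE /tuple_ball/= sqnorm_affine_tuple0 s2 gtr_pMr ?ltr0n//.
    case: (t \in _); rewrite ?mulr0// mulr1; congr (f _)%:E; congr (_ + _).
    by rewrite -scalerA; congr (_ *: _); apply/rowP => i;
      rewrite !mxE tnth_mktuple tnth_nseq add0r.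
  have ER : (\int[lebesgue_n n]_t (c' * K * \1_rescaled_domain t)%:E = (c' * K * W)%:E)%E.
    under eq_integral do rewrite EFinM.
    rewrite ge0_integralZl//; last 2 first.
    - by apply/measurable_EFinP; exact: measurable_indic.
    - by rewrite lee_fin mulr_ge0// ltW.
    by rewrite -(lebesgue_n_integral_indic mO) EW -EFinM.
  have EC : (\int[lebesgue_n n]_t (c * K * \1_(tuple_ball n 1) t)%:E = (c * K * omega n)%:E)%E.
    under eq_integral do rewrite EFinM.
    rewrite ge0_integralZl//; last 2 first.
    - by apply/measurable_EFinP; exact: measurable_indic.
    - by rewrite lee_fin mulr_ge0// ltW.
    by rewrite -(lebesgue_n_integral_indic (mb 1)) lebesgue_n_tuple_ball -EFinM.
  move: hf; under eq_integral do rewrite EFinD.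
  rewrite ge0_integralD//; last 4 first.
  - by move=> t _; rewrite lee_fin mulr_ge0.
  - by apply/measurable_EFinP; apply: measurable_funM => //; exact: measurable_indic.
  - by move=> t _; rewrite lee_fin !mulr_ge0// ltW.
  - by apply/measurable_EFinP; apply: measurable_funM => //; exact: measurable_indic.
  rewrite EJ ER EC.
  have fx0 := fx x0 Ox0 au.
  clear EJ; clearbody IB; case: IB IB0 mv => [i||]//.
    rewrite -EFinM -!EFinD !lee_fin => i0 mv; apply: le_trans.
    rewrite lerD2r ler_wpM2l// ?exprn_ge0 ?(ltW s0)//.
    have : (u x0 - 3 * a) * omega n <= f x0 * omega n by rewrite ler_wpM2r// ltW.
    rewrite exprMn L2 s2 in mv.
    have -> : omega n * K / n.+2%:R = u x0 * omega n - omega n / n.+2%:R * (K * n%:R / 2).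
      by rewrite -(addn2 n) natrD; field; rewrite -natrD pnatr_eq0 addn2.
    move: mv; set X := omega n / n.+2%:R * _ => mv fa.
    rewrite mulrBl in fa.
    by rewrite addrAC lerBlDr; exact: le_trans mv.
  (* An infinite integral over the ball contradicts the finite right side of [hf]. *)
  by move=> _ _; rewrite mulry gtr0_sg ?exprn_gt0// mul1e.
have sn0 : 0 < s ^+ n by rewrite exprn_gt0.
have so0 : 0 < 3 * (s ^+ n * omega n) by rewrite !mulr_gt0.
rewrite -(ler_pM2l K0); apply/ler_addgt0Pr => e e0.
(* Makes the error 3 a s^n [omega n] at most e, while a <= u x0 allows the truncation to be compared
   with u at x0. *)
pose a := Num.min (u x0) (e / (3 * (s ^+ n * omega n))).
have a0 : 0 < a by rewrite lt_min u0 divr_gt0.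
have a1 : a <= u x0 by rewrite ge_min lexx.
have a2 : a * (3 * (s ^+ n * omega n)) <= e.
  by rewrite -ler_pdivlMr// /a ge_min lexx orbT.
have := key a a0 a1; rewrite -/s; move: (n.+2%:R^-1) (s ^+ n) (omega n) a2 => v w o a2; lra.
Qed.
End rescaled_volume_ge.

Section torsion_volume.
Context {R : realType} {n : nat}.
Notation mR := (measurableTypeR R).
Notation leb := (@lebesgue_measure R).
Variables (Omega : set 'rV[R]_n) (u : 'rV[R]_n -> R).
Hypothesis hOmega : bounded_convex_domain Omega.
Hypothesis hu : torsion_function Omega u.
Variable x0 : 'rV[R]_n.
Hypothesis Ox0 : Omega x0.
Hypothesis max0 : forall y, closure Omega y -> u y <= u x0.
Hypothesis u0 : 0 < u x0.
Notation K := (2 * u x0).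
Notation L := (Num.sqrt K).
Notation Om := (@rescaled_domain R n Omega u x0).

Let K0 : 0 < K. Proof. by rewrite mulr_gt0. Qed.

(** Reduction to one variable: for a unit vector e, [ray_barrier] gives g(s) = f(x0 + L s e) the
    properties required in the hypothesis, and the ray integral of the indicator of the rescaled
    domain is rho^n / n. *)
Lemma ray_comparison_bound (c c' : R) : (0 < n)%N -> 0 <= c -> 0 <= c' ->
  (forall (g : R -> R) (rho : R), measurable_fun setT (g : mR -> R) -> 1 <= rho ->
    (forall s, 0 < s -> 0 <= g s) -> (forall s, 0 < s -> rho <= s -> g s = 0) ->
    (forall s, 0 < s -> g s <= K / 2) ->
    (forall s, 0 < s -> rho - 1 <= s < rho ->
      g s <= K * (1 / 2 - (1 - rho + s) ^+ 2 / 2)) ->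
    (\int[leb]_(s in `]0%R, +oo[) (s ^+ n.-1 * (g s * (s ^+ 2 < n%:R)%R%:R +
       c * K * (s ^+ 2 < 1)%R%:R))%:E <= (c' * K * (rho ^+ n / n%:R))%:E)%E) ->
  forall f : 'rV[R]_n -> R, continuous f -> (forall x, 0 <= f x) ->
    (forall x, ~ Omega x -> f x = 0) ->
    (forall x B, 0 <= B -> (Omega x -> u x <= B) -> f x <= B) ->
    (\int[lebesgue_n n]_t (f (x0 + L *: row_of t) * \1_(tuple_ball n n%:R) t +
         c * K * \1_(tuple_ball n 1) t)%:E <=
     \int[lebesgue_n n]_t (c' * K * \1_Om t)%:E)%E.
Proof.
move=> n0 c0 c'0 H f cf f0 fout fle.
have mO : measurable Om by exact: measurable_rescaled_domain.
have mb c1 := @measurable_tuple_ball R n c1.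
have caff : continuous (fun y : 'rV[R]_n => x0 + L *: y).
  apply: continuousD_fun; first exact: cst_continuous.
  by apply: continuousZ_fun; [exact: cst_continuous|exact: continuous_id_fun].
apply: (@le_integral_rays _ _ (fun t => f (x0 + L *: row_of t) * \1_(tuple_ball n n%:R) t +
   c * K * \1_(tuple_ball n 1) t) (fun t => c' * K * \1_Om t)) => //.
- apply: measurable_funD; apply: measurable_funM => //; try exact: measurable_indic.
  apply: (@measurable_continuous_row_of _ _ (fun y => f (x0 + L *: y))) => y.
  exact: (continuous_comp (@caff y) (@cf _)).
- by apply: measurable_funM => //; exact: measurable_indic.
- by move=> t; rewrite addr_ge0// !mulr_ge0// ltW.
- by move=> t; rewrite !mulr_ge0// ltW.
move=> e e1; have ee : dotv (row_of e) (row_of e) = 1 by rewrite dotv_row_of.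
have [rho rho1 Hr] := ray_barrier hOmega hu Ox0 max0 u0 ee.
have rvd s : x0 + L *: row_of (dilate s e) = x0 + (L * s) *: row_of e.
  congr (_ + _); rewrite -scalerA; congr (_ *: _).
  by apply/rowP => i; rewrite !mxE tnth_mktuple tnth_nseq add0r.
have L2 : L ^+ 2 = K by rewrite sqr_sqrtr// ltW.
pose g s := f (x0 + (L * s) *: row_of e).
apply: (@le_trans _ _ (c' * K * (rho ^+ n / n%:R))%:E).
  apply: le_trans (H g rho _ rho1 _ _ _ _).
  - rewrite le_eqVlt; apply/predU1P; left; apply: eq_integral => s _; congr EFin; congr (_ * _).
    rewrite rvd -/(g s); congr (_ * _ + _ * _); rewrite indicE; congr (nat_of_bool _)%:R.
      by apply/idP/idP; rewrite inE /tuple_ball/= /dilate sqnorm_affine_tuple0 e1 mulr1.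
    by apply/idP/idP; rewrite inE /tuple_ball/= /dilate sqnorm_affine_tuple0 e1 mulr1.
  - apply: continuous_measurable_fun => s; apply: continuous_comp; last exact: cf.
    apply: cvgD; first exact: cvg_cst.
    have lc : (L * t) @[t --> s] --> L * s by apply: cvgM; [exact: cvg_cst|exact: cvg_id].
    exact: (cvgZ lc (cvg_cst (row_of e))).
  - by move=> s s0; exact: f0.
  - move=> s s0 rs; apply: fout => /(Hr s (ltW s0)).1; by rewrite ltNge rs.
  - move=> s s0; apply: fle; first by rewrite divr_ge0// ltW.
    move=> Os; rewrite (_ : K / 2 = u x0); last by field.
    by apply: max0; exact: subset_closure.
  - move=> s s0 rs; apply: fle.
      by apply: mulr_ge0; [exact: ltW|case/andP: rs => r1 r2; nra].
    by move=> _; rewrite -{2}L2; exact: (Hr s (ltW s0)).2.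
rewrite -{1 2}(prednK n0) -(integral_ray_power n.-1 (c' * K)); last exact: le_trans rho1.
rewrite le_eqVlt; apply/predU1P; left; apply: eq_integral => s; rewrite inE/= in_itv/= andbT => s0.
congr EFin; congr (_ * (_ * _)); rewrite indicE; congr (nat_of_bool _)%:R.
apply/idP/idP => [sr|]; first by rewrite inE /rescaled_domain/= rvd; apply/(Hr s (ltW s0)).1.
by rewrite inE /rescaled_domain/= rvd => /(Hr s (ltW s0)).1.
Qed.
End torsion_volume.

Section torsion_volume_bound.
Context {R : realType} {n : nat}.
Notation mR := (measurableTypeR R).
Variables (Omega : set 'rV[R]_n) (u : 'rV[R]_n -> R).
Hypothesis hOmega : bounded_convex_domain Omega.
Hypothesis hu : torsion_function Omega u.
Variable x0 : 'rV[R]_n.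
Hypothesis Ox0 : Omega x0.
Hypothesis max0 : forall y, closure Omega y -> u y <= u x0.
Hypothesis u0 : 0 < u x0.
Notation K := (2 * u x0).
Notation L := (Num.sqrt K).
Notation Om := (@rescaled_domain R n Omega u x0).
Notation W := (fine (lebesgue_n n Om)).

Let K0 : 0 < K. Proof. by rewrite mulr_gt0. Qed.

(** Here f <= K / 2 holds pointwise on Omega, so c' = 1/2 and c = 0 work with a direct comparison of
    integrands. *)
Lemma rescaled_volume_ge4 : (4 <= n)%N -> (pi / Num.sqrt 2) ^+ n <= W.
Proof.
move=> n4; have n0 : (0 < n)%N by apply: leq_trans n4.
have mO : measurable Om by exact: measurable_rescaled_domain.
have core : Num.sqrt n%:R ^+ n * omega n / n.+2%:R + 0 * omega n <= 1 / 2 * W.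
  apply: rescaled_volume_ge => // f cf f0 fout fle.
  have caff : continuous (fun y : 'rV[R]_n => x0 + L *: y).
    apply: continuousD_fun; first exact: cst_continuous.
    by apply: continuousZ_fun; [exact: cst_continuous|exact: continuous_id_fun].
  have mf : measurable_fun setT (fun t : n.-tuple mR => f (x0 + L *: row_of t)).
    apply: (@measurable_continuous_row_of _ _ (fun y => f (x0 + L *: y))) => y.
    exact: (continuous_comp (@caff y) (@cf _)).
  have mb c := @measurable_tuple_ball R n c.
  apply: ge0_le_integral => //.
  - by move=> t _; rewrite lee_fin !mul0r addr0 mulr_ge0.
  - apply/measurable_EFinP; apply: measurable_funD; apply: measurable_funM => //;
      exact: measurable_indic.
  - by apply/measurable_EFinP; apply: measurable_funM => //; exact: measurable_indic.
  - move=> t _; rewrite lee_fin !mul0r addr0.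
    have [Ot|nOt] := pselect (Om t); last by rewrite fout// mul0r mulr_ge0// mulr_ge0// ltW.
    rewrite [X in _ <= _ * X]indicE mem_set// mulr1.
    have fu : f (x0 + L *: row_of t) <= 1 / 2 * K.
      apply: fle => [|Ot']; first by rewrite mulr_ge0// ltW.
      have -> : 1 / 2 * K = u x0 by field.
      by apply: max0; exact: subset_closure.
    apply: le_trans fu; rewrite indicE; case: (_ \in _); rewrite ?mulr1// mulr0.
    exact: f0.
have := @omega_ge R n n4; rewrite -ler_pdivlMr ?divr_gt0// => /le_trans; apply.
move: core; rewrite mul0r addr0; move: W (Num.sqrt _ ^+ n) (omega n) => w v o.
have -> : o * v / (n.+2%:R / 2) = 2 * (v * o / n.+2%:R).
  by rewrite -(addn2 n) natrD; field; rewrite -natrD pnatr_eq0 addn2.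
by move: (v * o / _) => q; lra.
Qed.

(** The constants give W >= 19 pi / 12, and pi^2 / 2 <= 19 pi / 12 amounts to pi <= 19/6. *)
Lemma rescaled_volume_ge2 : n = 2 -> (pi / Num.sqrt 2) ^+ n <= W.
Proof.
move=> n2; have n0 : (0 < n)%N by rewrite n2.
have core : Num.sqrt n%:R ^+ n * omega n / n.+2%:R + 2 / 15 * omega n <= 2 / 5 * W.
  apply: rescaled_volume_ge => //; apply: ray_comparison_bound => // g rho mg r1 g0 gout gcap gbar.
  rewrite n2; exact: (planar_ray mg (ltW K0)).
move: core; move: W => w; rewrite n2 omega2 pi_sqrt2_sq sqr_sqrtr// -[2.+2]/4%N => core.
have := @pi_le R; have := @pi_ge0 R; move: core; set p : R := pi => core p0 p1.
have p2 : p ^+ 2 <= 19 / 6 * p by rewrite expr2 ler_wpM2r.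
lra.
Qed.

(** The constants give W >= 32 sqrt 3 pi / 15, about 11.6, while (pi / sqrt 2)^3 is about 10.96. *)
Lemma rescaled_volume_ge3 : n = 3 -> (pi / Num.sqrt 2) ^+ n <= W.
Proof.
move=> n3; have n0 : (0 < n)%N by rewrite n3.
have core : Num.sqrt n%:R ^+ n * omega n / n.+2%:R + 0 * omega n <= 3 / 8 * W.
  apply: rescaled_volume_ge => //; apply: ray_comparison_bound => // g rho mg r1 g0 gout gcap gbar.
  rewrite n3; exact: (spatial_ray mg (ltW K0)).
move: core; move: W => w; rewrite n3 omega3 (exprS (pi / _)) pi_sqrt2_sq mul0r addr0 -[3.+2]/5%N => core.
have q3 : Num.sqrt 3 ^+ 3 = 3 * Num.sqrt 3 :> R by rewrite exprS sqr_sqrtr// mulrC.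
have r2 : Num.sqrt 2 ^+ 2 = 2 :> R by rewrite sqr_sqrtr.
have r3 : Num.sqrt 3 ^+ 2 = 3 :> R by rewrite sqr_sqrtr.
have := sqrtr_ge0 (2 : R); have := sqrtr_ge0 (3 : R).
have := @pi_le R; have := @pi_ge0 R; move: core; rewrite q3.
have -> : pi / Num.sqrt 2 = pi * (Num.sqrt 2 / 2) :> R.
  have s0 : Num.sqrt 2 != 0 :> R by rewrite sqrtr_eq0 -ltNge.
  by congr (_ * _); apply: (mulfI s0); rewrite mulfV// mulrA -expr2 r2 divff.
move: (Num.sqrt 2 : R) (Num.sqrt 3 : R) r2 r3 => a b a2 b2; set p : R := pi.
move=> core p0 p1 b0 a0.
have a3 : a <= 142 / 100 by nra.
have b3 : 17 / 10 <= b by nra.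
have p2 : p ^+ 2 <= (19 / 6) ^+ 2 by rewrite lerXn2r// nnegrE.
have p3 : p ^+ 2 * (a / 2 / 2) <= 356 / 100.
  apply: (@le_trans _ _ ((19 / 6) ^+ 2 * (142 / 100 / 2 / 2))); last by lra.
  by apply: ler_pM => //; [exact: sqr_ge0|lra|lra].
have p4 : p * (p ^+ 2 * (a / 2 / 2)) <= p * (32 * b / 15).
  by apply: ler_wpM2l => //; lra.
lra.
Qed.

Lemma torsion_volume_ge : (2 <= n)%N ->
  (L * (pi / Num.sqrt 2)) ^+ n <= fine (lebesgue_rV Omega).
Proof.
move=> n2; rewrite (@lebesgue_rescaled _ _ _ u hOmega x0 u0).
have fW : lebesgue_n n Om \is a fin_num.
  by rewrite ge0_fin_numE//; exact: rescaled_finite.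
rewrite fineM// exprMn /=; apply: ler_wpM2l; first by rewrite exprn_ge0// sqrtr_ge0.
have [n4|] := leqP 4 n; first exact: rescaled_volume_ge4.
rewrite ltnS leq_eqVlt => /predU1P[|n3]; first exact: rescaled_volume_ge3.
by apply: rescaled_volume_ge2; apply/eqP; rewrite eqn_leq n2 -ltnS n3.
Qed.
End torsion_volume_bound.

(** * The bound on the normal derivative *)

Theorem theorem2 (R : realType) (n : nat) (hn : (2 <= n)%N)
    (Omega : set 'rV[R]_n) (hOmega : bounded_convex_domain Omega)
    (u : 'rV[R]_n -> R) (hu : torsion_function Omega u) :
  forall (x nu : 'rV[R]_n) (d : R),
    boundary Omega x ->
    interior_unit_normal Omega x nu ->
    is_normal_derivative u x nu d ->
    d <= Num.sqrt 2 / pi * (fine (lebesgue_rV Omega)) `^ (n%:R^-1).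
Proof.
move=> x nu d [cx nOx] hnu hd.
have [Ne bO oO cO] := hOmega.
have {}nOx : ~ Omega x by move/interior_id : oO nOx => ->.
have ux : u x = 0 by exact: (torsion_boundary hOmega hu).
have nn : dotv nu nu = 1 by rewrite -enorm_sq hnu.1.1 expr1n.
have tin := interior_normal_in oO cO bO Ne cx nOx hnu.
have s20 : 0 < Num.sqrt 2 :> R by rewrite sqrtr_gt0.
have rhs0 : 0 <= Num.sqrt 2 / pi * fine (lebesgue_rV Omega) `^ n%:R^-1.
  by rewrite mulr_ge0 ?powR_ge0// divr_ge0 ?pi_ge0// ltW.
have [x0 cx0 max0] := torsion_max hOmega hu.
(* As u x = 0, a linear bound on u along the normal near x bounds the derivative. *)
have dle (k : R) : 
    (\forall t \near 0^'+, 0 < t -> Omega (x + t *: nu) -> u (x + t *: nu) <= k * t) -> d <= k.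
  move=> H; apply: (cvgr_to_le hd); near=> t.
  have t0 : 0 < t by [].
  rewrite ux subr0 ler_pdivrMr//.
  have Ot : Omega (x + t *: nu) by near: t.
  by move: t0 Ot; near: t.
(* If the maximum is at most 0, so is the derivative; otherwise u x0 > 0, as the volume bound
   requires. *)
have [u0|u0] := leP (u x0) 0.
  apply: le_trans rhs0; apply: dle; near=> t => t0 Ot; rewrite mul0r (le_trans _ u0)//.
  by apply: max0; exact: subset_closure.
have Ox0 : Omega x0.
  apply: contrapT => nO; have := torsion_boundary hOmega hu cx0 nO.
  by move=> e; rewrite e ltxx in u0.
set L := Num.sqrt (2 * u x0).
have L0 : 0 < L by rewrite sqrtr_gt0 mulr_gt0.
(* At x + t nu the height above the supporting hyperplane is exactly t, so the barrier gives u <= L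
   t for t <= L. *)
have dL : d <= L.
  apply: dle; near=> t => t0 Ot.
  have E : dotv (x + t *: nu - x) nu = t by rewrite addrAC subrr add0r dotvZl nn mulr1.
  have := torsion_barrier hOmega hu hnu.1 max0 (ltW u0) (subset_closure Ot).
  rewrite E => H; apply: (le_trans (H _)).
    by near: t; exact: nbhs_right_le.
  by rewrite -/L gerBl divr_ge0// sqr_ge0.
apply: (le_trans dL).
have V := torsion_volume_ge hOmega hu Ox0 max0 u0 hn; rewrite -/L in V.
have n0 : (n%:R : R) != 0 by rewrite pnatr_eq0 -lt0n (leq_trans _ hn).
have p0 : 0 < pi :> R := pi_gt0 R.
have q0 : 0 <= L * (pi / Num.sqrt 2) by rewrite mulr_ge0 ?divr_ge0 ?(ltW L0) ?(ltW p0) ?(ltW s20).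
have : L * (pi / Num.sqrt 2) <= fine (lebesgue_rV Omega) `^ n%:R^-1.
  have <- : ((L * (pi / Num.sqrt 2)) ^+ n) `^ n%:R^-1 = L * (pi / Num.sqrt 2).
    by rewrite -powR_mulrn// -powRrM divff// powRr1.
  by apply: ge0_ler_powR; rewrite ?nnegrE ?invr_ge0 ?exprn_ge0// (le_trans _ V)// exprn_ge0.
move=> h; have := ler_wpM2l (ltW (divr_gt0 s20 p0)) h; congr (_ <= _).
have s2n : Num.sqrt 2 != 0 :> R by rewrite gt_eqF.
have pn : pi != 0 :> R by rewrite gt_eqF.
by move: pi (Num.sqrt 2) pn s2n => a b pn s2n; field; rewrite s2n pn.
Unshelve. all: by end_near.
Qed.
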